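(* Let $q\in\mathcal{L}_2[0,L]$. For any $\varepsilon>0$ there exists $N\in\mathbb{N}$ such that every zero of the entire function $\rho\mapsto S(\rho,L)$ is approximated by a corresponding zero of $\rho\mapsto S_N(\rho,L)$ with error at most $\varepsilon$ (uniformly over all zeros), and $S_N(\cdot,L)$ has no other zeros.
   Context: Let $L>0$, $q$ complex valued. $S(\rho,x)$ is the solution of $-y''+q(x)y=\rho^2y$ on $(0,L)$ with $S(\rho,0)=0$, $S'(\rho,0)=1$. $\operatorname{sinc}(z)=\frac{\sin\pi z}{\pi z}$, $\operatorname{sinc}(0)=1$. With $s_n(L)=\frac{(-1)^n(2n+1)\pi}{L}S(\frac{(2n+1)\pi}{2L},L)-2$, the partial sum is $S_N(\rho,L)=\frac{\sin\rho L}{\rho}+\frac{1}{2\rho\sin\rho L}\sum_{n=0}^{N-1}s_n(L)\bigl(\operatorname{sinc}(\frac{2\rho L}\pi-2n-1)+\operatorname{sinc}(\frac{2\rho L}\pi+2n+1)\bigr)$, understood as an entire function of $\rho$ (singularities at $\rho=0$ and at zeros of $\sin\rho L$ being removable). *)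

(* Defs.v *)
From HB Require Import structures.
From mathcomp Require Import all_boot all_order all_algebra.
From mathcomp Require Import all_classical all_reals all_analysis.
From mathcomp Require Import complex.
Set Implicit Arguments. Unset Strict Implicit. Unset Printing Implicit Defensive.
Import Order.TTheory GRing.Theory Num.Theory.
Import numFieldNormedType.Exports.
Local Open Scope classical_set_scope.
Local Open Scope ring_scope.
Local Open Scope complex_scope.

Section Defs.
Variable R : realType.
Local Notation C := R[i].

Definition cre (z : C) : R := @complex.Re R z.
Definition cim (z : C) : R := @complex.Im R z.

Definition cabs (z : C) : R := Num.sqrt (cre z ^+ 2 + cim z ^+ 2).

Definition ccontinuous (f : C -> C) : Prop :=
  forall z (e : R), 0 < e -> exists2 d : R, 0 < d &
    forall w, cabs (w - z) < d -> cabs (f w - f z) < e.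

Definition csin (z : C) : C :=
  (sin (cre z) * ((expR (cim z) + expR (- cim z)) / 2))
  +i* (cos (cre z) * ((expR (cim z) - expR (- cim z)) / 2)).

Definition csinc (z : C) : C :=
  if z == 0 then 1 else csin ((pi : R)%:C * z) / ((pi : R)%:C * z).

Definition cintegral (a b : R) (f : R -> C) : C :=
  (\int[@lebesgue_measure R]_(t in `[a, b]) cre (f t))
  +i* (\int[@lebesgue_measure R]_(t in `[a, b]) cim (f t)).

Definition itv0 (L : R) : set R := `[0, L].

Definition in_L2 (L : R) (q : R -> C) : Prop :=
  measurable_fun `[0, L] (fun x => cre (q x)) /\
  measurable_fun `[0, L] (fun x => cim (q x)) /\
  (\int[@lebesgue_measure R]_(x in itv0 L) ((cre (q x)) ^+ 2)%:E < +oo)%E /\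
  (\int[@lebesgue_measure R]_(x in itv0 L) ((cim (q x)) ^+ 2)%:E < +oo)%E.

(* y is the (Caratheodory) solution on [0,L] of -y'' + q y = rho^2 y with
   y(0) = 0, y'(0) = 1:  y and y' are absolutely continuous on [0,L], i.e.
   y(x) = \int_0^x y'(t) dt, y'(x) = 1 + \int_0^x y''(t) dt, where
   y'' = (q - rho^2) y a.e. *)
Definition is_S_solution (L : R) (q : R -> C) (rho : C) (y : R -> C) : Prop :=
  exists dy : R -> C,
    (@lebesgue_measure R).-integrable (itv0 L) (EFin \o (fun t => cre (dy t))) /\
    (@lebesgue_measure R).-integrable (itv0 L) (EFin \o (fun t => cim (dy t))) /\
    (@lebesgue_measure R).-integrable (itv0 L)
       (EFin \o (fun t => cre ((q t - rho ^+ 2) * y t))) /\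
    (@lebesgue_measure R).-integrable (itv0 L)
       (EFin \o (fun t => cim ((q t - rho ^+ 2) * y t))) /\
    forall x, 0 <= x <= L ->
      y x = cintegral 0 x dy /\
      dy x = 1 + cintegral 0 x (fun t => (q t - rho ^+ 2) * y t).

Definition s_coef (L : R) (S : C -> R -> C) (n : nat) : C :=
  (-1) ^+ n * ((n.*2.+1)%:R * (pi : R)%:C / L%:C)
    * S ((n.*2.+1)%:R * (pi : R)%:C / (2 * L%:C)) L - 2.

(* the formula for S_N(rho, L) (valid for rho <> 0, sin(rho L) <> 0) *)
Definition SN_formula (L : R) (S : C -> R -> C) (N : nat) (rho : C) : C :=
  csin (rho * L%:C) / rho
  + (2 * rho * csin (rho * L%:C))^-1 *
    \sum_(n < N) s_coef L S n *
       (csinc (2 * rho * L%:C / (pi : R)%:C - (n.*2.+1)%:R)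
        + csinc (2 * rho * L%:C / (pi : R)%:C + (n.*2.+1)%:R)).

Definition zero_atleast (f : C -> C) (z : C) (j : nat) : Prop :=
  exists2 g : C -> C, ccontinuous g & forall w, f w = (w - z) ^+ j.+1 * g w.

(* zeros of f counted with multiplicity: pairs (z, j) with j < mult(z) *)
Definition zeros_mult (f : C -> C) : set (C * nat) :=
  [set p | zero_atleast f p.1 p.2].

End Defs.

(* Main.v *)
Require Import Defs.
From HB Require Import structures.
From mathcomp Require Import all_boot all_order all_algebra.
From mathcomp Require Import all_classical all_reals all_analysis.
From mathcomp Require Import complex.
From mathcomp Require Import measurable_realfun ring lra zify.
Import Order.TTheory GRing.Theory Num.Theory.
Import numFieldNormedType.Exports.
Local Open Scope classical_set_scope.
Local Open Scope ring_scope.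
Local Open Scope complex_scope.
Set Implicit Arguments.
Unset Strict Implicit.
Unset Printing Implicit Defensive.

(* An entire function is represented here as a locally uniform limit of
   polynomials; d'Alembert's lemma then yields the maximum principle, division
   by a zero, and a Hurwitz theorem in which the zeros of a perturbation are
   split off one at a time, so that no contour integration is needed.

   Write F (rho) = rho S(rho, L) - sin (rho L).  Variation of constants gives
   |F (rho)| <= K exp (|Im rho| L) / |rho|, using only that q is integrable, and
   Picard iteration shows that S(., L) is entire and even.  The function
   G (rho) = S_N (rho) - sin (rho L) / rho is the partial interpolation series for
   F (rho) / rho: F - rho G vanishes at the zeros of cos (rho L) of modulus less
   than N pi / L.  Comparing F - rho G with cos (rho L) on the circle
   |rho| = N pi / L and applying the maximum principle to their quotient gives
   |F (rho) - rho G (rho)| <= C exp (|Im rho| L) / sqrt N on the whole plane.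

   Outside a large disc, S and S_N are therefore both small perturbations of
   sin (rho L) / rho, and each has exactly one zero near every m pi / L; inside
   that disc S_N converges uniformly to S, and Hurwitz's theorem applies. *)

(** * The modulus on C *)

(** The obstacle is uniformity: one N must serve infinitely many zeros. Every error is therefore
    measured against exp (|Im rho| L), the size of sin (rho L) away from its zeros, and rho S rather
    than S is compared with rho S_N, so that no decay in rho is asked of the error. Near a remote
    zero the picture is moved to the origin by the periodicity of the sine, and a single Hurwitz
    constant covers all of them; the large disc and the admissible error are thus fixed by S and eps
    alone, before N is chosen. The rate 1 / sqrt N arises as follows: the decay of F bounds the
    coefficients of G by inverse nodes, and the sum of 1 / (node (N pi / L - node)) is a harmonic
    sum divided by N, for which the crude bound 2 sqrt N is enough. Evenness of S supplies the zeros
    of F - rho G at the negative nodes. Multiplicities are carried by factoring a function into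
    linear factors over a list and a factor without zeros in the region considered; a repeated zero
    is a repeated entry. *)

Section Cabs.
Variable R : realType.
Local Notation C := R[i].
Implicit Types z w : C.

Lemma cabsE z : cabs z = complex.Re `|z|.
Proof. by rewrite normc_def. Qed.

Lemma normcabs z : `|z| = (cabs z)%:C.
Proof. by rewrite normc_def. Qed.

Lemma cabsM z w : cabs (z * w) = cabs z * cabs w.
Proof.
have : (cabs (z * w))%:C = (cabs z)%:C * (cabs w)%:C by rewrite -!normcabs normrM.
by rewrite -rmorphM => /complexI.
Qed.

Lemma cabs0 : cabs (0 : C) = 0.
Proof. by rewrite cabsE normr0. Qed.

Lemma cabs1 : cabs (1 : C) = 1.
Proof. by rewrite cabsE normr1. Qed.

Lemma cabs_ge0 z : 0 <= cabs z.
Proof. exact: sqrtr_ge0. Qed.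
Hint Extern 0 (is_true (_ <= cabs _)) => exact: cabs_ge0 : core.

Lemma cabs_eq0 z : (cabs z == 0) = (z == 0).
Proof.
apply/eqP/eqP => [h|->]; last exact: cabs0.
by apply/eqP; rewrite -normr_eq0 normcabs h.
Qed.

Lemma cabs_gt0 z : (0 < cabs z) = (z != 0).
Proof. by rewrite lt_def cabs_eq0 cabs_ge0 andbT. Qed.

Lemma cabsN z : cabs (- z) = cabs z.
Proof. by rewrite !cabsE normrN. Qed.

Lemma cabsB z w : cabs (z - w) = cabs (w - z).
Proof. by rewrite -cabsN opprB. Qed.

Lemma ler_cabsD z w : cabs (z + w) <= cabs z + cabs w.
Proof. by rewrite -lecR rmorphD /= -!normcabs ler_normD. Qed.

Lemma ler_cabsB z w : cabs (z - w) <= cabs z + cabs w.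
Proof. by rewrite -(cabsN w); exact: ler_cabsD. Qed.

Lemma lerB_cabsD z w : cabs z - cabs w <= cabs (z + w).
Proof. rewrite lerBlDr; have := ler_cabsB (z + w) w; by rewrite addrK. Qed.

Lemma lerB_cabs z w : cabs z - cabs w <= cabs (z - w).
Proof. by rewrite -(cabsN w) lerB_cabsD. Qed.

Lemma cabsV z : cabs z^-1 = (cabs z)^-1.
Proof.
have [->|z0] := eqVneq z 0; first by rewrite invr0 cabs0 invr0.
apply: (@mulfI _ (cabs z)); first by rewrite cabs_eq0.
by rewrite -cabsM !mulfV ?cabs_eq0 // cabs1.
Qed.

Lemma cabsf z w : cabs (z / w) = cabs z / cabs w.
Proof. by rewrite cabsM cabsV. Qed.

Lemma cabsX z n : cabs (z ^+ n) = cabs z ^+ n.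
Proof. by elim: n => [|n IH]; rewrite ?cabs1 // !exprS cabsM IH. Qed.

Lemma cabsR (x : R) : cabs x%:C = `|x|.
Proof. by rewrite /cabs /= expr0n addr0 sqrtr_sqr. Qed.

Lemma cabs_nat n : cabs (n%:R : C) = n%:R.
Proof. by rewrite -(rmorph_nat (real_complex R)) cabsR ger0_norm. Qed.

Lemma cabs_prod (I : Type) (s : seq I) (f : I -> C) :
  cabs (\prod_(i <- s) f i) = \prod_(i <- s) cabs (f i).
Proof. by elim: s => [|a s IH]; rewrite ?big_nil ?cabs1 // !big_cons cabsM IH. Qed.

Lemma ler_cabs_sum (I : Type) (s : seq I) (P : pred I) (f : I -> C) :
  cabs (\sum_(i <- s | P i) f i) <= \sum_(i <- s | P i) cabs (f i).
Proof.
elim/big_ind2: _ => [|a b c d h1 h2|//]; first by rewrite cabs0.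
exact: le_trans (ler_cabsD _ _) (lerD h1 h2).
Qed.

Lemma sqr_cabs z : cabs z ^+ 2 = cre z ^+ 2 + cim z ^+ 2.
Proof. by rewrite /cabs sqr_sqrtr // addr_ge0 // sqr_ge0. Qed.

Lemma cre_le_cabs z : `|cre z| <= cabs z.
Proof.
rewrite -(@ler_pXn2r _ 2) ?nnegrE // sqr_cabs real_normK ?num_real //.
by rewrite lerDl sqr_ge0.
Qed.

Lemma cim_le_cabs z : `|cim z| <= cabs z.
Proof.
rewrite -(@ler_pXn2r _ 2) ?nnegrE // sqr_cabs real_normK ?num_real //.
by rewrite lerDr sqr_ge0.
Qed.

Lemma cabs_le_reim z : cabs z <= `|cre z| + `|cim z|.
Proof.
rewrite -(@ler_pXn2r _ 2) ?nnegrE ?addr_ge0 // sqr_cabs sqrrD !real_normK ?num_real //.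
by rewrite [leRHS]addrAC lerDl mulrn_wge0 // mulr_ge0.
Qed.

Lemma creD z w : cre (z + w) = cre z + cre w. Proof. by case: z w => ? ? []. Qed.
Lemma cimD z w : cim (z + w) = cim z + cim w. Proof. by case: z w => ? ? []. Qed.
Lemma creN z : cre (- z) = - cre z. Proof. by case: z. Qed.
Lemma cimN z : cim (- z) = - cim z. Proof. by case: z. Qed.
Lemma creM z w : cre (z * w) = cre z * cre w - cim z * cim w.
Proof. by case: z w => ? ? []. Qed.
Lemma cimM z w : cim (z * w) = cre z * cim w + cim z * cre w.
Proof. by case: z w => ? ? [] *; rewrite /cim /cre /= addrC. Qed.
Lemma creR (x : R) : cre x%:C = x. Proof. by []. Qed.
Lemma cimR (x : R) : cim x%:C = 0. Proof. by []. Qed.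
Lemma cE z : z = cre z +i* cim z. Proof. by case: z. Qed.
Lemma c_ext z w : cre z = cre w -> cim z = cim w -> z = w.
Proof. by case: z w => ? ? [] ? ? /= -> ->. Qed.

(** * Pointwise continuity and extreme values *)

Definition ccont_at (f : C -> C) z := forall e : R, 0 < e -> exists2 d : R, 0 < d &
    forall w, cabs (w - z) < d -> cabs (f w - f z) < e.


Lemma ccont_cst (c : C) z : ccont_at (fun=> c) z.
Proof. by move=> e e0; exists 1 => // w _; rewrite subrr cabs0. Qed.

Lemma ccont_id z : ccont_at id z.
Proof. by move=> e e0; exists e. Qed.

Lemma ccontD f g z : ccont_at f z -> ccont_at g z -> ccont_at (fun w => f w + g w) z.
Proof.
move=> cf cg e e0; have e20 : 0 < e / 2 by lra.
have [d1 d10 h1] := cf _ e20; have [d2 d20 h2] := cg _ e20.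
exists (Num.min d1 d2); first by rewrite lt_min d10.
move=> w; rewrite lt_min => /andP[/h1 {}h1 /h2 {}h2].
rewrite opprD addrACA; apply: le_lt_trans (ler_cabsD _ _) _; lra.
Qed.

Lemma ccontM f g z : ccont_at f z -> ccont_at g z -> ccont_at (fun w => f w * g w) z.
Proof.
move=> cf cg e e0; pose A := cabs (f z); pose B := cabs (g z).
have A0 : 0 <= A by exact: cabs_ge0.
have B0 : 0 <= B by exact: cabs_ge0.
have K0 : 0 < 1 + A + B by lra.
pose e' := Num.min 1 (e / (1 + A + B)).
have e'0 : 0 < e' by rewrite lt_min ltr01 divr_gt0.
have e'1 : e' <= 1 by rewrite ge_min lexx.
have e'e : e' * (1 + A + B) <= e by rewrite -ler_pdivlMr // ge_min lexx orbT.
have [d1 d10 h1] := cf _ e'0; have [d2 d20 h2] := cg _ e'0.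
exists (Num.min d1 d2); first by rewrite lt_min d10.
move=> w; rewrite lt_min => /andP[/h1 {}h1 /h2 {}h2].
clearbody e'.
have -> : f w * g w - f z * g z = (f w - f z) * (g w - g z) + f z * (g w - g z) + g z * (f w - f z) by ring.
apply: le_lt_trans (ler_cabsD _ _) _; rewrite !cabsM.
have h3 := ler_cabsD ((f w - f z) * (g w - g z)) (f z * (g w - g z)).
rewrite !cabsM -/A -/B in h3 *.
have a0 := cabs_ge0 (f w - f z); have b0 := cabs_ge0 (g w - g z).
set a := cabs (f w - f z) in h1 h3 a0 *; set b := cabs (g w - g z) in h2 h3 b0 *.
have hab : a * b <= a by apply: ler_piMr => //; lra.
have hA : A * b <= A * e' by apply: ler_wpM2l => //; exact: ltW.
have hB : B * a <= B * e' by apply: ler_wpM2l => //; exact: ltW.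
lra.
Qed.

Lemma ccontN f z : ccont_at f z -> ccont_at (fun w => - f w) z.
Proof.
move=> cf e e0; have [d d0 h] := cf e e0; exists d => // w /h.
by rewrite -opprD cabsN.
Qed.

Lemma ccontB f g z : ccont_at f z -> ccont_at g z -> ccont_at (fun w => f w - g w) z.
Proof. by move=> cf cg; apply: ccontD => //; exact: ccontN. Qed.

Lemma ccontV f z : f z != 0 -> ccont_at f z -> ccont_at (fun w => (f w)^-1) z.
Proof.
move=> fz cf e e0; have A0 : 0 < cabs (f z) by rewrite cabs_gt0.
set A := cabs (f z) in A0.
have e'0 : 0 < Num.min (A / 2) (e * A ^+ 2 / 2).
  by rewrite lt_min !divr_gt0 // mulr_gt0 // exprn_gt0.
have [d d0 h] := cf _ e'0; exists d => // w /h.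
rewrite lt_min => /andP[h1 h2].
have fw : A / 2 < cabs (f w).
  have := lerB_cabs (f z) (f w); rewrite cabsB -/A; lra.
have fw0 : f w != 0 by rewrite -cabs_gt0; lra.
have -> : (f w)^-1 - (f z)^-1 = (f z - f w) / (f w * f z) by field; rewrite fz.
rewrite cabsf cabsM cabsB ltr_pdivrMr -/A; last by rewrite mulr_gt0 //; lra.
move: h2 fw; set a := cabs (_ - _); set b := cabs _ => h2 fw.
apply: lt_trans h2 _; rewrite expr2.
have : 0 < e * A by nra.
nra.
Qed.

(** Moves continuity to [R * R], where compactness of boxes and the extreme value theorem are
    available. *)
Lemma mkc_cont (f : C -> C) (p : R * R) : ccont_at f (p.1 +i* p.2) ->
  {for p, continuous (fun q : R * R => cabs (f (q.1 +i* q.2)))}.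
Proof.
move=> cf; apply/cvgrPdist_lt => e e0.
have [d d0 h] := cf _ e0.
have d20 : 0 < d / 2 by lra.
near=> q.
have hq1 : `|p.1 - q.1| < d / 2.
  near: q; apply: (@cvgr_dist_lt _ R) => //; exact: cvg_fst.
have hq2 : `|p.2 - q.2| < d / 2.
  near: q; apply: (@cvgr_dist_lt _ R) => //; exact: cvg_snd.
have hw : cabs ((q.1 +i* q.2) - (p.1 +i* p.2)) < d.
  rewrite cabsB; apply: le_lt_trans (cabs_le_reim _) _; rewrite /cre /cim /=; lra.
have := h _ hw; rewrite ltr_norml.
have := lerB_cabs (f (q.1 +i* q.2)) (f (p.1 +i* p.2)).
have := lerB_cabs (f (p.1 +i* p.2)) (f (q.1 +i* q.2)).
rewrite (cabsB (f (p.1 +i* p.2))) => *; apply/andP; split; lra.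
Unshelve. all: by end_near.
Qed.

(** One compact set for two uses: a closed disc when [s = 0] and a circle when [s = r]. *)
Definition annulus (c : C) (s r : R) : set (R * R) :=
  [set p | s <= cabs ((p.1 +i* p.2) - c) <= r].

Lemma annulus_compact c s r : compact (annulus c s r).
Proof.
have cc : continuous (fun p : R * R => cabs ((p.1 +i* p.2) - c)).
  move=> p; apply: (@mkc_cont (fun w => w - c)); apply: ccontB; [exact: ccont_id|exact: ccont_cst].
apply: (@subclosed_compact _ _ (`[cre c - r, cre c + r] `*` `[cim c - r, cim c + r])).
- rewrite (_ : annulus c s r = (fun p : R * R => cabs ((p.1 +i* p.2) - c)) @^-1` `[s, r]%classic); last first.
    by apply/seteqP; split => p /=; rewrite /annulus /= in_itv.
  by apply: closed_comp => [p _|]; [exact: cc|exact: itv_closed].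
- by apply: compact_setX; exact: segment_compact.
move=> [x y]; rewrite /annulus /= => /andP[_ h]; rewrite !in_itv /=.
have := le_trans (cre_le_cabs _) h; have := le_trans (cim_le_cabs _) h.
by rewrite !creD !cimD creN cimN !ler_norml /cre /cim /= => /andP[? ?] /andP[? ?]; split; apply/andP; split; lra.
Qed.

Lemma annulus_max (f : C -> C) (c : C) (s r : R) : 0 <= r -> s <= r ->
  (forall w, s <= cabs (w - c) <= r -> ccont_at f w) ->
  exists2 m, s <= cabs (m - c) <= r &
    forall w, s <= cabs (w - c) <= r -> cabs (f w) <= cabs (f m).
Proof.
move=> r0 sr cf.
have A0 : annulus c s r !=set0.
  exists (cre c + r, cim c); rewrite /annulus /=.
  have -> : (cre c + r) +i* cim c - c = r%:C.
    by apply: c_ext; rewrite !(creD, cimD, creN, cimN) /=; ring.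
  by rewrite cabsR ger0_norm // sr lexx.
have [|p] := compact_EVT_max A0 (@annulus_compact c s r) (f := fun q => cabs (f (q.1 +i* q.2))).
  by apply: continuous_in_subspaceT => q; rewrite inE => hq; apply: mkc_cont; exact: cf.
rewrite inE => hp hm; exists (p.1 +i* p.2) => // w hw.
by have := hm (cre w, cim w); rewrite inE /annulus /= -cE => /(_ hw).
Qed.

Lemma annulus_min (f : C -> C) (c : C) (s r : R) : 0 <= r -> s <= r ->
  (forall w, s <= cabs (w - c) <= r -> ccont_at f w) ->
  exists2 m, s <= cabs (m - c) <= r &
    forall w, s <= cabs (w - c) <= r -> cabs (f m) <= cabs (f w).
Proof.
move=> r0 sr cf.
have A0 : annulus c s r !=set0.
  exists (cre c + r, cim c); rewrite /annulus /=.
  have -> : (cre c + r) +i* cim c - c = r%:C.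
    by apply: c_ext; rewrite !(creD, cimD, creN, cimN) /=; ring.
  by rewrite cabsR ger0_norm // sr lexx.
have [|p] := compact_EVT_min A0 (@annulus_compact c s r) (f := fun q => cabs (f (q.1 +i* q.2))).
  by apply: continuous_in_subspaceT => q; rewrite inE => hq; apply: mkc_cont; exact: cf.
rewrite inE => hp hm; exists (p.1 +i* p.2) => // w hw.
by have := hm (cre w, cim w); rewrite inE /annulus /= -cE => /(_ hw).
Qed.

(* D'Alembert's lemma: [h = s b] with [b ^+ k = tau / g z0] moves the value
   [tau + h ^+ k * g] outwards along the ray through [tau]. *)
Lemma dalembert (tau : C) (g : C -> C) (z0 : C) (k : nat) (r : R) :
  (0 < k)%N -> tau != 0 -> g z0 != 0 -> ccont_at g z0 -> 0 < r ->
  exists2 w, cabs (w - z0) < r & cabs tau < cabs (tau + (w - z0) ^+ k * g w).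
Proof.
move=> k0 tau0 g0 cg r0.
pose b := k.-root (tau / g z0).
have bk : b ^+ k = tau / g z0 by rewrite /b rootCK.
have [d d0 hd] := cg _ (ltac:(by rewrite cabs_gt0) : 0 < cabs (g z0)).
pose B := cabs b + 1.
have B0 : 0 < B by rewrite ltr_wpDl.
pose s := Num.min 1 (Num.min d r / B).
have s0 : 0 < s by rewrite lt_min ltr01 divr_gt0 // lt_min d0.
have s1 : s <= 1 by rewrite ge_min lexx.
have sB : s * B <= Num.min d r by rewrite -ler_pdivlMr // ge_min lexx orbT.
have hw : cabs (s%:C * b) < Num.min d r.
  apply: lt_le_trans sB; rewrite cabsM cabsR ger0_norm; last exact: ltW.
  by rewrite ltr_pM2l // ltrDl.
exists (z0 + s%:C * b); rewrite (addrC z0) addrK.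
  by apply: lt_le_trans hw _; rewrite ge_min lexx orbT.
have hg : cabs (g (s%:C * b + z0) - g z0) < cabs (g z0).
  by apply: hd; rewrite addrK; apply: lt_le_trans hw _; rewrite ge_min lexx.
set D := g _ - g z0 in hg.
have -> : g (s%:C * b + z0) = D + g z0 by rewrite /D subrK.
(* The gain [s ^ k * tau] points along [tau]; the error is smaller than it by the factor
   [|D| / |g z0| < 1]. *)
have -> : tau + (s%:C * b) ^+ k * (D + g z0) = (1 + s%:C ^+ k) * tau + s%:C ^+ k * (tau / g z0) * D.
  by rewrite exprMn bk; field.
apply: lt_le_trans (lerB_cabsD _ _).
rewrite !cabsM cabsV cabsX cabsR (ger0_norm (ltW s0)).
have -> : cabs (1 + s%:C ^+ k) = 1 + s ^+ k.
  rewrite -rmorphXn -(rmorph1 (real_complex R)) -rmorphD cabsR ger0_norm //.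
  by rewrite addr_ge0 // exprn_ge0 // ltW.
have sk : 0 < s ^+ k by rewrite exprn_gt0.
have t0 : 0 < cabs tau by rewrite cabs_gt0.
have gz0 : 0 < cabs (g z0) by rewrite cabs_gt0.
rewrite mulrDl mul1r -addrA ltrDl -!mulrA -mulrBr mulr_gt0 //.
have -> : cabs tau - cabs tau * ((cabs (g z0))^-1 * cabs D) = cabs tau * (1 - cabs D / cabs (g z0)) by ring.
by rewrite mulr_gt0 // subr_gt0 ltr_pdivrMr // mul1r.
Qed.

End Cabs.
#[export] Hint Extern 0 (is_true (_ <= cabs _)) => exact: cabs_ge0 : core.

(** * Locally uniform limits of polynomials *)

Section Entire.
Variable R : realType.
Local Notation C := R[i].
Implicit Types (z w c : C) (f g h : C -> C).

(** The form in which limits of estimates are taken throughout: an error [b / (m + 1)] valid for all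
    [m] is dropped. *)
Lemma le_archi (x a b : R) : (forall m : nat, x <= a + b / m.+1%:R) -> x <= a.
Proof.
move=> h; rewrite leNgt; apply/negP => ax.
pose m := Num.bound (`|b| / (x - a)).
have xa : 0 < x - a by rewrite subr_gt0.
have hm : `|b| / (x - a) < m%:R by apply: archi_boundP; rewrite divr_ge0 // ltW.
have hm1 : `|b| / (x - a) < m.+1%:R by apply: lt_trans hm _; rewrite ltr_nat.
have := h m; rewrite leNgt => /negP; apply.
rewrite -ltrBrDl ltr_pdivrMr ?ltr0n //.
apply: le_lt_trans (ler_norm b) _.
by move: hm1; rewrite ltr_pdivrMr // mulrC.
Qed.

(** The supremum of the lower bounds [u n - b n] lies below every [u m + b m]. The rate [b] is kept,
    as the later estimates need it and not mere convergence. *)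
Lemma real_limit (u b : nat -> R) :
  (forall n m, (n <= m)%N -> `|u n - u m| <= b n) -> exists l, forall n, `|u n - l| <= b n.
Proof.
move=> h.
have h' n m : u n - b n <= u m + b m.
  have bn := le_trans (normr_ge0 _) (h n n (leqnn _)).
  have bm := le_trans (normr_ge0 _) (h m m (leqnn _)).
  have [/h|/ltnW/h] := leqP n m; rewrite ler_norml => /andP[]; lra.
pose A := range (fun n => u n - b n).
have hA : has_sup A.
  split; first by exists (u 0%N - b 0%N), 0%N.
  by exists (u 0%N + b 0%N) => _ [n _ <-].
exists (sup A) => n; rewrite ler_norml; apply/andP; split.
  rewrite lerBrDl -lerBrDr opprK; apply: ge_sup; first by case: hA.
  by move=> _ [m _ <-].
rewrite lerBlDr -lerBlDl; apply: ub_le_sup; first by case: hA.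
by exists n.
Qed.

Lemma complex_limit (u : nat -> C) (b : nat -> R) :
  (forall n m, (n <= m)%N -> cabs (u n - u m) <= b n) ->
  exists l, forall n, cabs (u n - l) <= b n + b n.
Proof.
move=> h.
have [l1 h1] : exists l, forall n, `|cre (u n) - l| <= b n.
  apply: real_limit => n m nm; apply: le_trans (h n m nm).
  by rewrite -creN -creD cre_le_cabs.
have [l2 h2] : exists l, forall n, `|cim (u n) - l| <= b n.
  apply: real_limit => n m nm; apply: le_trans (h n m nm).
  by rewrite -cimN -cimD cim_le_cabs.
exists (l1 +i* l2) => n; apply: le_trans (cabs_le_reim _) _.
by rewrite creD cimD creN cimN lerD.
Qed.

Lemma ccont_horner (p : {poly C}) z : ccont_at (horner p) z.
Proof.
elim/poly_ind: p => [|p c IH].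
  have -> : horner (0 : {poly C}) = (fun=> 0) by apply/funext => w; rewrite horner0.
  exact: ccont_cst.
have -> : horner (p * 'X + c%:P) = (fun w => p.[w] * w + c).
  by apply/funext => w; rewrite !hornerE.
by apply: ccontD; [apply: ccontM => //; exact: ccont_id | exact: ccont_cst].
Qed.

(** At an interior maximum [m] with nonzero value, [p - p.[m]] is [('X - m) ^ k * q] with [q]
    nonzero at [m] and [k > 0], and [dalembert] finds a larger modulus nearby; the alternative is a
    constant polynomial. *)
Lemma poly_max (p : {poly C}) (r M : R) : 0 < r ->
  (forall w, cabs w = r -> cabs p.[w] <= M) -> forall w, cabs w <= r -> cabs p.[w] <= M.
Proof.
move=> r0 h.
have hr : cabs r%:C = r by rewrite cabsR gtr0_norm.
have M0 : 0 <= M by apply: le_trans (cabs_ge0 _) (h _ hr).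
have [m hm hmax] := annulus_max (c := (0 : C)) (f := horner p) (ltW r0) (ltW r0 : 0 <= r) (fun w _ => ccont_horner p w).
rewrite subr0 in hm; case/andP: hm => _ hm.
suff hM : cabs p.[m] <= M.
  by move=> w hw; apply: le_trans hM; apply: hmax; rewrite subr0 hw cabs_ge0.
have [/eqP mr|mr] := boolP (cabs m == r); first exact: h.
have {}mr : cabs m < r by rewrite lt_neqAle mr.
have [t0|t0] := eqVneq p.[m] 0; first by rewrite t0 cabs0.
have [q0|q0] := eqVneq (p - p.[m]%:P) 0.
  have := h _ hr; have -> : p.[r%:C] = p.[m] => //.
  by rewrite {1}(subr0_eq q0) hornerC.
have [k [q hq e]] := multiplicity_XsubC (p - p.[m]%:P) m.
rewrite q0 /= in hq.
have k0 : (0 < k)%N.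
  case: k e => // e.
  have : root (p - p.[m]%:P) m by rewrite rootE !hornerE subrr.
  by rewrite e expr0 mulr1 (negbTE hq).
have [w hw] := dalembert k0 t0 hq (ccont_horner q m) (ltac:(by rewrite subr_gt0) : 0 < r - cabs m).
have -> : p.[m] + (w - m) ^+ k * q.[w] = p.[w].
  have := congr1 (horner ^~ w) e; rewrite /= !hornerE mulrC => <-; ring.
rewrite ltNge => /negP[]; apply: hmax; rewrite subr0 cabs_ge0 /=.
have := ler_cabsD (w - m) m; rewrite subrK; lra.
Qed.

Definition entire f := forall r e : R, 0 < e ->
  exists p : {poly C}, forall z, cabs z <= r -> cabs (f z - p.[z]) <= e.

Lemma entire_ext f g : f =1 g -> entire f -> entire g.
Proof. by move=> /funext ->. Qed.

Lemma entire_horner p : entire (horner p).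
Proof. by move=> r e e0; exists p => z _; rewrite subrr cabs0 ltW. Qed.

Lemma entire_cst c : entire (fun=> c).
Proof. by apply: entire_ext (entire_horner c%:P) => w; rewrite hornerC. Qed.

Lemma entire_id : entire id.
Proof. by apply: entire_ext (entire_horner 'X) => w; rewrite hornerX. Qed.

Lemma entire_lim f : (forall r e : R, 0 < e ->
   exists2 g, entire g & forall z, cabs z <= r -> cabs (f z - g z) <= e) -> entire f.
Proof.
move=> h r e e0; have e20 : 0 < e / 2 by lra.
have [g eg hg] := h r _ e20; have [p hp] := eg r _ e20.
exists p => z hz; have := hp z hz; have := hg z hz.
have := ler_cabsD (f z - g z) (g z - p.[z]); rewrite addrA subrK; lra.
Qed.

Lemma entire_cont f z : entire f -> ccont_at f z.
Proof.
move=> ef e e0; have e30 : 0 < e / 3 by lra.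
have [p hp] := ef (cabs z + 1) _ e30.
have [d d0 hd] := ccont_horner p z e30.
exists (Num.min d 1); first by rewrite lt_min d0 ltr01.
move=> w; rewrite lt_min => /andP[/hd h1 h2].
have hz : cabs z <= cabs z + 1 by rewrite lerDl.
have hw : cabs w <= cabs z + 1.
  have := ler_cabsD (w - z) z; rewrite subrK; lra.
have -> : f w - f z = (f w - p.[w]) + (p.[w] - p.[z]) - (f z - p.[z]) by ring.
have := hp _ hz; have := hp _ hw.
have := ler_cabsB ((f w - p.[w]) + (p.[w] - p.[z])) (f z - p.[z]).
have := ler_cabsD (f w - p.[w]) (p.[w] - p.[z]); lra.
Qed.

Lemma entire_bounded f (r : R) : entire f -> exists2 M, 0 < M & forall z, cabs z <= r -> cabs (f z) <= M.
Proof.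
move=> ef; pose r' := Num.max r 0; have r0 : 0 <= r' by rewrite le_max lexx orbT.
have [m _ hm] := annulus_max (c := (0 : C)) (f := f) r0 r0 (fun w _ => entire_cont w ef).
exists (cabs (f m) + 1); first by rewrite ltr_wpDl ?cabs_ge0.
move=> z hz; have := hm z; rewrite subr0 cabs_ge0 /= le_max hz => /(_ isT) h.
by apply: le_trans h _; rewrite lerDl ler01.
Qed.

Lemma entireD f g : entire f -> entire g -> entire (fun w => f w + g w).
Proof.
move=> ef eg r e e0; have e20 : 0 < e / 2 by lra.
have [p hp] := ef r _ e20; have [q hq] := eg r _ e20.
exists (p + q) => z hz; rewrite hornerD opprD addrACA.
have := hp _ hz; have := hq _ hz; have := ler_cabsD (f z - p.[z]) (g z - q.[z]); lra.
Qed.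

Lemma entireM f g : entire f -> entire g -> entire (fun w => f w * g w).
Proof.
move=> ef eg r e e0.
have [A A0 hA] := entire_bounded r ef; have [B B0 hB] := entire_bounded r eg.
have e10 : 0 < Num.min 1 (e / (A + B + 1)) by rewrite lt_min ltr01 divr_gt0 // !addr_gt0.
set e' := Num.min _ _ in e10.
have e11 : e' <= 1 by rewrite ge_min lexx.
have e1e : e' * (A + B + 1) <= e by rewrite -ler_pdivlMr ?ge_min ?lexx ?orbT // !addr_gt0.
clearbody e'.
have [p hp] := ef r _ e10; have [q hq] := eg r _ e10.
exists (p * q) => z hz; rewrite hornerM.
have -> : f z * g z - p.[z] * q.[z] = (f z - p.[z]) * g z + (f z) * (g z - q.[z]) - (f z - p.[z]) * (g z - q.[z]) by ring.
apply: le_trans (ler_cabsB _ _) _; apply: le_trans (lerD (ler_cabsD _ _) (lexx _)) _.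
rewrite !cabsM.
have h1 : cabs (f z - p.[z]) * cabs (g z) <= e' * B by apply: ler_pM => //; [exact: hp|exact: hB].
have h2 : cabs (f z) * cabs (g z - q.[z]) <= A * e' by apply: ler_pM => //; [exact: hA|exact: hq].
have h3 : cabs (f z - p.[z]) * cabs (g z - q.[z]) <= e' * 1.
  by apply: ler_pM => //; [exact: hp| apply: le_trans e11; exact: hq].
lra.
Qed.

Lemma entireZ c f : entire f -> entire (fun w => c * f w).
Proof. by move=> ef; apply: entireM => //; exact: entire_cst. Qed.

Lemma entireN f : entire f -> entire (fun w => - f w).
Proof. by move=> /(entireZ (-1)); apply: entire_ext => w; rewrite mulN1r. Qed.

Lemma entireB f g : entire f -> entire g -> entire (fun w => f w - g w).
Proof. by move=> ef eg; apply: entireD => //; exact: entireN. Qed.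

Lemma entire_sum (I : Type) (s : seq I) (f : I -> C -> C) :
  (forall i, entire (f i)) -> entire (fun w => \sum_(i <- s) f i w).
Proof.
move=> h; elim: s => [|a s IH].
  by apply: entire_ext (entire_cst 0) => w; rewrite big_nil.
by apply: entire_ext (entireD (h a) IH) => w; rewrite big_cons.
Qed.

Lemma entire_prod (I : Type) (s : seq I) (f : I -> C -> C) :
  (forall i, entire (f i)) -> entire (fun w => \prod_(i <- s) f i w).
Proof.
move=> h; elim: s => [|a s IH].
  by apply: entire_ext (entire_cst 1) => w; rewrite big_nil.
by apply: entire_ext (entireM (h a) IH) => w; rewrite big_cons.
Qed.

Lemma entireX f n : entire f -> entire (fun w => f w ^+ n).
Proof.
move=> h; elim: n => [|n IH]; first exact: entire_cst.
by apply: entire_ext (entireM h IH) => w; rewrite exprS.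
Qed.

Lemma entire_XsubC c : entire (fun w => w - c).
Proof. by apply: entireB; [exact: entire_id|exact: entire_cst]. Qed.

Lemma entire_comp_poly f (q : {poly C}) : entire f -> entire (fun w => f q.[w]).
Proof.
move=> ef r e e0; have [M _ hM] := entire_bounded r (entire_horner q).
have [p hp] := ef M _ e0; exists (p \Po q) => z hz; rewrite horner_comp.
exact/hp/hM.
Qed.

Lemma entire_shift f c : entire f -> entire (fun w => f (w + c)).
Proof. by move=> /(@entire_comp_poly _ ('X + c%:P)); apply: entire_ext => w; rewrite !hornerE. Qed.

Lemma entire_scale f c : entire f -> entire (fun w => f (w * c)).
Proof. by move=> /(@entire_comp_poly _ ('X * c%:P)); apply: entire_ext => w; rewrite !hornerE. Qed.

Lemma entire_sqr f : entire f -> entire (fun w => f (w ^+ 2)).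
Proof. by move=> /(@entire_comp_poly _ ('X^2)); apply: entire_ext => w; rewrite !hornerE. Qed.

(** * Maximum principle and division by zeros *)

Lemma entire_max f c (r M : R) : 0 < r -> entire f ->
  (forall w, cabs (w - c) = r -> cabs (f w) <= M) -> forall w, cabs (w - c) <= r -> cabs (f w) <= M.
Proof.
(* The 2 counts the approximation error [e] once on the circle and once at [w]. *)
move=> r0 ef h w hw; apply: (@le_archi _ _ 2) => m.
have e0 : 0 < m.+1%:R^-1 :> R by rewrite invr_gt0 ltr0n.
set e := _^-1 in e0 *.
have [p hp] := entire_shift c ef r e0.
have hM : forall z, cabs z <= r -> cabs p.[z] <= M + e.
  apply: poly_max => // z hz; have := hp z; rewrite hz lexx => /(_ isT).
  have := h (z + c); rewrite addrK => /(_ hz).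
  have := lerB_cabs p.[z] (f (z + c)); rewrite cabsB; lra.
have := hM _ hw; have := hp _ hw; rewrite subrK.
have := lerB_cabs (f w) p.[w - c]; lra.
Qed.

(** If [p] approximates [f] then [p - p.[0]] is divisible by ['X], and its quotients [q n] converge
    locally uniformly. The limit is [f w / w] off 0; at 0 its value has to be constructed as the
    limit [l] of [(q n).[0]]. *)
Lemma entire_div0 f : entire f -> f 0 = 0 -> exists2 g, entire g & forall w, f w = w * g w.
Proof.
move=> ef f0.
have hn (n : nat) : exists q : {poly C}, forall w, cabs w <= n.+1%:R ->
    cabs (f w - w * q.[w]) <= 2 / n.+1%:R.
  have [|p hp] := ef n.+1%:R n.+1%:R^-1; first by rewrite invr_gt0 ltr0n.
  have /factor_theorem[q hq] : root (p - p.[0]%:P) 0 by rewrite rootE !hornerE subrr.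
  exists q => w hw.
  have -> : w * q.[w] = p.[w] - p.[0].
    by have := congr1 (horner ^~ w) hq; rewrite /= !hornerE => ->; ring.
  have h0 : cabs (f 0 - p.[0]) <= n.+1%:R^-1 by apply: hp; rewrite cabs0.
  have -> : f w - (p.[w] - p.[0]) = (f w - p.[w]) - (f 0 - p.[0]) by rewrite f0; ring.
  by apply: le_trans (ler_cabsB _ _) _; rewrite mulr_natl mulr2n lerD // hp.
have {hn} [q hq] := choice hn.
(* On the circle of radius [n + 1 >= 1] a factor [w] does not decrease the modulus, so a bound on
   [w * (q n - q m)] holds for [q n - q m]; [poly_max] carries it inside. *)
have hC n m : (n <= m)%N -> forall w, cabs w <= n.+1%:R ->
    cabs ((q n).[w] - (q m).[w]) <= 4 / n.+1%:R.
  move=> nm w hw.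
  have -> : (q n).[w] - (q m).[w] = (q n - q m).[w] by rewrite !hornerE.
  apply: (poly_max (r := n.+1%:R)) hw; first by rewrite ltr0n.
  move=> {}w hw; rewrite !hornerE.
  have n1 : 1 <= n.+1%:R :> R by rewrite ler1n.
  apply: (@le_trans _ _ (cabs (w * ((q n).[w] - (q m).[w])))).
    by rewrite cabsM hw ler_peMl.
  have hnm : 2 / m.+1%:R <= 2 / n.+1%:R :> R.
    by rewrite ler_pM2l // lef_pV2 ?posrE ?ltr0n // ler_nat.
  have := hq n w; rewrite hw lexx => /(_ isT).
  have := hq m w; rewrite hw ler_nat ltnS => /(_ nm).
  have := ler_cabsB (f w - w * (q m).[w]) (f w - w * (q n).[w]).
  have -> : (f w - w * (q m).[w]) - (f w - w * (q n).[w]) = w * ((q n).[w] - (q m).[w]) by ring.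
  move: hnm; set a := n.+1%:R^-1; set b := m.+1%:R^-1; lra.
have [l hl] : exists l, forall n, cabs ((q n).[0] - l) <= 4 / n.+1%:R + 4 / n.+1%:R.
  by apply: complex_limit => n m nm; apply: hC => //; rewrite cabs0 ler0n.
pose g w := if w == 0 then l else f w / w.
have hg n w : cabs w <= n.+1%:R -> cabs (g w - (q n).[w]) <= 8 / n.+1%:R.
  move=> hw; rewrite /g; have [->|w0] := eqVneq w 0.
    by rewrite cabsB; apply: le_trans (hl n) _; set a := n.+1%:R^-1; lra.
  apply: (@le_trans _ _ (4 / n.+1%:R)); last by rewrite ler_wpM2r ?invr_ge0 ?ler0n //; lra.
  (* Dividing directly by [w] would lose uniformity near 0. Comparing with [q (n + m)] and letting
     [m] grow removes the term with [1 / |w|]. *)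
  apply: (@le_archi _ _ (2 / cabs w)) => m.
  have hwm : cabs w <= (n + m).+1%:R by apply: le_trans hw _; rewrite ler_nat ltnS leq_addr.
  have h1 := hC n (n + m)%N (leq_addr _ _) w hw.
  have h2 := hq _ _ hwm.
  have aw : 0 < cabs w by rewrite cabs_gt0.
  have h3 : cabs (f w / w - (q (n + m)%N).[w]) <= 2 / cabs w / m.+1%:R.
    have -> : f w / w - (q (n + m)%N).[w] = (f w - w * (q (n + m)%N).[w]) / w by field.
    rewrite cabsf mulrAC ler_pM2r ?invr_gt0 //; apply: le_trans h2 _.
    by rewrite ler_pM2l // lef_pV2 ?posrE ?ltr0n // ler_nat ltnS leq_addl.
  have := ler_cabsB (f w / w - (q (n + m)%N).[w]) ((q n).[w] - (q (n + m)%N).[w]).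
  rewrite opprB addrA subrK; move: h1 h3.
  set a := n.+1%:R^-1; set b := 2 / cabs w / _; lra.
exists g; last first.
  move=> w; rewrite /g; have [->|w0] := eqVneq w 0; first by rewrite f0 mul0r.
  by field.
move=> r e e0.
pose n := Num.bound (Num.max r (8 / e)).
have hn : Num.max r (8 / e) < n%:R by apply: archi_boundP; rewrite le_max (divr_ge0 _ (ltW e0)) // orbT.
have {hn} : Num.max r (8 / e) < n.+1%:R by apply: lt_trans hn _; rewrite ltr_nat.
rewrite gt_max => /andP[hr he].
exists (q n) => z hz; apply: le_trans (hg n _ _) _; first by apply: le_trans hz (ltW hr).
by rewrite ler_pdivrMr ?ltr0n // -ler_pdivrMl // mulrC ltW.
Qed.

Lemma entire_div f z : entire f -> f z = 0 -> exists2 g, entire g & forall w, f w = (w - z) * g w.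
Proof.
move=> ef fz; have [||g eg hg] := @entire_div0 (fun w => f (w + z)).
- exact: entire_shift.
- by rewrite add0r.
exists (fun w => g (w - z)); first exact: entire_shift.
by move=> w; rewrite -hg subrK.
Qed.

Lemma ccont_eq_off f g z : ccont_at f z -> ccont_at g z ->
  (forall e : R, 0 < e -> exists2 w, cabs (w - z) < e & f w = g w) -> f z = g z.
Proof.
move=> cf cg h; apply/eqP; rewrite -subr_eq0 -cabs_eq0 eq_le cabs_ge0 andbT.
apply: (@le_archi _ _ 2) => m; rewrite add0r.
have e0 : 0 < m.+1%:R^-1 :> R by rewrite invr_gt0 ltr0n.
set e := _^-1 in e0 *.
have [d1 d10 h1] := cf _ e0; have [d2 d20 h2] := cg _ e0.
have [|w hw e1] := h (Num.min d1 d2); first by rewrite lt_min d10.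
move: hw; rewrite lt_min => /andP[/h1 {}h1 /h2]; rewrite -e1 => {}h2.
have := ler_cabsB (f w - g z) (f w - f z).
by rewrite opprB [_ - _ + _]addrC addrA subrK; lra.
Qed.

(** Used to cancel a factor [w - z]: the cancelled identity extends to [z] by continuity. *)
Lemma ccont_eq_punctured f g z : ccontinuous f -> ccontinuous g ->
  (forall w, w != z -> f w = g w) -> forall w, f w = g w.
Proof.
move=> cf cg h w; have [->|/h//] := eqVneq w z.
apply: ccont_eq_off; [exact: cf|exact: cg|] => e e0.
exists (z + (e / 2)%:C).
  by rewrite addrAC subrr add0r cabsR gtr0_norm; lra.
apply: h; rewrite -subr_eq0 addrAC subrr add0r -cabs_gt0 cabsR gtr0_norm; lra.
Qed.

(** Otherwise [f] is divisible by [(w - z) ^ m] for every [m]. On the circle of radius [2 d] about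
    [z], with [d > |w0 - z|], the quotient is at most [M / (2 d) ^ m], hence [|f w0| <= M / 2 ^ m]
    and [f w0 = 0]. *)
Lemma entire_order f w0 z : entire f -> f w0 != 0 ->
  exists k, exists2 g, entire g & (g z != 0) /\ forall w, f w = (w - z) ^+ k * g w.
Proof.
move=> ef fw; apply: contrapT => hno.
have hk k : exists2 g, entire g & forall w, f w = (w - z) ^+ k * g w.
  elim: k => [|k [g eg hg]]; first by exists f => // w; rewrite mul1r.
  have [gz|gz] := eqVneq (g z) 0; last by case: hno; exists k, g.
  have [h eh hh] := entire_div eg gz; exists h => // w.
  by rewrite hg hh exprSr mulrA.
pose d := cabs (w0 - z) + 1; have d1 : 1 <= d by rewrite lerDr.
have d0 : 0 < d by lra.
have [M M0 hM] := entire_bounded (2 * d + cabs z) ef.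
move: fw; apply/negP; rewrite negbK -cabs_eq0 eq_le cabs_ge0 andbT.
apply: (@le_archi _ _ M) => m; rewrite add0r.
have [g eg hg] := hk m.
have h2d : 0 < 2 * d by lra.
have hgw : cabs (g w0) <= M / (2 * d) ^+ m.
  apply: (entire_max (c := z) h2d eg) => [w hw|]; last first.
    by apply: (@le_trans _ _ d); rewrite ?lerDl // ler_peMl //; lra.
  rewrite ler_pdivlMr ?exprn_gt0 // -hw -cabsX -cabsM mulrC -hg.
  by apply: hM; have := ler_cabsD (w - z) z; rewrite subrK; lra.
rewrite hg cabsM cabsX.
apply: (@le_trans _ _ (d ^+ m * (M / (2 * d) ^+ m))).
  apply: ler_pM => //; first by rewrite exprn_ge0.
  by apply: lerXn2r; rewrite ?nnegrE ?cabs_ge0 ?ltW // ltrDl.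
rewrite exprMn invfM mulrCA [d ^+ m * _]mulrCA mulfV ?mulr1 ?expf_neq0 ?gt_eqF // ler_pM2l //.
rewrite lef_pV2 ?posrE ?ltr0n ?exprn_gt0 //.
by rewrite -natrX ler_nat ltn_expl.
Qed.

(** [g] may vanish outside the disc, so [f / g] is not known to be a limit of polynomials and
    [entire_max] does not apply. The argument of [poly_max] is repeated at a maximum point of
    [|f / g|]. *)
Lemma quotient_max f g c (r K : R) : 0 < r -> entire f -> entire g ->
  (forall w, cabs (w - c) <= r -> g w != 0) ->
  (forall w, cabs (w - c) = r -> cabs (f w) <= K * cabs (g w)) ->
  forall w, cabs (w - c) <= r -> cabs (f w) <= K * cabs (g w).
Proof.
move=> r0 ef eg g0 h.
have hr : cabs (c + r%:C - c) = r by rewrite addrAC subrr add0r cabsR gtr0_norm.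
have hrg : 0 < cabs (g (c + r%:C)) by rewrite cabs_gt0 g0 // hr.
have K0 : 0 <= K.
  by have := le_trans (cabs_ge0 _) (h _ hr); rewrite pmulr_lge0.
pose u w := f w / g w.
have cu w : cabs (w - c) <= r -> ccont_at u w.
  by move=> hw; apply: ccontM; [exact: entire_cont|apply: ccontV; [exact: g0|exact: entire_cont]].
have hu w : cabs (w - c) <= r -> (cabs (f w) <= K * cabs (g w)) = (cabs (u w) <= K).
  by move=> hw; rewrite /u cabsf ler_pdivrMr // cabs_gt0 g0.
have [m /andP[_ hm] hmax] := annulus_max (c := c) (f := u) (ltW r0) (ltW r0)
  (fun w hw => cu w (proj2 (andP hw))).
suff hM : cabs (u m) <= K.
  by move=> w hw; rewrite hu //; apply: le_trans hM; apply: hmax; rewrite cabs_ge0.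
have [/eqP mr|mr] := boolP (cabs (m - c) == r); first by rewrite -hu //; exact: h.
have {}mr : cabs (m - c) < r by rewrite lt_neqAle mr.
have [t0|t0] := eqVneq (u m) 0; first by rewrite t0 cabs0.
(* [f / g - u m = F / g], and [F] is entire, so its order at [m] supplies the exponent for
   [dalembert]; if [F] vanishes identically the quotient is constant. *)
pose F w := f w - u m * g w.
have eF : entire F by apply: entireB => //; exact: entireZ.
have [F0|] := pselect (forall w, F w = 0).
  have := h _ hr; rewrite hu ?hr // /u.
  have /subr0_eq -> := F0 (c + r%:C).
  by rewrite mulfK // -cabs_gt0.
move=> /existsNP[w0 /eqP hw0].
have [k [G eG [Gm hG]]] := entire_order m eF hw0.
have k0 : (0 < k)%N.
  case: k hG => // hG; have := hG m; rewrite mul1r /F /u divfK ?subrr ?g0 // => e.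
  by rewrite -e eqxx in Gm.
have gm : g m != 0 by exact: g0.
have cGg : ccont_at (fun w => G w / g w) m.
  by apply: ccontM; [exact: entire_cont|apply: ccontV => //; exact: entire_cont].
have Ggm : G m / g m != 0 by rewrite mulf_neq0 // invr_neq0.
have [w hw] := @dalembert _ _ (fun w => G w / g w) _ _ _ k0 t0 Ggm cGg (ltac:(by rewrite subr_gt0) : 0 < r - cabs (m - c)).
have hwc : cabs (w - c) <= r.
  have := ler_cabsD (w - m) (m - c); rewrite addrA subrK; lra.
have gw : g w != 0 by exact: g0.
have -> : u m + (w - m) ^+ k * (G w / g w) = u w.
  rewrite mulrA -hG /F /u; by field; rewrite gw gm.
by rewrite ltNge => /negP[]; apply: hmax; rewrite cabs_ge0.
Qed.

(** Without a zero in the disc, [quotient_max] applied to [1 / f] contradicts the small value at the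
    centre. This is how zeros of perturbations are produced. *)
Lemma entire_min f c (r M : R) : 0 < r -> 0 < M -> entire f ->
  (forall w, cabs (w - c) = r -> M <= cabs (f w)) -> cabs (f c) < M ->
  exists2 b, cabs (b - c) < r & f b = 0.
Proof.
move=> r0 M0 ef h hc.
have [[b hb fb]|hno] := pselect (exists2 b, cabs (b - c) <= r & f b = 0).
  exists b => //; rewrite lt_neqAle hb andbT; apply/eqP => e.
  by have := h _ e; rewrite fb cabs0 leNgt M0.
have : cabs 1 <= M^-1 * cabs (f c).
  apply: (@quotient_max (fun=> 1) f c r M^-1 r0 (entire_cst 1) ef).
  - by move=> w hw; apply/eqP => fw; apply: hno; exists w.
  - by move=> w hw; rewrite cabs1 -ler_pdivrMl ?invr_gt0 // mulr1 invrK h.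
  - by rewrite subrr cabs0 ltW.
by rewrite cabs1 -ler_pdivrMl ?invr_gt0 // mulr1 invrK leNgt hc.
Qed.

End Entire.

(** * Zeros and their stability *)

Section Zeros.
Variable R : realType.
Local Notation C := R[i].
Implicit Types (z w c a : C) (f g h : C -> C) (s t : seq C).

Definition prodX s w : C := \prod_(a <- s) (w - a).

Lemma prodX_cons a s w : prodX (a :: s) w = (w - a) * prodX s w.
Proof. by rewrite /prodX big_cons. Qed.

Lemma prodX_nil w : prodX [::] w = 1.
Proof. by rewrite /prodX big_nil. Qed.

Lemma entire_prodX s : entire (prodX s).
Proof. by apply: entire_prod => a; exact: entire_XsubC. Qed.

Lemma prodX_eq0 s w : (prodX s w == 0) = (w \in s).
Proof.
elim: s => [|a s IH]; first by rewrite prodX_nil oner_eq0.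
by rewrite prodX_cons mulf_eq0 IH subr_eq0 in_cons.
Qed.

Lemma prodX_count s z w :
  prodX s w = (w - z) ^+ count_mem z s * prodX [seq a <- s | a != z] w.
Proof.
elim: s => [|a s IH]; first by rewrite /= mul1r.
rewrite prodX_cons IH /=; have [->|az] := eqVneq a z; first by rewrite exprS mulrA.
by rewrite prodX_cons add0n mulrCA.
Qed.

Lemma zero_atleast_count f s g z j : entire g -> (forall w, f w = prodX s w * g w) ->
  (j < count_mem z s)%N -> zero_atleast f z j.
Proof.
move=> eg hf jm.
exists (fun w => (w - z) ^+ (count_mem z s - j.+1) * (prodX [seq a <- s | a != z] w * g w)).
  move=> w; apply: entire_cont; apply: entireM.
    by apply: entireX; exact: entire_XsubC.
  by apply: entireM => //; exact: entire_prodX.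
by move=> w /=; rewrite hf (prodX_count s z) [RHS]mulrA -exprD subnKC // -mulrA.
Qed.

(** Turns multiplicity, defined through a continuous cofactor, into counting in a list: if [j]
    reached the count, cancelling [(w - z) ^ count] between the two factorizations would force the
    cofactor [K] to vanish at [z]. *)
Lemma zero_atleastP f s g z j : entire g -> (forall w, f w = prodX s w * g w) ->
  g z != 0 -> zero_atleast f z j <-> (j < count_mem z s)%N.
Proof.
move=> eg hf gz; split; last exact: (zero_atleast_count eg hf).
pose K w := prodX [seq a <- s | a != z] w * g w.
have eK : entire K by apply: entireM => //; exact: entire_prodX.
have Kz : K z != 0 by rewrite mulf_neq0 // prodX_eq0 mem_filter eqxx.
have hK w : f w = (w - z) ^+ count_mem z s * K w by rewrite hf (prodX_count s z) mulrA.
move=> [G cG hG]; rewrite ltnNge; apply/negP => mj.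
pose n := (j - count_mem z s)%N.
have hn : j.+1 = (count_mem z s + n.+1)%N by rewrite /n addnS subnKC.
have : K z = (z - z) ^+ n.+1 * G z.
  apply: (@ccont_eq_punctured _ K (fun w => (w - z) ^+ n.+1 * G w) z).
  - by move=> w; exact: entire_cont.
  - move=> w; apply: ccontM; last exact: cG.
    by apply: entire_cont; apply: entireX; exact: entire_XsubC.
  move=> w wz; apply: (@mulfI _ ((w - z) ^+ count_mem z s)).
    by rewrite expf_neq0 // subr_eq0.
  by rewrite -hK hG mulrA -exprD -hn.
by rewrite subrr expr0n mul0r => /eqP; rewrite (negbTE Kz).
Qed.

Lemma zero_atleast_eq0 f z j : zero_atleast f z j -> f z = 0.
Proof. by move=> [g _ ->]; rewrite subrr expr0n mul0r. Qed.

Lemma entire_div_seq f s : entire f -> uniq s -> (forall a, a \in s -> f a = 0) ->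
  exists2 g, entire g & forall w, f w = prodX s w * g w.
Proof.
elim: s f => [|a s IH] f ef.
  by exists f => // w; rewrite prodX_nil mul1r.
move=> /= /andP[as_ us] h.
have [g eg hg] := entire_div ef (h a (mem_head _ _)).
have [|g' eg' hg'] := IH g eg us.
  move=> b bs; have := h b; rewrite in_cons bs orbT => /(_ isT)/eqP.
  rewrite hg mulf_eq0 subr_eq0 => /orP[/eqP ba|/eqP//].
  by rewrite -ba bs in as_.
by exists g' => // w; rewrite hg hg' prodX_cons mulrA.
Qed.

(** Zeros are divided out until none is left in the disc. If this never ended, [f] would have
    arbitrarily many linear factors, and the growth argument of [entire_order] would give
    [f w0 = 0]. *)
Lemma entire_finite_zeros f w0 (r : R) : 0 < r -> entire f -> f w0 != 0 ->
  exists s, exists2 g, entire g & [/\ forall w, f w = prodX s w * g w,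
    forall a, a \in s -> cabs a <= r & forall w, cabs w <= r -> g w != 0].
Proof.
move=> r0 ef fw; apply: contrapT => hno.
have hk k : exists s, exists2 g, entire g & [/\ forall w, f w = prodX s w * g w,
    forall a, a \in s -> cabs a <= r & size s = k].
  elim: k => [|k [s [g eg [hg hs ks]]]].
    by exists [::], f => //; split=> // w; rewrite prodX_nil mul1r.
  have [hg0|] := pselect (forall w, cabs w <= r -> g w != 0).
    by case: hno; exists s, g.
  move=> /existsNP[a /not_implyP[ar /negP]]; rewrite negbK => /eqP ga.
  have [g' eg' hg'] := entire_div eg ga.
  exists (a :: s), g' => //; split; last by rewrite /= ks.
    by move=> w; rewrite hg hg' prodX_cons mulrCA mulrA.
  by move=> b; rewrite in_cons => /orP[/eqP->|/hs].
(* On |w| = r + 2 d each factor is at least 2 d, while it is at most d at w0. *)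
pose d := cabs w0 + r; have d0 : 0 < d by rewrite ltr_wpDl.
pose r' := r + 2 * d; have r'0 : 0 < r' by rewrite /r'; lra.
have [M M0 hM] := entire_bounded r' ef.
move: fw; apply/negP; rewrite negbK -cabs_eq0 eq_le cabs_ge0 andbT.
apply: (@le_archi _ _ _ M) => m; rewrite add0r.
have [s [g eg [hg hs ks]]] := hk m.
have hgw : cabs (g w0) <= M / (2 * d) ^+ m.
  apply: (entire_max (c := 0) r'0 eg) => [w|]; last first.
    by rewrite subr0 /r' /d; have := cabs_ge0 w0; lra.
  rewrite subr0 => hw; rewrite ler_pdivlMr ?exprn_gt0 ?mulr_gt0 //.
  apply: le_trans (hM w _); last by rewrite hw.
  rewrite hg cabsM mulrC ler_wpM2r //.
  rewrite /prodX cabs_prod -ks.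
  elim: (s) hs => [|a l IH] hs; first by rewrite big_nil.
  rewrite big_cons /= exprS ler_pM ?exprn_ge0 ?mulr_ge0 ?(ltW d0) //.
    have := lerB_cabs w a; have := hs a (mem_head _ _); rewrite hw /r'; lra.
  by apply: IH => b bl; apply: hs; rewrite in_cons bl orbT.
rewrite hg cabsM.
apply: (@le_trans _ _ (d ^+ m * (M / (2 * d) ^+ m))).
  apply: ler_pM => //.
  rewrite /prodX cabs_prod -ks.
  elim: (s) hs => [|a l IH] hs; first by rewrite big_nil.
  rewrite big_cons /= exprS ler_pM ?prodr_ge0 //.
    have := ler_cabsB w0 a; have := hs a (mem_head _ _); rewrite /d; lra.
  by apply: IH => b bl; apply: hs; rewrite in_cons bl orbT.
rewrite exprMn invfM mulrCA [d ^+ m * _]mulrCA mulfV ?mulr1 ?expf_neq0 ?gt_eqF // ler_pM2l //.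
rewrite lef_pV2 ?posrE ?ltr0n ?exprn_gt0 //.
by rewrite -natrX ler_nat ltn_expl.
Qed.

Lemma isolating_radius s a (r : R) : 0 < r ->
  exists2 d, 0 < d <= r & forall b, b \in s -> b != a -> d < cabs (b - a).
Proof.
move=> r0; elim: s => [|c s [d /andP[d0 dr] hd]]; first by exists r => //; rewrite r0 lexx.
have [->|ca] := eqVneq c a.
  exists d; first by rewrite d0.
  by move=> b; rewrite in_cons => /orP[/eqP->|]; [rewrite eqxx|exact: hd].
have ca0 : 0 < cabs (c - a) by rewrite cabs_gt0 subr_eq0.
exists (Num.min d (cabs (c - a) / 2)).
  by rewrite lt_min d0 divr_gt0 //= ge_min dr.
move=> b; rewrite in_cons gt_min => /orP[/eqP->|bs ba]; last by rewrite hd.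
by move=> _; apply/orP; right; lra.
Qed.

(** Induction on [s]: a circle about the head [a] that avoids the other zeros yields a zero [b] of
    [g], and the quotients of [f] by [w - a] and of [g] by [w - b] are again close. The list [t] is
    built in the order of [s], whence the bound entry by entry. *)
Lemma hurwitz s f h (r : R) : 0 < r -> entire f -> entire h ->
  (forall w, f w = prodX s w * h w) -> (forall w, cabs w <= r -> h w != 0) ->
  (forall a, a \in s -> cabs a < r) ->
  forall e : R, 0 < e -> exists2 d : R, 0 < d & forall g, entire g ->
    (forall w, cabs w <= r -> cabs (f w - g w) <= d) ->
    exists t, exists2 h', entire h' & [/\ size t = size s,
      forall i, (i < size s)%N -> cabs (nth 0 s i - nth 0 t i) <= e,
      forall a, a \in t -> cabs a < r,
      forall w, g w = prodX t w * h' w & forall w, cabs w <= r -> h' w != 0].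
Proof.
move=> r0; elim: s f => [|a s IH] f ef eh hf h0 hs e e0.
  have hf' w : f w = h w by rewrite hf prodX_nil mul1r.
  have [m /andP[_ hm] hmin] := annulus_min (c := (0 : C)) (f := f) (ltW r0) (ltW r0) (fun w _ => entire_cont w ef).
  rewrite subr0 in hm.
  have m0 : 0 < cabs (f m) by rewrite cabs_gt0 hf' h0.
  exists (cabs (f m) / 2); first by rewrite divr_gt0.
  move=> g eg hg; exists [::], g => //; split=> // w.
    by rewrite prodX_nil mul1r.
  move=> hw; rewrite -cabs_gt0.
  have := hmin w; rewrite subr0 cabs_ge0 hw => /(_ isT).
  have := hg w hw; have := lerB_cabs (f w) (f w - g w).
  by rewrite subKr; lra.
pose f' w := prodX s w * h w.
have ef' : entire f' by apply: entireM => //; exact: entire_prodX.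
have hff' w : f w = (w - a) * f' w by rewrite hf prodX_cons /f' mulrA.
have ar : cabs a < r by apply: hs; rewrite mem_head.
have [|d1 d10 hd1] := IH f' ef' eh (fun=> erefl) h0 _ e e0.
  by move=> b bs; apply: hs; rewrite in_cons bs orbT.
have [M M0 hM] := entire_bounded r ef'.
(* Half the distance from [a] to the circle of radius [r]: a zero [b] within [q] of [a] keeps
   [|w - b| >= q] on that circle. *)
pose q := (r - cabs a) / 2; have q0 : 0 < q by rewrite divr_gt0 // subr_gt0.
(* The last bound makes the shift error [|f' w| * |a - b| <= M * d2] at most half of [d1 * q]. *)
pose r1 := Num.min (Num.min e q) (d1 * q / 2 / M).
have r10 : 0 < r1 by rewrite !lt_min e0 q0 !divr_gt0 // mulr_gt0.
have [d2 /andP[d20 d2r] hd2] := isolating_radius (a :: s) a r10.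
move: d2r; rewrite !le_min => /andP[/andP[d2e d2q]].
rewrite (ler_pdivlMr d2 _ M0) => d2M.
have hcirc w : cabs (w - a) <= d2 -> cabs w <= r.
  by move=> hw; have := ler_cabsD (w - a) a; rewrite subrK /q in d2q *; lra.
have [m /andP[hm1 hm2] hmin] := annulus_min (c := a) (f := f) (ltW d20) (lexx _) (fun w _ => entire_cont w ef).
have hma : cabs (m - a) = d2 by apply/eqP; rewrite eq_le hm1 hm2.
have m0 : 0 < cabs (f m).
  rewrite cabs_gt0 hf mulf_neq0 ?h0 ?hcirc ?hma // prodX_eq0; apply/negP => /hd2.
  rewrite hma ltxx; have [ma|_ /(_ isT)//] := eqVneq m a.
  by move: hma; rewrite ma subrr cabs0 => d2_0; rewrite -d2_0 ltxx in d20.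
(* A third of the minimum of [|f|] on the small circle leaves [|g| >= 2 d] there, while
   [|g a| <= d]; the other bound is the second half of [d1 * q]. *)
pose d := Num.min (cabs (f m) / 3) (d1 * q / 2).
have d0 : 0 < d by rewrite lt_min !divr_gt0 // mulr_gt0.
exists d => // g eg hg.
have dm : d <= cabs (f m) / 3 by rewrite ge_min lexx.
have dq : d <= d1 * q / 2 by rewrite ge_min lexx orbT.
have [|||b hb gb] := @entire_min _ g a d2 (2 * d) d20 _ eg.
- by rewrite mulr_gt0.
- move=> w hw; have := hmin w; rewrite hw !lexx => /(_ isT).
  have := hg w; rewrite hcirc ?hw // => /(_ isT).
  have := lerB_cabs (f w) (f w - g w); rewrite subKr; lra.
- have := hg a (ltW ar); rewrite hff' subrr mul0r sub0r cabsN; lra.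
have [g' eg' hg'] := entire_div eg gb.
have br : cabs b < r - q.
  have := ler_cabsD (b - a) a; rewrite subrK /q in d2q *; lra.
have hfg w : cabs w <= r -> cabs (f' w - g' w) <= d1.
  move=> hw0; apply: (@entire_max _ (fun w => f' w - g' w) 0 r d1 r0); last by rewrite subr0.
    exact: entireB.
  move=> {hw0}{}w; rewrite subr0 => hw.
  have wb : q <= cabs (w - b) by have := lerB_cabs w b; rewrite hw; lra.
  (* The quotients are compared only after multiplication by [w - b], which is bounded below on the
     large circle; the maximum principle does the rest. *)
  have key : (w - b) * (f' w - g' w) = (f w - g w) + f' w * (a - b).
    by rewrite hff' hg'; ring.
  have h1 : cabs (w - b) * cabs (f' w - g' w) <= d1 * q.
    rewrite -cabsM key; apply: le_trans (ler_cabsD _ _) _.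
    have h2 := hg w; rewrite hw lexx in h2; have {}h2 := h2 isT.
    have h3 : cabs (f' w * (a - b)) <= M * d2.
      by rewrite cabsM ler_pM // ?hM ?hw // cabsB ltW.
    by apply: le_trans (lerD h2 h3) _; rewrite (mulrC M) [leRHS]splitr lerD.
  rewrite -(ler_pM2r q0); apply: le_trans h1.
  by rewrite mulrC ler_wpM2r.
have [t [h' eh' [ts td ti tg th]]] := hd1 g' eg' hfg.
exists (b :: t), h' => //; split=> //.
- by rewrite /= ts.
- case=> [|i] /=; first by move=> _; rewrite cabsB; lra.
  by rewrite ltnS; exact: td.
- by move=> z; rewrite in_cons => /orP[/eqP->|/ti//]; lra.
- by move=> w; rewrite hg' tg prodX_cons mulrA.
Qed.

(* The pair (z, j) stands for the j-th copy of the zero z; here z is the k-th entry of s. *)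
Definition occ s k : C * nat := (nth 0 s k, count_mem (nth 0 s k) (take k s)).

Lemma occ_lt s k : (k < size s)%N -> ((occ s k).2 < count_mem (occ s k).1 s)%N.
Proof.
move=> ks; rewrite /= -[X in (_ < count_mem _ X)%N](cat_take_drop k s) count_cat (drop_nth 0) //= eqxx.
by rewrite addnA addn1 ltnS leq_addr.
Qed.

Lemma occ_inj s k l : (k < size s)%N -> (l < size s)%N -> occ s k = occ s l -> k = l.
Proof.
wlog kl : k l / (k <= l)%N.
  move=> h ks ls e; have [/h|/ltnW/h] := leqP k l; first exact.
  by move=> ->.
move=> ks ls; rewrite /occ => -[e1 e2].
move: kl; rewrite leq_eqVlt => /orP[/eqP//|kl].
move: e2; rewrite -e1 -(cat_take_drop k (take l s)) take_takel ?(ltnW kl) //.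
rewrite count_cat (drop_nth 0) ?size_takel ?(ltnW ls) // nth_take //= eqxx.
by rewrite addnA addn1 => /eqP; rewrite eqn_leq ltnNge leq_addr /= andbF.
Qed.

(** The induction adds entries at the end because [occ s k] depends only on the first [k + 1]
    entries. *)
Lemma occ_surj s z j : (j < count_mem z s)%N -> exists2 k, (k < size s)%N & occ s k = (z, j).
Proof.
elim/last_ind: s => [//|s x IH]; rewrite -cats1 count_cat /= addn0.
have [js _|sj] := ltnP j (count_mem z s).
  have [k ks <-] := IH js; exists k; first by rewrite size_cat ltn_addr.
  by rewrite /occ nth_cat ks takel_cat // ltnW.
case: eqVneq => [->|_]; last by rewrite addn0 ltnNge sj.
rewrite addn1 ltnS => js; have {sj js}-> : j = count_mem z s by apply/eqP; rewrite eqn_leq js.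
exists (size s); first by rewrite size_cat addn1.
by rewrite /occ nth_cat ltnn subnn /= take_size_cat.
Qed.

(* In the region [K i] the k-th entry of [s i] is sent to the k-th entry of [t i]. *)
Lemma zeros_matching (J : Type) (K : J -> set C) f g (f' g' : J -> C -> C) (s t : J -> seq C) (e : R) :
  (forall i j z, K i z -> K j z -> i = j) ->
  (forall i, entire (f' i)) -> (forall i, entire (g' i)) ->
  (forall i w, f w = prodX (s i) w * f' i w) -> (forall i w, g w = prodX (t i) w * g' i w) ->
  (forall i w, K i w -> f' i w != 0) -> (forall i w, K i w -> g' i w != 0) ->
  (forall i a, a \in s i -> K i a) -> (forall i a, a \in t i -> K i a) ->
  (forall z, f z = 0 -> exists i, K i z) -> (forall z, g z = 0 -> exists i, K i z) ->
  (forall i, size (t i) = size (s i)) ->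
  (forall i k, (k < size (s i))%N -> cabs (nth 0 (s i) k - nth 0 (t i) k) <= e) ->
  exists phi : C * nat -> C * nat, set_bij (zeros_mult f) (zeros_mult g) phi /\
    (forall p, zeros_mult f p -> cabs ((phi p).1 - p.1) <= e).
Proof.
move=> dis ef eg hf hg f0 g0 Ks Kt cf cg sz de.
pose rel p p' := exists i k, [/\ (k < size (s i))%N, p = occ (s i) k & p' = occ (t i) k].
have hp p : zeros_mult f p -> exists i k, (k < size (s i))%N /\ p = occ (s i) k.
  case: p => z j hz; have /cf[i Ki] := zero_atleast_eq0 hz.
  have /(zero_atleastP _ (ef i) (hf i) (f0 i _ Ki))/occ_surj[k ks kz] := hz.
  by exists i, k.
have hp' p : zeros_mult g p -> exists i k, (k < size (s i))%N /\ p = occ (t i) k.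
  case: p => z j hz; have /cg[i Ki] := zero_atleast_eq0 hz.
  have /(zero_atleastP _ (eg i) (hg i) (g0 i _ Ki))/occ_surj[k ks kz] := hz.
  by exists i, k; rewrite -sz.
have Kocc i k : (k < size (s i))%N -> K i (occ (s i) k).1 by move=> ks; apply: Ks; exact: mem_nth.
have Kocc' i k : (k < size (s i))%N -> K i (occ (t i) k).1.
  by move=> ks; apply: Kt; apply: mem_nth; rewrite sz.
have hz' i k : (k < size (s i))%N -> zeros_mult g (occ (t i) k).
  move=> ks; apply/(zero_atleastP _ (eg i) (hg i) (g0 i _ (Kocc' _ _ ks))).
  by apply: occ_lt; rewrite sz.
have hz i k : (k < size (s i))%N -> zeros_mult f (occ (s i) k).
  move=> ks; apply/(zero_atleastP _ (ef i) (hf i) (f0 i _ (Kocc _ _ ks))).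
  exact: occ_lt.
(* [phi] fixes the points without a partner; for zeros of [f] the partner is unique because the
   regions are disjoint and [occ] is injective. *)
pose phi p := xget p [set p' | rel p p'].
have hphi i k : (k < size (s i))%N -> phi (occ (s i) k) = occ (t i) k.
  move=> ks; rewrite /phi; case: xgetP => [p' _ [i' [k' [ks' e1 ->]]]|/(_ (occ (t i) k))[]]; last by exists i, k.
  have ii : i = i' by apply: dis (Kocc _ _ ks) _; rewrite e1; exact: Kocc.
  by case: _ / ii in ks' e1 *; rewrite (occ_inj ks ks' e1).
exists phi; split; last first.
  move=> p /hp[i [k [ks ->]]]; rewrite hphi // cabsB; exact: de.
split.
- by move=> p /hp[i [k [ks ->]]]; rewrite hphi //; exact: hz'.
- move=> p p'; rewrite !inE => /hp[i [k [ks ->]]] /hp[i' [k' [ks' ->]]].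
  rewrite !hphi // => e1.
  have ii : i = i' by apply: dis (Kocc' _ _ ks) _; rewrite e1; exact: Kocc'.
  case: _ / ii in ks' e1 *; congr occ; apply: (@occ_inj (t i)) e1; by rewrite sz.
- move=> p /hp'[i [k [ks ->]]]; exists (occ (s i) k); first exact: hz.
  exact: hphi.
Qed.

End Zeros.

(** * The complex exponential and sine *)

Section RealTrig.
Variable R : realType.

Lemma sin_le (y : R) : 0 <= y -> `|sin y| <= y.
Proof.
move=> y0; have [|c _] := @MVT_segment R sin cos 0 y y0 (fun x _ => is_derive_sin x).
  by apply: continuous_subspaceT; exact: continuous_sin.
rewrite sin0 !subr0 => ->; rewrite normrM (ger0_norm y0).
by rewrite ler_piMl // cos_max.
Qed.

(** From [cos y - 1 = - 2 * sin (y / 2) ^ 2] and [|sin x| <= |x|]. *)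
Lemma cosB1_le (y : R) : `|cos y - 1| <= y ^+ 2.
Proof.
have [y2 e] : exists y2 : R, y = y2 *+ 2 by exists (y / 2); rewrite -mulr_natr; field.
rewrite e cos_mulr2n cos2sin2.
have h : `|sin y2| <= `|y2|.
  have [y0|y0] := leP 0 y2; first by rewrite (ger0_norm y0) sin_le.
  rewrite -normrN -sinN (ltr0_norm y0); apply: sin_le; lra.
have h2 : sin y2 ^+ 2 <= y2 ^+ 2.
  by rewrite -(real_normK (num_real (sin y2))) -(real_normK (num_real y2)) lerXn2r ?nnegrE.
have h3 := sqr_ge0 (sin y2); have h4 := sqr_ge0 y2.
have -> : (1 - sin y2 ^+ 2) *+ 2 - 1 - 1 = - (2 * sin y2 ^+ 2) by ring.
have -> : (y2 *+ 2) ^+ 2 = 4 * y2 ^+ 2 by ring.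
rewrite ler_norml; apply/andP; split; lra.
Qed.

Lemma sinB_le (y : R) : `|y| <= 1 -> `|sin y - y| <= y ^+ 2.
Proof.
wlog y0 : y / 0 <= y.
  move=> h y1; have [y0|y0] := leP 0 y; first exact: h.
  have := h (- y); rewrite normrN sinN sqrrN -opprD normrN; apply => //; lra.
rewrite (ger0_norm y0) => y1.
have [|c] := @MVT_segment R (fun x => sin x - x) (fun x => cos x - 1) 0 y y0 (fun x _ => is_deriveB _ _).
  apply: continuous_subspaceT => x; apply: cvgB; [exact: continuous_sin|exact: cvg_id].
rewrite in_itv /= => /andP[c0 cy]; rewrite sin0 !subr0 => ->.
rewrite normrM (ger0_norm y0) expr2 ler_wpM2r //.
apply: le_trans (cosB1_le c) _; nra.
Qed.

(** Only [1 + x <= expR x] is used: at [- x] it gives the upper bound [expR x * (1 - x) <= 1]. *)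
Lemma expRB1_le (x : R) : `|x| <= 1 / 2 -> `|expR x - 1 - x| <= 2 * x ^+ 2.
Proof.
move=> hx; have := hx; rewrite ler_norml => /andP[h1 h2].
have e1 := expR_ge1Dx x.
have e2 : expR x * (1 - x) <= 1.
  have := expR_ge1Dx (- x); have := expRxMexpNx_1 x; have := expR_gt0 x.
  set a := expR x; set b := expR (- x) => a0 ab b1; nra.
rewrite ger0_norm; last lra.
have h3 : expR x <= 2 by nra.
nra.
Qed.

End RealTrig.

(** * Complex exponential, Euler's formula, size of the sine *)

Section Cexp.
Variable R : realType.
Local Notation C := R[i].
Implicit Types z w : C.

Definition cexp z : C := (expR (cre z) * cos (cim z)) +i* (expR (cre z) * sin (cim z)).

Lemma cre1 : cre (1 : C) = 1. Proof. by []. Qed.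
Lemma cim1 : cim (1 : C) = 0. Proof. by []. Qed.
Lemma cre_cexp z : cre (cexp z) = expR (cre z) * cos (cim z). Proof. by []. Qed.
Lemma cim_cexp z : cim (cexp z) = expR (cre z) * sin (cim z). Proof. by []. Qed.

Lemma cexpD z w : cexp (z + w) = cexp z * cexp w.
Proof.
apply: c_ext; rewrite ?creM ?cimM /cexp /cre /cim /= -/(cre _) -/(cim _).
  by rewrite creD cimD expRD cosD; ring.
by rewrite creD cimD expRD sinD; ring.
Qed.

Lemma cexp0 : cexp 0 = 1.
Proof. by apply: c_ext; rewrite /cexp /cre /cim /= expR0 ?cos0 ?sin0; ring. Qed.

Lemma cexpN z : cexp z * cexp (- z) = 1.
Proof. by rewrite -cexpD subrr cexp0. Qed.

Lemma cabs_cexp z : cabs (cexp z) = expR (cre z).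
Proof.
rewrite /cabs /cexp /cre /cim /= -/(cre _) -/(cim _) !exprMn -mulrDr.
by rewrite cos2Dsin2 mulr1 sqrtr_sqr ger0_norm // expR_ge0.
Qed.

Lemma cexpM z n : cexp (n%:R * z) = cexp z ^+ n.
Proof.
elim: n => [|n IH]; first by rewrite mul0r cexp0.
by rewrite exprS -IH -cexpD mulrSr mulrDl mul1r addrC.
Qed.

(** With [z = x + i y] the real quadratic bounds add up to at most [4 x ^ 2 + 5 y ^ 2], so the
    constant 9 is generous. *)
Lemma cexp_approx z : cabs z <= 1 / 2 -> cabs (cexp z - 1 - z) <= 9 * cabs z ^+ 2.
Proof.
move=> hz; have hx := le_trans (cre_le_cabs z) hz; have hy := le_trans (cim_le_cabs z) hz.
have := expRB1_le hx; have := @cosB1_le R (cim z).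
have := @sinB_le R (cim z) (ltac:(lra)).
have : expR (cre z) <= 2.
  by have := expRB1_le hx; move: hx; rewrite !ler_norml => /andP[? ?] /andP[? ?]; nra.
have := expR_gt0 (cre z).
have hs := sqr_cabs z.
set x := cre z in hx hs *; set y := cim z in hy hs *; set E := expR x => E0 E2 s1 c1 e1.
apply: le_trans (cabs_le_reim _) _.
have -> : cre (cexp z - 1 - z) = E * (cos y - 1) + (E - 1 - x).
  by rewrite !creD !creN cre1 cre_cexp -/x -/y -/E; ring.
have -> : cim (cexp z - 1 - z) = E * (sin y - y) + (E - 1 - x) * y + x * y.
  by rewrite !cimD !cimN cim1 cim_cexp -/x -/y -/E; ring.
have h1 : `|E * (cos y - 1)| <= 2 * y ^+ 2.
  by rewrite normrM (gtr0_norm E0) ler_pM // ltW.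
have h2 : `|E * (sin y - y)| <= 2 * y ^+ 2.
  by rewrite normrM (gtr0_norm E0) ler_pM // ltW.
have h3 : `|(E - 1 - x) * y| <= 2 * x ^+ 2 * (1 / 2) by rewrite normrM ler_pM.
have h4 : `|x * y| <= x ^+ 2 + y ^+ 2.
  by rewrite ler_norml; apply/andP; split; nra.
have := ler_normD (E * (cos y - 1)) (E - 1 - x).
have := ler_normD (E * (sin y - y) + (E - 1 - x) * y) (x * y).
have := ler_normD (E * (sin y - y)) ((E - 1 - x) * y).
have := sqr_ge0 x; have := sqr_ge0 y.
lra.
Qed.

Lemma ler_cabs_subX (a b : C) (K : R) n : cabs a <= K -> cabs b <= K ->
  cabs (a ^+ n.+1 - b ^+ n.+1) <= n.+1%:R * cabs (a - b) * K ^+ n.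
Proof.
move=> ha hb; have K0 : 0 <= K by apply: le_trans ha.
elim: n => [|n IH]; first by rewrite !expr1 mul1r mulr1.
have -> : a ^+ n.+2 - b ^+ n.+2 = a * (a ^+ n.+1 - b ^+ n.+1) + (a - b) * b ^+ n.+1.
  by rewrite (exprS a n.+1) (exprS b n.+1); ring.
apply: le_trans (ler_cabsD _ _) _; rewrite !cabsM cabsX.
have h1 : cabs a * cabs (a ^+ n.+1 - b ^+ n.+1) <= K * (n.+1%:R * cabs (a - b) * K ^+ n) by rewrite ler_pM.
have h2 : cabs (a - b) * cabs b ^+ n.+1 <= cabs (a - b) * K ^+ n.+1.
  by rewrite ler_wpM2l // lerXn2r ?nnegrE.
apply: le_trans (lerD h1 h2) _.
by rewrite (exprS K n) -(natr1 n.+1); lra.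
Qed.

(** The approximants are [(1 + z / n) ^ n]. Both [cexp (z / n)] and [1 + z / n] have modulus at most
    [expR (r / n)], so [ler_cabs_subX] turns the quadratic error of one factor into a total error of
    order [1 / n]. *)
Lemma entire_cexp : entire cexp.
Proof.
move=> r e e0.
pose r' := Num.max r 1; have r1 : 1 <= r' by rewrite le_max lexx orbT.
pose B := 9 * r' ^+ 2 * expR r'.
have B0 : 0 <= B by rewrite !mulr_ge0 ?exprn_ge0 ?expR_ge0 //; lra.
pose n := Num.bound (Num.max (2 * r') (B / e)).
have hn : Num.max (2 * r') (B / e) < n%:R by apply: archi_boundP; rewrite le_max (divr_ge0 B0 (ltW e0)) orbT.
have {hn} : Num.max (2 * r') (B / e) < n.+1%:R by apply: lt_trans hn _; rewrite ltr_nat.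
rewrite gt_max => /andP[nr nB].
have n0 : 0 < n.+1%:R :> R by rewrite ltr0n.
exists ((1 + (n.+1%:R^-1)%:P * 'X) ^+ n.+1) => z hz.
have {}hz : cabs z <= r' by rewrite le_max hz.
rewrite horner_exp !hornerE.
have nC : n.+1%:R != 0 :> C by rewrite pnatr_eq0.
set w := n.+1%:R^-1 * z.
have hw : cabs w <= r' / n.+1%:R.
  by rewrite /w cabsM cabsV cabs_nat mulrC ler_wpM2r // invr_ge0 ltW.
have -> : cexp z = cexp w ^+ n.+1 by rewrite -cexpM /w mulVKf.
have hw2 : cabs w <= 1 / 2.
  by apply: le_trans hw _; rewrite ler_pdivrMr //; lra.
have K1 : cabs (cexp w) <= expR (r' / n.+1%:R).
  rewrite cabs_cexp ler_expR; apply: le_trans hw.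
  exact: le_trans (ler_norm _) (cre_le_cabs _).
have K2 : cabs (1 + w) <= expR (r' / n.+1%:R).
  apply: le_trans (ler_cabsD _ _) _; rewrite cabs1.
  by apply: le_trans (expR_ge1Dx _); rewrite lerD2l.
apply: le_trans (ler_cabs_subX n K1 K2) _.
have hd : cabs (cexp w - (1 + w)) <= 9 * (r' / n.+1%:R) ^+ 2.
  rewrite opprD addrA; apply: le_trans (cexp_approx hw2) _.
  by rewrite ler_pM2l // lerXn2r ?nnegrE // divr_ge0 // ?ltW //; lra.
have hE : expR (r' / n.+1%:R) ^+ n <= expR r'.
  rewrite -expRM_natl ler_expR mulrA ler_pdivrMr // mulrC ler_wpM2l //; first lra.
  by rewrite ler_nat.
apply: (@le_trans _ _ (n.+1%:R * (9 * (r' / n.+1%:R) ^+ 2) * expR r')).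
  by apply: ler_pM; rewrite ?ler_pM2l ?mulr_ge0 ?exprn_ge0 ?expR_ge0 // ltW.
have -> : n.+1%:R * (9 * (r' / n.+1%:R) ^+ 2) * expR r' = B / n.+1%:R.
  by rewrite /B; field.
by rewrite ler_pdivrMr // mulrC -ler_pdivrMr // ltW.
Qed.

Let I : C := 0 +i* 1.

Lemma csinE z : csin z = (cexp (I * z) - cexp (- (I * z))) / (2 * I).
Proof.
have I0 : 2 * I != 0 :> C.
  rewrite mulf_neq0 ?pnatr_eq0 //; apply/eqP => h.
  by have := congr1 (@cim R) h; rewrite /I /cim /= => /eqP; rewrite oner_eq0.
apply: (mulIf I0); rewrite divfK //.
have h2 : (2 : C) = 2 +i* 0 by rewrite -[LHS](rmorph_nat (real_complex R) 2).
rewrite h2; case: z => x y.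
have -> : I * (x +i* y) = (- y) +i* x by apply: c_ext; rewrite ?creM ?cimM /I /cre /cim /=; ring.
have -> : - ((- y) +i* x) = y +i* (- x) by apply: c_ext; rewrite ?creN ?cimN /cre /cim /= ?opprK.
rewrite /cexp /csin /I; apply: c_ext; rewrite ?(creM, cimM, creD, cimD, creN, cimN) /cre /cim /= ?sinN ?cosN; by field.
Qed.

Definition ccos z : C := (cexp (I * z) + cexp (- (I * z))) / 2.

Lemma entire_csin : entire (@csin R).
Proof.
have h c : entire (fun z => cexp (c * z)).
  by apply: entire_ext (entire_scale c entire_cexp) => z; rewrite mulrC.
apply: entire_ext (entireZ (2 * I)^-1 (entireB (h I) (h (- I)))) => z.
by rewrite csinE mulNr mulrC.
Qed.

Lemma entire_ccos : entire ccos.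
Proof.
have h c : entire (fun z => cexp (c * z)).
  by apply: entire_ext (entire_scale c entire_cexp) => z; rewrite mulrC.
apply: entire_ext (entireZ (2)^-1 (entireD (h I) (h (- I)))) => z.
by rewrite /ccos mulNr mulrC.
Qed.

Lemma I_neq0 : I != 0.
Proof.
apply/eqP => h; have := congr1 (@cim R) h; rewrite /I /cim /= => /eqP.
by rewrite oner_eq0.
Qed.

Lemma sqrI : I ^+ 2 = -1.
Proof. by apply: c_ext; rewrite /I expr2 ?(creM, cimM, creN, cimN) /cre /cim /=; ring. Qed.

Lemma csinD z w : csin (z + w) = csin z * ccos w + ccos z * csin w.
Proof.
rewrite !csinE /ccos mulrDr opprD !cexpD; field.
by rewrite I_neq0.
Qed.

Lemma csinN z : csin (- z) = - csin z.
Proof. by rewrite !csinE mulrN opprK; field; rewrite I_neq0. Qed.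

Lemma ccosN z : ccos (- z) = ccos z.
Proof. by rewrite /ccos mulrN opprK addrC. Qed.

Lemma csin2 z : csin (2 * z) = 2 * csin z * ccos z.
Proof. by rewrite mulr_natl mulr2n csinD; ring. Qed.

Lemma csinR (x : R) : csin x%:C = (sin x)%:C.
Proof.
by rewrite /csin /= /cre /cim /= oppr0 expR0; apply: c_ext; rewrite /cre /cim /=; field.
Qed.

Lemma ccosR (x : R) : ccos x%:C = (cos x)%:C.
Proof.
rewrite /ccos; apply: (@mulIf _ 2); first by rewrite pnatr_eq0.
rewrite divfK ?pnatr_eq0 //.
have -> : I * x%:C = 0 +i* x by apply: c_ext; rewrite ?creM ?cimM /I /cre /cim /=; ring.
have -> : - (0 +i* x) = 0 +i* (- x) by apply: c_ext; rewrite ?creN ?cimN /cre /cim /= ?oppr0.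
have h2 : (2 : C) = 2 +i* 0 by rewrite -[LHS](rmorph_nat (real_complex R) 2).
rewrite h2 /cexp; apply: c_ext; rewrite ?(creM, cimM, creD, cimD, creN, cimN) /cre /cim /= ?sinN ?cosN ?expR0; by ring.
Qed.

Lemma csinDpi z : csin (z + (pi : R)%:C) = - csin z.
Proof.
rewrite csinD csinR ccosR sinpi cospi rmorphN rmorph1.
by rewrite mulrN1 rmorph0 mulr0 addr0.
Qed.

Lemma csinDnpi z n : csin (z + (pi : R)%:C *+ n) = (-1) ^+ n * csin z.
Proof. by rewrite (@alternatingn C C) // => w; rewrite csinDpi. Qed.

Lemma csin_shift z (m : int) : csin (z + m%:~R * (pi : R)%:C) = (-1) ^+ `|m|%N * csin z.
Proof.
case: m => n; first by rewrite -csinDnpi mulr_natl.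
rewrite NegzE abszN absz_nat.
have := csinDnpi (z - (pi : R)%:C *+ n.+1) n.+1; rewrite subrK => ->.
rewrite mulrA -exprMn mulrNN mulr1 expr1n mul1r; congr csin.
by rewrite mulrNz mulNr mulr_natl.
Qed.

Lemma ccosE z : ccos z = csin (z + (pi / 2 : R)%:C).
Proof.
rewrite csinD csinR ccosR sin_pihalf cos_pihalf.
by rewrite rmorph0 rmorph1 mulr0 add0r mulr1.
Qed.

(** Since [cosh ^ 2 = 1 + sinh ^ 2], the variables separate. Both the zeros of the sine and its
    lower bound are read off this sum of squares. *)
Lemma cabs_csin_sqr z : cabs (csin z) ^+ 2 =
  sin (cre z) ^+ 2 + ((expR (cim z) - expR (- cim z)) / 2) ^+ 2.
Proof.
have := cos2sin2 (cre z); have := expRxMexpNx_1 (cim z); rewrite sqr_cabs.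
have -> : cre (csin z) = sin (cre z) * ((expR (cim z) + expR (- cim z)) / 2) by [].
have -> : cim (csin z) = cos (cre z) * ((expR (cim z) - expR (- cim z)) / 2) by [].
set s := sin _; set c := cos _; set a := expR _; set b := expR _ => ab cs.
rewrite [(s * _) ^+ 2]exprMn [(c * _) ^+ 2]exprMn cs.
have -> : ((a + b) / 2) ^+ 2 = ((a - b) / 2) ^+ 2 + a * b by field.
by rewrite ab; ring.
Qed.

Lemma csin_eq0 z : csin z = 0 -> cim z = 0 /\ sin (cre z) = 0.
Proof.
move=> h; have := cabs_csin_sqr z; rewrite h cabs0 expr0n /= => /eqP.
rewrite eq_sym paddr_eq0 ?sqr_ge0 // !sqrf_eq0 => /andP[/eqP s0].
rewrite mulf_eq0 invr_eq0 pnatr_eq0 orbF subr_eq0 => /eqP/expR_inj e.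
by split=> //; lra.
Qed.

Lemma cabs_csin_le z : cabs (csin z) <= expR `|cim z|.
Proof.
rewrite csinE cabsf cabsM cabs_nat.
have -> : cabs I = 1 by rewrite /I /cabs /cre /cim /= expr0n add0r expr1n sqrtr1.
rewrite mulr1 ler_pdivrMr //; apply: le_trans (ler_cabsB _ _) _.
rewrite !cabs_cexp creN.
have -> : cre (I * z) = - cim z by rewrite creM /I /cre /cim /=; ring.
have h1 : expR (- cim z) <= expR `|cim z| by rewrite ler_expR -normrN ler_norm.
have h2 : expR (- - cim z) <= expR `|cim z| by rewrite opprK ler_expR ler_norm.
lra.
Qed.

Lemma cabs_ccos_le z : cabs (ccos z) <= expR `|cim z|.
Proof.
by rewrite ccosE; apply: le_trans (cabs_csin_le _) _; rewrite cimD addr0.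
Qed.

Lemma int_near (x : R) : exists m : int, `|x - m%:~R * pi| <= pi / 2.
Proof.
have p0 := pi_gt0 R.
exists (Num.floor (x / pi + 1 / 2)).
have := real_floor_itv (num_real (x / pi + 1 / 2)); set m := Num.floor _.
rewrite intrD mulr1z => /andP[]; set M := m%:~R => h1 h2.
have e : x = (x / pi) * pi by rewrite divfK // gt_eqF.
set t := x / pi in e h1 h2.
by rewrite e ler_norml; apply/andP; split; nra.
Qed.

(** A shift by the nearest multiple of pi gives [|Re z| <= pi / 2]; then [|Im z|] or [|Re z|] is at
    least [r / 2]. In the first case [sinh] dominates; in the second [sin (r / 2)] does, and the
    factor [expR (- (r / 2))] in [c] absorbs the bounded exponential. *)
Lemma csin_lower (r : R) : 0 < r -> r < pi -> exists2 c, 0 < c & forall z,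
  (forall m : int, r <= cabs (z - m%:~R * (pi : R)%:C)) -> c * expR `|cim z| <= cabs (csin z).
Proof.
move=> r0 rpi.
have s0 : 0 < sin (r / 2) by apply: sin_gt0_pihalf; apply/andP; split; lra.
have e0 : 0 < (1 - expR (- r)) / 2 by rewrite divr_gt0 // subr_gt0 expR_lt1; lra.
pose c := Num.min (sin (r / 2) * expR (- (r / 2))) ((1 - expR (- r)) / 2).
have c1 : c <= sin (r / 2) * expR (- (r / 2)) by rewrite ge_min lexx.
have c2 : c <= (1 - expR (- r)) / 2 by rewrite ge_min lexx orbT.
exists c; first by rewrite lt_min e0 mulr_gt0 // expR_gt0.
move=> z hz; have [m hm] := int_near (cre z).
set z' := z - m%:~R * (pi : R)%:C.
have z'E : z = z' + m%:~R * (pi : R)%:C by rewrite subrK.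
have mpiE : m%:~R * (pi : R)%:C = (m%:~R * pi)%:C by rewrite rmorphM rmorph_int.
have iz' : cim z' = cim z by rewrite /z' mpiE cimD cimN cimR subr0.
have rz' : cre z' = cre z - m%:~R * pi by rewrite /z' mpiE creD creN creR.
have -> : cabs (csin z) = cabs (csin z').
  by rewrite z'E csin_shift cabsM cabsX cabsN cabs1 expr1n mul1r.
have {hz}hz : r <= cabs z' := hz m.
rewrite -iz'; rewrite -rz' in hm; move: z' hz hm {iz' rz' z'E} => {mpiE z m} z hz hx.
have [y0|y0] := leP (r / 2) `|cim z|.
- rewrite -(@ler_pXn2r _ 2) ?nnegrE ?mulr_ge0 ?expR_ge0 //; last first.
    by rewrite ltW // lt_min e0 mulr_gt0 // expR_gt0.
  rewrite cabs_csin_sqr; apply: le_trans (_ : ((expR (cim z) - expR (- cim z)) / 2) ^+ 2 <= _); last first.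
    by rewrite lerDr sqr_ge0.
  have -> : ((expR (cim z) - expR (- cim z)) / 2) ^+ 2 = ((expR `|cim z| - expR (- `|cim z|)) / 2) ^+ 2.
    have [h|h] := leP 0 (cim z); first by rewrite ger0_norm.
    by rewrite ltr0_norm // opprK -sqrrN -mulNr opprB.
  set y := `|cim z| in y0 *.
  have ey : expR (- y) <= expR y * expR (- r) by rewrite -expRD ler_expR; lra.
  have h : c * expR y <= (expR y - expR (- y)) / 2.
    apply: le_trans (_ : (1 - expR (- r)) / 2 * expR y <= _).
      by rewrite ler_wpM2r ?expR_ge0.
    lra.
  apply: lerXn2r => //; rewrite nnegrE; last apply: le_trans h; rewrite mulr_ge0 ?expR_ge0 //;
    by rewrite ltW // lt_min e0 mulr_gt0 // expR_gt0.
have hx2 : r / 2 <= `|cre z| by have := cabs_le_reim z; lra.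
have hs : sin (r / 2) <= `|sin (cre z)|.
  have -> : `|sin (cre z)| = sin `|cre z|.
    have [h|h] := leP 0 (cre z).
      rewrite (ger0_norm h) ger0_norm // sin_ge0_pi // h /=; move: hx; rewrite ger0_norm //; have := pi_gt0 R; lra.
    move: hx; rewrite (ltr0_norm h) sinN => hx.
    rewrite -normrN ger0_norm // -sinN sin_ge0_pi //; have := pi_gt0 R; lra.
  move: hx2; rewrite le_eqVlt => /orP[/eqP <-//|hx2].
  by rewrite ltW // ltr_sin // in_itv /=; apply/andP; split; lra.
apply: (@le_trans _ _ (sin (r / 2))).
  apply: le_trans (_ : sin (r / 2) * expR (- (r / 2)) * expR `|cim z| <= _).
    by rewrite ler_wpM2r ?expR_ge0.
  rewrite -mulrA ler_piMr ?(ltW s0) // -expRD expR_le1; lra.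
apply: le_trans hs _.
rewrite -(@ler_pXn2r _ 2) ?nnegrE // cabs_csin_sqr real_normK ?num_real //.
by rewrite lerDl sqr_ge0.
Qed.

Lemma csin_zero z : csin z = 0 -> exists m : int, z = m%:~R * (pi : R)%:C.
Proof.
move=> h; have p0 := pi_gt0 R.
have [m hm] := int_near (cre z); exists m.
have [i0 s0] := csin_eq0 h.
apply: contrapT => hzm.
have mpiE : m%:~R * (pi : R)%:C = (m%:~R * pi)%:C by rewrite rmorphM rmorph_int.
pose z' := z - m%:~R * (pi : R)%:C.
have z'0 : z' != 0 by rewrite subr_eq0; apply/eqP.
have sz' : csin z' = 0.
  move: h; rewrite -[z in csin z](subrK (m%:~R * (pi : R)%:C)) csin_shift => /eqP.
  by rewrite mulf_eq0 signr_eq0 /= => /eqP.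
have [_ s'0] := csin_eq0 sz'.
have rz' : cre z' = cre z - m%:~R * pi by rewrite /z' mpiE creD creN creR.
have iz' : cim z' = 0 by rewrite /z' mpiE cimD cimN cimR subr0.
have cz' : cre z' = 0.
  rewrite -rz' in hm; move: hm; rewrite ler_norml => /andP[h1 h2].
  apply: sin_inj; rewrite ?in_itv /= ?sin0 ?s'0 ?h1 ?h2 //.
  by apply/andP; split; lra.
by move/eqP: z'0; apply; apply: c_ext.
Qed.

(** Makes [sin w / w] available without a singularity. Its value at 0 is obtained along small
    positive reals, where [|sin x - x| <= x ^ 2]. *)
Lemma csin_div : exists2 g : C -> C, entire g &
  (forall w, csin w = w * g w) /\ g 0 = 1.
Proof.
have [|g eg hg] := entire_div0 entire_csin; first by rewrite -(rmorph0 (real_complex R)) csinR sin0 rmorph0.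
exists g => //; split=> //; apply/eqP; rewrite -subr_eq0 -cabs_eq0 eq_le cabs_ge0 andbT.
apply: (@le_archi _ _ _ 2) => m; rewrite add0r.
have e0 : 0 < m.+1%:R^-1 :> R by rewrite invr_gt0 ltr0n.
set e := _^-1 in e0 *.
have [d d0 hd] := entire_cont 0 eg e0.
pose x := Num.min (Num.min 1 e) (d / 2).
have x0 : 0 < x by rewrite !lt_min ltr01 e0 divr_gt0.
have x1 : x <= 1 by rewrite !ge_min lexx.
have xe : x <= e by rewrite !ge_min lexx orbT.
have xd : x <= d / 2 by rewrite ge_min lexx orbT.
clearbody x.
have h1 : cabs (g x%:C - g 0) < e.
  by apply: hd; rewrite subr0 cabsR gtr0_norm //; lra.
have h2 : cabs (g x%:C - 1) <= x.
  have xC : x%:C != 0 by rewrite -cabs_gt0 cabsR gtr0_norm.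
  have -> : g x%:C - 1 = (sin x - x)%:C / x%:C.
    by rewrite rmorphB /= -csinR hg; field; exact: xC.
  rewrite cabsf !cabsR (gtr0_norm x0) ler_pdivrMr // -expr2.
  by apply: sinB_le; rewrite gtr0_norm.
have := ler_cabsB (g x%:C - 1) (g x%:C - g 0).
have -> : g x%:C - 1 - (g x%:C - g 0) = g 0 - 1 by ring.
lra.
Qed.

End Cexp.

(** * Complex-valued Lebesgue integrals *)

Section Integrals.
Variable R : realType.
Local Notation C := R[i].
Local Notation mu := (@lebesgue_measure R).
Variable L : R.
Hypothesis L0 : 0 < L.
Local Notation integ f := (mu.-integrable `[0, L]%classic (EFin \o f)).
Implicit Types (f g k : R -> R) (u v w : R -> C).

Lemma mitv a b : measurable (`[a, b]%classic : set (measurableTypeR R)).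
Proof. exact: measurable_itv. Qed.
Hint Resolve mitv : core.

Lemma integ_sub f a b : integ f -> 0 <= a -> b <= L -> mu.-integrable `[a, b]%classic (EFin \o f).
Proof.
move=> h a0 bL; apply: integrableS h => //.
by apply: subset_itv; rewrite bnd_simp.
Qed.

Lemma integ_ext f g : (forall t, 0 <= t <= L -> f t = g t) -> integ f -> integ g.
Proof.
move=> h; apply: eq_integrable => // t; rewrite inE /= in_itv /= => ht.
by rewrite h.
Qed.

Lemma integD f g : integ f -> integ g -> integ (fun t => f t + g t).
Proof. by move=> hf hg; have := integrableD (mitv _ _) hf hg; apply: eq_integrable. Qed.

Lemma integZ c f : integ f -> integ (fun t => c * f t).
Proof. by move=> hf; have := integrableZl (mitv _ _) c hf; apply: eq_integrable. Qed.

Lemma integN f : integ f -> integ (fun t => - f t).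
Proof. by move=> /(integZ (-1)); apply: integ_ext => t _; rewrite mulN1r. Qed.

Lemma integB f g : integ f -> integ g -> integ (fun t => f t - g t).
Proof. by move=> hf hg; apply: integD => //; exact: integN. Qed.

Lemma integ_cont g : {within `[0, L], continuous g} -> integ g.
Proof. by apply: continuous_compact_integrable; exact: segment_compact. Qed.

Lemma integ_cst c : integ (fun=> c).
Proof. by apply: integ_cont; apply: continuous_subspaceT => x; exact: cvg_cst. Qed.

Lemma integ_norm f : integ f -> integ (fun t => `|f t|).
Proof. exact: integrable_norm. Qed.

Lemma continuous_itv_bounded g : {within `[0, L], continuous g} ->
  exists2 M, 0 <= M & forall t, 0 <= t <= L -> `|g t| <= M.
Proof.
move=> cg; have /compact_bounded[M [_ hM]] : compact (g @` `[0, L]).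
  by apply: continuous_compact => //; exact: segment_compact.
exists (`|M| + 1) => [|t ht]; first by rewrite addr_ge0.
apply: hM; first by rewrite (le_lt_trans (ler_norm _)) // ltrDl.
by exists t => //=; rewrite in_itv.
Qed.

Lemma integM_cont f g : {within `[0, L], continuous g} -> integ f -> integ (fun t => g t * f t).
Proof.
move=> cg hf; have := @integrableMr _ _ _ mu _ (mitv 0 L) g _ _ _ hf; apply.
  by apply: subspace_continuous_measurable_fun.
have [M M0 hM] := continuous_itv_bounded cg.
exists M; split; first exact: num_real.
move=> x xM t /=; rewrite in_itv /= => ht; apply: le_trans (hM t ht) _; exact: ltW.
Qed.

Local Notation I f a b := (\int[mu]_(t in `[a, b]) f t).

Lemma RintB f a b : integ f -> 0 <= a -> a <= b -> b <= L ->
  I f 0 b - I f 0 a = I f a b.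
Proof.
move=> hf a0 ab bL.
rewrite -(@Rintegral_itv_obnd_cbnd _ a (BRight b)); last first.
  apply: integrableS (integ_sub hf a0 bL) => //.
  by apply: subset_itv; rewrite bnd_simp.
by rewrite Rintegral_itvB // ?bnd_simp //; apply: integ_sub.
Qed.

Lemma Rint0 f a : I f a a = 0.
Proof. by rewrite set_itv1 Rintegral_set1. Qed.

Lemma Rint_le f g a b : integ f -> integ g -> 0 <= a -> b <= L ->
  (forall t, a <= t <= b -> f t <= g t) -> I f a b <= I g a b.
Proof.
move=> hf hg a0 bL h; apply: le_Rintegral; [exact: mitv|exact: integ_sub..|].
by move=> t /=; rewrite in_itv /=; exact: h.
Qed.

Lemma Rint_norm f g a b : integ f -> integ g -> 0 <= a -> b <= L ->
  (forall t, a <= t <= b -> `|f t| <= g t) -> `|I f a b| <= I g a b.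
Proof.
move=> hf hg a0 bL h.
apply: le_trans (le_normr_Rintegral _ _) _; [exact: mitv|exact: integ_sub|].
by apply: Rint_le => //; exact: integ_norm.
Qed.

Lemma RintD f g a b : integ f -> integ g -> 0 <= a -> b <= L ->
  I (fun t => f t + g t) a b = I f a b + I g a b.
Proof. by move=> hf hg a0 bL; rewrite RintegralD //; exact: integ_sub. Qed.

Lemma RintZ c f a b : integ f -> 0 <= a -> b <= L ->
  I (fun t => c * f t) a b = c * I f a b.
Proof. by move=> hf a0 bL; rewrite RintegralZl //; exact: integ_sub. Qed.

Lemma Rint_cst c a b : a <= b -> I (fun=> c) a b = c * (b - a).
Proof.
move=> ab; rewrite Rintegral_cst //= lebesgue_measure_itv /= lte_fin.
move: ab; rewrite le_eqVlt => /orP[/eqP->|ab]; first by rewrite ltxx subrr.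
by rewrite ab -EFinB.
Qed.

Lemma Rint_cont f : integ f -> {within `[0, L], continuous (fun x => I f 0 x)}.
Proof. by move=> hf; apply: parameterized_integral_continuous => //; exact: ltW. Qed.

(** * Componentwise integrability and continuity *)

Definition cinteg u := integ (fun t => cre (u t)) /\ integ (fun t => cim (u t)).
Definition ccts u := {within `[0, L], continuous (fun t => cre (u t))} /\
  {within `[0, L], continuous (fun t => cim (u t))}.
(** The sum norm dominates [cabs], and its integrability follows at once from that of the two
    components. *)
Definition n1 (z : C) : R := `|cre z| + `|cim z|.

Lemma cabs_n1 z : cabs z <= n1 z.
Proof. exact: cabs_le_reim. Qed.

Lemma n1_ge0 z : 0 <= n1 z.
Proof. by rewrite /n1 addr_ge0. Qed.

Lemma integ_n1 u : cinteg u -> integ (fun t => n1 (u t)).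
Proof. by move=> [h1 h2]; apply: integD; exact: integ_norm. Qed.

Lemma cinteg_ext u v : (forall t, 0 <= t <= L -> u t = v t) -> cinteg u -> cinteg v.
Proof. by move=> h [h1 h2]; split; [apply: integ_ext h1|apply: integ_ext h2] => t ht; rewrite h. Qed.

Lemma cintegD u v : cinteg u -> cinteg v -> cinteg (fun t => u t + v t).
Proof.
move=> [h1 h2] [h3 h4]; split.
  by apply: integ_ext (integD h1 h3) => t _; rewrite creD.
by apply: integ_ext (integD h2 h4) => t _; rewrite cimD.
Qed.

Lemma cintegM_cts u v : ccts u -> cinteg v -> cinteg (fun t => u t * v t).
Proof.
move=> [c1 c2] [h1 h2]; split.
  by apply: integ_ext (integB (integM_cont c1 h1) (integM_cont c2 h2)) => t _; rewrite creM.
by apply: integ_ext (integD (integM_cont c1 h2) (integM_cont c2 h1)) => t _; rewrite cimM.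
Qed.

Lemma ccts_cst (c : C) : ccts (fun=> c).
Proof. by split; apply: continuous_subspaceT => x; exact: cvg_cst. Qed.

Lemma ccts_integ u : ccts u -> cinteg u.
Proof. by move=> [h1 h2]; split; exact: integ_cont. Qed.

Lemma cintegZ c u : cinteg u -> cinteg (fun t => c * u t).
Proof. by move=> h; apply: cintegM_cts => //; exact: ccts_cst. Qed.

Lemma cintegN u : cinteg u -> cinteg (fun t => - u t).
Proof. by move=> /(cintegZ (-1)); apply: cinteg_ext => t _; rewrite mulN1r. Qed.

Lemma cintegB u v : cinteg u -> cinteg v -> cinteg (fun t => u t - v t).
Proof. by move=> hu hv; apply: cintegD => //; exact: cintegN. Qed.

Lemma cinteg_cst (c : C) : cinteg (fun=> c).
Proof. by apply: ccts_integ; exact: ccts_cst. Qed.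

Lemma ccts_ext u v : (forall t, 0 <= t <= L -> u t = v t) -> ccts u -> ccts v.
Proof.
by move=> h [h1 h2]; split; [apply: subspace_eq_continuous h1|apply: subspace_eq_continuous h2];
  move=> t; rewrite inE /= in_itv /= => ht; rewrite /= /from_subspace /= h.
Qed.

Lemma cctsD u v : ccts u -> ccts v -> ccts (fun t => u t + v t).
Proof.
move=> [h1 h2] [h3 h4]; split.
  have -> : (fun t => cre (u t + v t)) = (fun t => cre (u t) + cre (v t)) by apply/funext => t; rewrite creD.
  by move=> x; apply: cvgD; [exact: h1|exact: h3].
have -> : (fun t => cim (u t + v t)) = (fun t => cim (u t) + cim (v t)) by apply/funext => t; rewrite cimD.
by move=> x; apply: cvgD; [exact: h2|exact: h4].
Qed.

Lemma cctsM u v : ccts u -> ccts v -> ccts (fun t => u t * v t).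
Proof.
move=> [h1 h2] [h3 h4]; split.
  have -> : (fun t => cre (u t * v t)) = (fun t => cre (u t) * cre (v t) - cim (u t) * cim (v t)) by apply/funext => t; rewrite creM.
  by move=> x; apply: cvgB; apply: cvgM; [exact: h1|exact: h3|exact: h2|exact: h4].
have -> : (fun t => cim (u t * v t)) = (fun t => cre (u t) * cim (v t) + cim (u t) * cre (v t)) by apply/funext => t; rewrite cimM.
by move=> x; apply: cvgD; apply: cvgM; [exact: h1|exact: h4|exact: h2|exact: h3].
Qed.

Lemma ccts_int u : cinteg u -> ccts (fun x => cintegral 0 x u).
Proof. by move=> [h1 h2]; split; exact: Rint_cont. Qed.

Lemma ccts_cexp (k : C) : ccts (fun t => cexp (k * t%:C)).
Proof.
have h1 (a : R) : continuous (fun t : R => a * t) by move=> x; apply: cvgM; [exact: cvg_cst|exact: cvg_id].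
have h2 (a : R) : continuous (fun t : R => expR (a * t)).
  by move=> x; apply: (@continuous_comp _ _ _ (fun t : R => a * t) expR); [exact: h1|exact: continuous_expR].
split; apply: continuous_subspaceT => x.
  have -> : (fun t => cre (cexp (k * t%:C))) = (fun t => expR (cre k * t) * cos (cim k * t)).
    by apply/funext => t; rewrite cre_cexp creM cimM creR cimR !mulr0 subr0 add0r.
  apply: cvgM; first exact: h2.
  by apply: (@continuous_comp _ _ _ (fun t : R => cim k * t) cos); [exact: h1|exact: continuous_cos].
have -> : (fun t => cim (cexp (k * t%:C))) = (fun t => expR (cre k * t) * sin (cim k * t)).
  by apply/funext => t; rewrite cim_cexp creM cimM creR cimR !mulr0 subr0 add0r.
apply: cvgM; first exact: h2.
by apply: (@continuous_comp _ _ _ (fun t : R => cim k * t) sin); [exact: h1|exact: continuous_sin].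
Qed.

Lemma cint_ext u v a b : (forall t, a <= t <= b -> u t = v t) -> cintegral a b u = cintegral a b v.
Proof.
move=> h; rewrite /cintegral; congr (_ +i* _); apply: eq_Rintegral => t;
  by rewrite inE /= in_itv /= => ht; rewrite h.
Qed.

Lemma cintB u a b : cinteg u -> 0 <= a -> a <= b -> b <= L ->
  cintegral 0 b u - cintegral 0 a u = cintegral a b u.
Proof.
move=> [h1 h2] a0 ab bL; apply: c_ext; rewrite ?creD ?cimD ?creN ?cimN; exact: RintB.
Qed.

Lemma cint0 u a : cintegral a a u = 0.
Proof. by rewrite /cintegral !Rint0. Qed.

Lemma cintD u v a b : cinteg u -> cinteg v -> 0 <= a -> b <= L ->
  cintegral a b (fun t => u t + v t) = cintegral a b u + cintegral a b v.
Proof.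
move=> [h1 h2] [h3 h4] a0 bL; apply: c_ext; rewrite ?creD ?cimD /cintegral /cre /cim /= -RintD //;
  by apply: eq_Rintegral => t _; rewrite -?/(cre _) -?/(cim _) ?creD ?cimD.
Qed.

Lemma cre_cint u a b : cre (cintegral a b u) = I (fun t => cre (u t)) a b.
Proof. by []. Qed.

Lemma cim_cint u a b : cim (cintegral a b u) = I (fun t => cim (u t)) a b.
Proof. by []. Qed.

Lemma cintZ c u a b : cinteg u -> 0 <= a -> b <= L ->
  cintegral a b (fun t => c * u t) = c * cintegral a b u.
Proof.
move=> [h1 h2] a0 bL; apply: c_ext; rewrite ?creM ?cimM !cre_cint !cim_cint.
  have -> : I (fun t => cre (c * u t)) a b = I (fun t => cre c * cre (u t) + - cim c * cim (u t)) a b.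
    by apply: eq_Rintegral => t _; rewrite creM mulNr.
  by rewrite RintD ?RintZ ?mulNr //; exact: integZ.
have -> : I (fun t => cim (c * u t)) a b = I (fun t => cre c * cim (u t) + cim c * cre (u t)) a b.
  by apply: eq_Rintegral => t _; rewrite cimM.
by rewrite RintD ?RintZ //; exact: integZ.
Qed.

(* The factor 2 comes from bounding the real and imaginary parts separately. *)
Lemma cint_le u k a b : cinteg u -> integ k -> 0 <= a -> b <= L ->
  (forall t, a <= t <= b -> cabs (u t) <= k t) -> cabs (cintegral a b u) <= 2 * I k a b.
Proof.
move=> [h1 h2] hk a0 bL h; apply: le_trans (cabs_le_reim _) _.
have e1 : `|cre (cintegral a b u)| <= I k a b.
  by apply: Rint_norm => // t ht; apply: le_trans (h t ht); exact: cre_le_cabs.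
have e2 : `|cim (cintegral a b u)| <= I k a b.
  by apply: Rint_norm => // t ht; apply: le_trans (h t ht); exact: cim_le_cabs.
lra.
Qed.

Lemma cint_cst (c : C) (a b : R) : a <= b -> cintegral a b (fun=> c) = (b - a)%:C * c.
Proof.
move=> ab; rewrite /cintegral !Rint_cst //.
by apply: c_ext; rewrite ?creM ?cimM ?creR ?cimR /cre /cim /=; ring.
Qed.

(** On a bounded interval [|f| <= 1 + f ^ 2] is an integrable majorant. *)
Lemma L2_integ f : measurable_fun `[0, L] f ->
  (\int[mu]_(x in itv0 L) ((f x) ^+ 2)%:E < +oo)%E -> integ f.
Proof.
move=> mf hf.
have h2 : integ (fun x => f x ^+ 2).
  apply/integrableP; split.
    by apply/measurable_EFinP; apply: measurable_funX.
  by under eq_integral => x _ do rewrite /= ger0_norm ?sqr_ge0 //.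
apply: (le_integrable (mitv 0 L) _ _ (integD (integ_cst 1) h2)).
  exact/measurable_EFinP.
move=> x _ /=; rewrite lee_fin [leRHS]ger0_norm; last by rewrite addr_ge0 // sqr_ge0.
rewrite -(real_normK (num_real (f x))); have := normr_ge0 (f x); nra.
Qed.

End Integrals.

(** * Integrating factors for absolutely continuous functions *)

Section ODE.
Variable R : realType.
Local Notation C := R[i].
Local Notation mu := (@lebesgue_measure R).
Variable L : R.
Hypothesis L0 : 0 < L.
Local Notation integ f := (mu.-integrable `[0, L]%classic (EFin \o f)).
Local Notation I f a b := (\int[mu]_(t in `[a, b]) f t).
Local Notation cinteg := (cinteg L).
Local Notation ccts := (ccts L).

(** Serves in place of a Gronwall inequality: a bound that improves from [A] by halving may be
    replaced by its limit [b], whatever the initial [A] was. *)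
Lemma le_halving (x A b c : R) : 0 <= A -> 0 <= c ->
  (forall k, x <= (A / 2 ^+ k + b) * c) -> x <= b * c.
Proof.
move=> A0 c0 h; apply: (@le_archi _ _ _ (A * c)) => k.
apply: le_trans (h k) _; rewrite mulrDl addrC lerD2l mulrAC ler_wpM2l ?mulr_ge0 //.
rewrite lef_pV2 ?posrE ?ltr0n ?exprn_gt0 // -natrX ler_nat; exact: ltn_expl.
Qed.

(* [D] is constant: over n equal pieces its increments sum to O(1/n). *)
Lemma chain_const (D : R -> C) (G : R -> R) (K d : R) : 0 <= K -> 0 < d ->
  (forall a b, 0 <= a -> a <= b -> b <= L -> b - a <= d -> 
     cabs (D b - D a) <= K * (b - a) * (G b - G a)) ->
  (forall a b, 0 <= a -> a <= b -> b <= L -> G a <= G b) ->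
  forall x, 0 <= x <= L -> D x = D 0.
Proof.
move=> K0 d0 h hG x /andP[x0 xL].
apply/eqP; rewrite -subr_eq0 -cabs_eq0 eq_le cabs_ge0 andbT.
apply: (@le_archi _ _ _ (K * x * (G x - G 0))) => m; rewrite add0r.
pose n0 := Num.bound (x / d).
have hn0 : x / d < n0%:R by apply: archi_boundP; rewrite divr_ge0 // ltW.
pose n := (m + n0).+1.
have n0' : 0 < n%:R :> R by rewrite ltr0n.
have hn : x / n%:R <= d.
  rewrite ler_pdivrMr // mulrC -ler_pdivrMr //; apply: ltW; apply: lt_le_trans hn0 _.
  by rewrite ler_nat /n leqW // leq_addl.
pose t (i : nat) : R := x / n%:R * i%:R.
have t0 i : 0 <= t i by rewrite /t !mulr_ge0 // invr_ge0 ltW.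
have tS i : t i.+1 - t i = x / n%:R by rewrite /t -natr1; ring.
have tn : t n = x by rewrite /t divfK // gt_eqF.
have tle i j : (i <= j)%N -> t i <= t j.
  by move=> ij; rewrite /t ler_wpM2l ?ler_nat // divr_ge0 // ltW.
have hi i : (i <= n)%N -> cabs (D (t i) - D 0) <= K * (x / n%:R) * (G (t i) - G 0).
  elim: i => [|i IH] hin; first by rewrite /t mulr0 !subrr cabs0 mulr0.
  have -> : D (t i.+1) - D 0 = (D (t i.+1) - D (t i)) + (D (t i) - D 0) by ring.
  have -> : K * (x / n%:R) * (G (t i.+1) - G 0) = K * (x / n%:R) * (G (t i.+1) - G (t i)) + K * (x / n%:R) * (G (t i) - G 0) by ring.
  apply: le_trans (ler_cabsD _ _) _; apply: lerD; last exact: IH (ltnW hin).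
  rewrite -(tS i); apply: h => //.
  - exact: tle.
  - by apply: le_trans (tle _ _ hin) _; rewrite tn.
  - by rewrite tS.
have := hi n (leqnn _); rewrite tn => H; apply: le_trans H _.
have -> : K * (x / n%:R) * (G x - G 0) = K * x * (G x - G 0) / n%:R by ring.
rewrite ler_wpM2l ?mulr_ge0 ?subr_ge0 ?hG // lef_pV2 ?posrE ?ltr0n //.
by rewrite ler_nat /n ltnS leq_addr.
Qed.

(** A product rule for [cexp (- k x) * V x] that avoids derivatives almost everywhere. The
    difference [D] of the two sides has increments bounded by [(b - a) * (G b - G a)] up to a
    constant, so [chain_const] applies. *)
Lemma integrating_factor (V w : R -> C) (V0 k : C) : cinteg w -> cinteg V ->
  (forall x, 0 <= x <= L -> V x = V0 + cintegral 0 x (fun t => w t + k * V t)) ->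
  forall x, 0 <= x <= L ->
    cexp (- k * x%:C) * V x = V0 + cintegral 0 x (fun t => cexp (- k * t%:C) * w t).
Proof.
move=> iw iV hV.
pose W t := w t + k * V t.
have iW : cinteg W by apply: cintegD => //; exact: cintegZ.
pose P (t : R) := cexp (- k * t%:C).
have iPw : cinteg (fun t => P t * w t) by apply: cintegM_cts => //; exact: ccts_cexp.
(* The summand 1 gives [b - a <= G b - G a], so that errors quadratic in [b - a] also have the form
   required by [chain_const]. *)
pose K := fun t => n1 (w t) + n1 (W t) + 1.
have iK : integ K.
  by apply: integD; [apply: integD; exact: integ_n1|exact: integ_cst].
pose G x := I K 0 x.
have GB a b : 0 <= a -> a <= b -> b <= L -> G b - G a = I K a b.
  by move=> *; exact: (RintB iK).
have Kge (f : R -> R) a b : integ f -> 0 <= a -> a <= b -> b <= L -> 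
    (forall t, f t <= K t) -> I f a b <= G b - G a.
  by move=> iF a0 ab bL hf; rewrite GB //; apply: (Rint_le iF iK).
have hlen a b : 0 <= a -> a <= b -> b <= L -> b - a <= G b - G a.
  move=> a0 ab bL; rewrite -[b - a]mul1r -Rint_cst //.
  apply: Kge => //; first exact: integ_cst.
  by move=> t; rewrite /K lerDr addr_ge0 // n1_ge0.
have hG a b : 0 <= a -> a <= b -> b <= L -> G a <= G b.
  by move=> a0 ab bL; rewrite -subr_ge0; apply: le_trans (hlen _ _ a0 ab bL); rewrite subr_ge0.
have VB a b : 0 <= a -> a <= b -> b <= L -> V b - V a = cintegral a b W.
  move=> a0 ab bL; rewrite -(cintB iW) // !hV ?a0 ?bL ?(le_trans a0 ab) ?(le_trans ab bL) //.
  by rewrite opprD addrACA subrr add0r.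
have VB_le a b : 0 <= a -> a <= b -> b <= L -> cabs (V b - V a) <= 2 * (G b - G a).
  move=> a0 ab bL; rewrite VB //.
  apply: le_trans (cint_le iW (integ_n1 iW) a0 bL (fun t _ => cabs_n1 _)) _.
  rewrite ler_pM2l //; apply: Kge => //; first exact: integ_n1.
  by move=> t; rewrite /K; have := n1_ge0 (w t); lra.
pose A := cabs (V 0) + 2 * (G L - G 0).
have VA t : 0 <= t <= L -> cabs (V t) <= A.
  move=> /andP[t0 tL]; have := VB_le 0 t (lexx _) t0 tL; have := lerB_cabs (V t) (V 0).
  have := hG t L t0 tL (lexx _); rewrite /A; lra.
pose M := expR (cabs k * L).
have PM t : 0 <= t <= L -> cabs (P t) <= M.
  move=> /andP[t0 tL]; rewrite /P cabs_cexp ler_expR.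
  apply: le_trans (ler_norm _) _; apply: le_trans (cre_le_cabs _) _.
  by rewrite cabsM cabsN cabsR (ger0_norm t0) ler_wpM2l.
have M0 : 0 <= M by exact: expR_ge0.
have A0 : 0 <= A by apply: le_trans (VA 0 _) => //; rewrite lexx ltW.
pose c := cabs k; have c0 : 0 <= c by exact: cabs_ge0.
(* Ensures [|k| * (b - a) <= 1 / 2], the range of [cexp_approx], also when [k = 0]. *)
pose d := (1 / 2) / (c + 1).
have d0 : 0 < d by rewrite divr_gt0 // ltr_wpDl.
have P1 a b : 0 <= a -> a <= b -> b <= L -> b - a <= d ->
    cabs (P b - P a + k * (b - a)%:C * P b) <= 9 * c ^+ 2 * M * (b - a) ^+ 2.
  move=> a0 ab bL hd; pose z := k * (b - a)%:C.
  have -> : P a = P b * cexp z.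
    by rewrite /P -cexpD /z; congr cexp; rewrite rmorphB /=; ring.
  have -> : P b - P b * cexp z + k * (b - a)%:C * P b = - (P b * (cexp z - 1 - z)) by rewrite /z; ring.
  have cz : cabs z = c * (b - a) by rewrite /z cabsM cabsR ger0_norm // subr_ge0.
  have z2 : cabs z <= 1 / 2.
    rewrite cz; apply: (@le_trans _ _ (c * d)); first by rewrite ler_wpM2l.
    by rewrite /d mulrA ler_pdivrMr ?ltr_wpDl //; lra.
  rewrite cabsN cabsM; apply: (@le_trans _ _ (M * (9 * (c * (b - a)) ^+ 2))).
    apply: ler_pM => //; first by apply: PM; rewrite bL (le_trans a0 ab).
    by rewrite -cz; exact: cexp_approx.
  by rewrite le_eqVlt; apply/orP; left; apply/eqP; ring.
have P2 a b : 0 <= a -> a <= b -> b <= L -> b - a <= d ->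
    cabs (P b - P a) <= 6 * c * M * (b - a).
  move=> a0 ab bL hd; have h1 := P1 a b a0 ab bL hd.
  have h2 : cabs (k * (b - a)%:C * P b) <= c * (b - a) * M.
    rewrite !cabsM cabsR ger0_norm ?subr_ge0 //; apply: ler_pM => //.
      by rewrite mulr_ge0 // subr_ge0.
    by apply: PM; rewrite bL (le_trans a0 ab).
  have := lerB_cabsD (P b - P a) (k * (b - a)%:C * P b).
  have h3 : c * (b - a) <= 1 / 2.
    apply: (@le_trans _ _ (c * d)); first by rewrite ler_wpM2l.
    by rewrite /d mulrA ler_pdivrMr ?ltr_wpDl //; lra.
  have : 9 * c ^+ 2 * M * (b - a) ^+ 2 <= 9 * (1 / 2) * (c * (b - a)) * M.
    have -> : 9 * c ^+ 2 * M * (b - a) ^+ 2 = (c * (b - a)) * (9 * (c * (b - a)) * M) by ring.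
    have -> : 9 * (1 / 2) * (c * (b - a)) * M = (1 / 2) * (9 * (c * (b - a)) * M) by ring.
    by rewrite ler_wpM2r // !mulr_ge0 // subr_ge0.
  have : 0 <= c * (b - a) * M by rewrite !mulr_ge0 // subr_ge0.
  lra.
pose D x := P x * V x - cintegral 0 x (fun t => P t * w t).
have D0 : D 0 = V0.
  rewrite /D cint0 subr0 hV ?lexx ?ltW // cint0 addr0 /P mulr0.
  by rewrite cexp0 mul1r.
suff hD : forall x, 0 <= x <= L -> D x = D 0.
  by move=> x /hD; rewrite D0 => <-; rewrite /D subrK.
pose KK := 12 * c * M + 4 * M * c + 9 * c ^+ 2 * M * A.
have KK0 : 0 <= KK by rewrite !addr_ge0 // !mulr_ge0 // exprn_ge0.
apply: (@chain_const D G KK d KK0 d0) => // a b a0 ab bL hd.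
have ab0 : 0 <= b - a by rewrite subr_ge0.
have b0 := le_trans a0 ab; have aL := le_trans ab bL.
have e1 : cintegral a b W = cintegral a b w + k * cintegral a b (fun t => V t - V a) + k * ((b - a)%:C * V a).
  rewrite /W (cintD iw (cintegZ k iV)) // (cintZ k iV) // -addrA -mulrDr; congr (_ + _ * _).
  rewrite -cint_cst // -(@cintD _ L) //; last 2 first.
  - by apply: cintegB => //; exact: cinteg_cst.
  - exact: cinteg_cst.
  by apply: cint_ext => t _; rewrite subrK.
(* The first-order terms cancel; what remains is the variation of [P] against [w], the variation of
   [V] against [k], and the second-order error of the exponential. *)
have e2 : D b - D a = - cintegral a b (fun t => (P t - P b) * w t)
    + P b * k * cintegral a b (fun t => V t - V a) + (P b - P a + k * (b - a)%:C * P b) * V a.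
  have -> : cintegral a b (fun t => (P t - P b) * w t) = cintegral a b (fun t => P t * w t) - P b * cintegral a b w.
    rewrite -(cintZ (P b) iw) // -[X in _ = _ + X]mulN1r -(@cintZ _ L) //; last exact: cintegZ.
    rewrite -(@cintD _ L) //; last by do 2 apply: cintegZ.
    by apply: cint_ext => t _; ring.
  rewrite -(cintB iPw) // /D.
  have -> : V b = V a + cintegral a b W by rewrite -VB // addrC subrK.
  rewrite e1; ring.
rewrite e2.
have GBa := hlen a b a0 ab bL.
have b1 : cabs (cintegral a b (fun t => (P t - P b) * w t)) <= 12 * c * M * (b - a) * (G b - G a).
  pose kk := 6 * c * M * (b - a).
  have kk0 : 0 <= kk by rewrite !mulr_ge0.
  apply: le_trans (@cint_le _ L _ (fun t => kk * n1 (w t)) a b _ _ a0 bL _) _.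
  - have -> : (fun t => (P t - P b) * w t) = (fun t => P t * w t - P b * w t) by apply/funext => t; ring.
    by apply: cintegB => //; exact: cintegZ.
  - by apply: integZ; exact: integ_n1.
  - move=> t /andP[ta tb]; rewrite cabsM; apply: ler_pM => //; last exact: cabs_n1.
    rewrite cabsB; apply: le_trans (P2 t b _ tb bL _) _; [lra|lra|].
    by rewrite ler_wpM2l ?mulr_ge0 //; lra.
  rewrite (RintZ kk (integ_n1 iw)) // mulrA.
  have -> : 12 * c * M * (b - a) = 2 * kk by rewrite /kk; ring.
  apply: ler_wpM2l; first by rewrite mulr_ge0.
  apply: Kge => //; first exact: integ_n1.
  by move=> t; rewrite /K; have := n1_ge0 (W t); lra.
have b2 : cabs (P b * k * cintegral a b (fun t => V t - V a)) <= 4 * M * c * (b - a) * (G b - G a).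
  rewrite !cabsM.
  have -> : 4 * M * c * (b - a) * (G b - G a) = M * c * (2 * (2 * (G b - G a) * (b - a))) by ring.
  apply: ler_pM => //; first by rewrite mulr_ge0.
    by apply: ler_wpM2r => //; apply: PM; rewrite b0.
  rewrite -Rint_cst //; apply: (@cint_le _ L) => //.
  - by apply: cintegB => //; exact: cinteg_cst.
  - exact: integ_cst.
  - move=> t /andP[ta tb]; apply: le_trans (VB_le a t a0 ta (le_trans tb bL)) _.
    by rewrite ler_pM2l // lerD2r hG //; lra.
have b3 : cabs ((P b - P a + k * (b - a)%:C * P b) * V a) <= 9 * c ^+ 2 * M * A * (b - a) * (G b - G a).
  rewrite cabsM; apply: (@le_trans _ _ (9 * c ^+ 2 * M * (b - a) ^+ 2 * A)).
    by apply: ler_pM => //; [exact: P1|apply: VA; rewrite a0].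
  have -> : 9 * c ^+ 2 * M * (b - a) ^+ 2 * A = 9 * c ^+ 2 * M * A * (b - a) * (b - a) by ring.
  by apply: ler_wpM2l => //; rewrite !mulr_ge0 // exprn_ge0.
have -> : KK * (b - a) * (G b - G a) = 12 * c * M * (b - a) * (G b - G a)
    + 4 * M * c * (b - a) * (G b - G a) + 9 * c ^+ 2 * M * A * (b - a) * (G b - G a).
  by rewrite /KK; ring.
apply: le_trans (ler_cabsD _ _) _; apply: lerD b3.
by apply: le_trans (ler_cabsD _ _) _; apply: lerD b2; rewrite cabsN.
Qed.

End ODE.

(** * The solution as a function of the spectral parameter *)

Section Solutions.
Variable R : realType.
Local Notation C := R[i].
Local Notation mu := (@lebesgue_measure R).
Variable L : R.
Hypothesis L0 : 0 < L.
Variable q : R -> C.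
Hypothesis iq : cinteg L q.
Local Notation integ f := (mu.-integrable `[0, L]%classic (EFin \o f)).
Local Notation I f a b := (\int[mu]_(t in `[a, b]) f t).
Local Notation cinteg := (cinteg L).
Local Notation ccts := (ccts L).
Let im : C := 0 +i* 1.

Let Q := I (fun t => n1 (q t)) 0 L.

Lemma normq_itv_ge0 a : 0 <= a -> a <= L -> 0 <= I (fun t => n1 (q t)) a L.
Proof.
move=> a0 aL; have e : I (fun=> 0) a L = 0 by rewrite Rint_cst // mul0r.
rewrite -{}[leLHS]e; apply: (@Rint_le _ L) => //; first exact: integ_cst.
  exact: integ_n1.
by move=> t _; exact: n1_ge0.
Qed.

Lemma normq_ge0 : 0 <= Q.
Proof. by apply: normq_itv_ge0 => //; exact: ltW. Qed.

Lemma normq_mono x : 0 <= x <= L -> I (fun t => n1 (q t)) 0 x <= Q.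
Proof.
move=> /andP[x0 xL]; rewrite /Q -subr_ge0 (RintB (integ_n1 iq)) //.
exact: normq_itv_ge0.
Qed.

(** Continuity of [y] and [dy], which holds because both are integrals, is what makes products such
    as [q * y] integrable. *)
Record solution (rho : C) (y dy : R -> C) : Prop := Solution {
  sol_y : ccts y; sol_dy : ccts dy;
  sol_int : forall x, 0 <= x <= L -> y x = cintegral 0 x dy;
  sol_eq : forall x, 0 <= x <= L ->
    dy x = 1 + cintegral 0 x (fun t => (q t - rho ^+ 2) * y t) }.

Lemma is_S_solutionP rho y : is_S_solution L q rho y -> exists dy, solution rho y dy.
Proof.
move=> [dy [h1 [h2 [h3 [h4 h]]]]]; exists dy.
have idy : cinteg dy by [].
have iw : cinteg (fun t => (q t - rho ^+ 2) * y t) by [].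
split.
- by apply: ccts_ext (ccts_int L0 idy) => x /h[].
- by apply: ccts_ext (cctsD (ccts_cst L 1) (ccts_int L0 iw)) => x /h[].
- by move=> x /h[].
- by move=> x /h[].
Qed.

Lemma solution_bounded rho y dy : solution rho y dy ->
  exists2 A, 0 <= A & forall x, 0 <= x <= L -> cabs (y x) <= A /\ cabs (dy x) <= A.
Proof.
move=> [[y1 y2] [d1 d2] _ _].
have [A1 A10 h1] := continuous_itv_bounded y1; have [A2 A20 h2] := continuous_itv_bounded y2.
have [A3 A30 h3] := continuous_itv_bounded d1; have [A4 A40 h4] := continuous_itv_bounded d2.
exists (A1 + A2 + A3 + A4); first by rewrite !addr_ge0.
move=> x hx; split; apply: le_trans (cabs_le_reim _) _.
  by have := h1 x hx; have := h2 x hx; lra.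
by have := h3 x hx; have := h4 x hx; lra.
Qed.

Lemma cintegqM y : ccts y -> cinteg (fun t => q t * y t).
Proof.
by move=> hy; apply: cinteg_ext (cintegM_cts hy iq) => t _; rewrite mulrC.
Qed.

(* For [k ^+ 2 = - rho ^+ 2] the combination [dy + k y] solves a first-order equation. *)
Lemma solution_half rho y dy (k : C) : k ^+ 2 = - rho ^+ 2 -> solution rho y dy ->
  forall x, 0 <= x <= L ->
  cexp (- k * x%:C) * (dy x + k * y x) = 1 + cintegral 0 x (fun t => cexp (- k * t%:C) * (q t * y t)).
Proof.
move=> hk [cy cdy hy hdy] x hx.
apply: (@integrating_factor R L L0 (fun t => dy t + k * y t) (fun t => q t * y t) 1 k) => //.
- exact: cintegqM.
- by apply: ccts_integ; apply: cctsD => //; apply: cctsM => //; exact: ccts_cst.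
move=> {hx}{}x /andP[x0 xL].
have idy := ccts_integ cdy; have iy := ccts_integ cy.
rewrite hy ?x0 // hdy ?x0 //.
have -> : cintegral 0 x (fun t => (q t - rho ^+ 2) * y t) =
    cintegral 0 x (fun t => q t * y t) + k ^+ 2 * cintegral 0 x y.
  rewrite -(cintZ _ iy) // -(@cintD _ L) //; [|exact: cintegqM|exact: cintegZ].
  by apply: cint_ext => t _; rewrite hk; ring.
have -> : cintegral 0 x (fun t => q t * y t + k * (dy t + k * y t)) =
    cintegral 0 x (fun t => q t * y t) + (k * cintegral 0 x dy + k ^+ 2 * cintegral 0 x y).
  rewrite -(cintZ _ iy) // -(cintZ _ idy) // -!(@cintD _ L) //; try exact: cintegqM; try exact: cintegZ.
    by apply: cint_ext => t _; ring.
  by apply: cintegD; exact: cintegZ.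
by ring.
Qed.

(** The formulas of [solution_half] for [im * rho] and [- (im * rho)] are multiplied by the inverse
    exponentials and subtracted, so that [dy] cancels. Keeping [rho] as a factor of [y] avoids a
    division at [rho = 0]. *)
Lemma solution_repr rho y dy : solution rho y dy -> forall x, 0 <= x <= L ->
  2 * im * (rho * y x - csin (rho * x%:C)) =
   cexp (im * rho * x%:C) * cintegral 0 x (fun t => cexp (- (im * rho) * t%:C) * (q t * y t))
   - cexp (- (im * rho) * x%:C) * cintegral 0 x (fun t => cexp (- (- (im * rho)) * t%:C) * (q t * y t)).
Proof.
move=> hs x hx.
have i2 : im ^+ 2 = -1 by exact: sqrI.
have h1 := @solution_half rho y dy (im * rho) (ltac:(by rewrite exprMn i2 mulN1r)) hs x hx.
have h2 := @solution_half rho y dy (- (im * rho)) (ltac:(by rewrite sqrrN exprMn i2 mulN1r)) hs x hx.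
have -> : cintegral 0 x (fun t => cexp (- (im * rho) * t%:C) * (q t * y t)) =
  cexp (- (im * rho) * x%:C) * (dy x + im * rho * y x) - 1 by rewrite h1 [1 + _]addrC addrK.
have -> : cintegral 0 x (fun t => cexp (- - (im * rho) * t%:C) * (q t * y t)) =
  cexp (- - (im * rho) * x%:C) * (dy x + - (im * rho) * y x) - 1 by rewrite h2 [1 + _]addrC addrK.
rewrite csinE -/im.
have i0 : im != 0 by exact: I_neq0.
have e1 : cexp (im * rho * x%:C) * cexp (- (im * rho) * x%:C) = 1 by rewrite mulNr cexpN.
have -> : im * (rho * x%:C) = im * rho * x%:C by rewrite mulrA.
rewrite opprK -[- (im * rho * x%:C)]mulNr.
set a := cexp (im * rho * x%:C) in e1 *; set b := cexp (- (im * rho) * x%:C) in e1 *.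
have -> : a * (b * (dy x + im * rho * y x) - 1) - b * (a * (dy x + - (im * rho) * y x) - 1)
  = (a * b) * (2 * (im * rho * y x)) - a + b by ring.
rewrite e1; field; exact: i0.
Qed.

(** The kernel contributes [expR (t0 * (x - t))] and the assumed bound [expR (t0 * t)]; their
    product no longer depends on [t], so only the integral [Q] remains. Each of the two integrals
    costs the factor 2 of [cint_le], and the 2 on the left takes one away. *)
Lemma solution_step rho y dy (A : R) : solution rho y dy -> 0 <= A ->
  (forall x, 0 <= x <= L -> cabs (y x) <= A * expR (`|cim rho| * x)) ->
  forall x, 0 <= x <= L ->
    cabs (rho * y x - csin (rho * x%:C)) <= 2 * A * Q * expR (`|cim rho| * x).
Proof.
move=> hs A0 hA x /andP[x0 xL]; set t0 := `|cim rho| in hA *.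
have key (k : C) : (cre k = cim rho \/ cre k = - cim rho) ->
    cabs (cexp (- k * x%:C) * cintegral 0 x (fun t => cexp (k * t%:C) * (q t * y t))) <=
    2 * (A * Q * expR (t0 * x)).
  move=> hk; have iqy := cintegqM (sol_y hs).
  have iu : cinteg (fun t => cexp (k * t%:C) * (q t * y t)) by apply: cintegM_cts => //; exact: ccts_cexp.
  rewrite -(cintZ _ iu) //.
  apply: le_trans (@cint_le _ L _ (fun t => A * expR (t0 * x) * n1 (q t)) 0 x _ _ (lexx _) xL _) _.
  - exact: cintegZ.
  - by apply: integZ; exact: integ_n1.
  - move=> t /andP[t_0 tx]; rewrite mulrA -cexpD !cabsM cabs_cexp.
    have h1 := hA t (ltac:(by rewrite t_0 (le_trans tx xL))).
    have h2 : expR (cre (- k * x%:C + k * t%:C)) <= expR (t0 * (x - t)).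
      rewrite ler_expR.
      have -> : - k * x%:C + k * t%:C = - (k * (x - t)%:C) by rewrite rmorphB /=; ring.
      rewrite creN creM creR cimR mulr0 subr0 -mulNr ler_wpM2r ?subr_ge0 //.
      by case: hk => ->; rewrite /t0 ?opprK ?ler_norm // -normrN ler_norm.
    apply: (@le_trans _ _ (expR (t0 * (x - t)) * (n1 (q t) * (A * expR (t0 * t))))).
      apply: ler_pM; [exact: expR_ge0|by rewrite mulr_ge0|exact: h2|].
      by apply: ler_pM => //; exact: cabs_n1.
    rewrite le_eqVlt; apply/orP; left; apply/eqP.
    have -> : t0 * x = t0 * (x - t) + t0 * t by ring.
    by rewrite expRD; ring.
  rewrite ler_pM2l // (RintZ _ (integ_n1 iq)) //.
  have -> : A * Q * expR (t0 * x) = A * expR (t0 * x) * Q by ring.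
  apply: ler_wpM2l; first by rewrite mulr_ge0 // expR_ge0.
  by apply: normq_mono; rewrite x0.
have := solution_repr hs (ltac:(by rewrite x0) : 0 <= x <= L) => e.
have cim1' : cabs im = 1 by rewrite /im /cabs /cre /cim /= expr0n add0r expr1n sqrtr1.
have e2 : cabs (2 * im * (rho * y x - csin (rho * x%:C))) = 2 * cabs (rho * y x - csin (rho * x%:C)).
  by rewrite !cabsM cabs_nat cim1' mulr1.
have ci : cre (im * rho) = - cim rho by rewrite creM /im /cre /cim /=; ring.
have k1 := key (- (im * rho)) (ltac:(by rewrite creN ci opprK; left)).
have k2 := key (im * rho) (ltac:(by rewrite ci; right)).
rewrite opprK in k1; rewrite opprK in e.
have := ler_cabsB (cexp (im * rho * x%:C) * cintegral 0 x (fun t => cexp (- (im * rho) * t%:C) * (q t * y t)))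
  (cexp (- (im * rho) * x%:C) * cintegral 0 x (fun t => cexp (im * rho * t%:C) * (q t * y t))).
rewrite -e e2; move: k1 k2.
set X := A * Q * expR _; have -> : 2 * A * Q * expR (t0 * x) = 2 * X by rewrite /X; ring.
lra.
Qed.

Lemma solution_large rho y dy : solution rho y dy -> 0 < cabs rho -> 4 * Q <= cabs rho ->
  cabs (rho * y L - csin (rho * L%:C)) <= 4 * Q / cabs rho * expR (`|cim rho| * L).
Proof.
move=> hs r0 rQ; have [A0 A00 hA0] := solution_bounded hs.
have Q0 := normq_ge0.
(* For [|rho| >= 4 Q] one application of [solution_step] improves a bound [A] to
   [A / 2 + 1 / |rho|]; [B] is the fixed point of this map. *)
pose B : R := 2 / cabs rho.
have B0 : 0 <= B by rewrite divr_ge0.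
have LL : 0 <= L <= L by rewrite lexx ltW.
have hk k : forall x, 0 <= x <= L -> cabs (y x) <= (A0 / 2 ^+ k + B) * expR (`|cim rho| * x).
  elim: k => [|k IH] x hx.
    have [h _] := hA0 x hx; apply: le_trans h _; rewrite divr1.
    rewrite -[leLHS]mulr1; apply: ler_pM => //; first by rewrite lerDl.
    by rewrite -expR0 ler_expR mulr_ge0 //; case/andP: hx.
  set A := A0 / 2 ^+ k + B in IH.
  have A_0 : 0 <= A by rewrite addr_ge0 // divr_ge0 // exprn_ge0.
  have h := solution_step hs A_0 IH hx.
  have hs' : cabs (csin (rho * x%:C)) <= expR (`|cim rho| * x).
    apply: le_trans (cabs_csin_le _) _; rewrite cimM creR cimR mulr0 add0r normrM.
    by rewrite (@ger0_norm _ x) //; case/andP: hx.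
  have h2 : cabs rho * cabs (y x) <= (1 + 2 * A * Q) * expR (`|cim rho| * x).
    by rewrite -cabsM; have := lerB_cabs (rho * y x) (csin (rho * x%:C)); lra.
  rewrite -(ler_pM2l r0); apply: le_trans h2 _.
  rewrite mulrA; apply: ler_wpM2r; first exact: expR_ge0.
  have -> : cabs rho * (A0 / 2 ^+ k.+1 + B) = cabs rho * A / 2 + 1.
    by rewrite /A /B exprS; field; rewrite gt_eqF //= expf_neq0.
  have : A * (4 * Q) <= A * cabs rho by rewrite ler_wpM2l.
  lra.
have hy x : 0 <= x <= L -> cabs (y x) <= B * expR (`|cim rho| * x).
  move=> hx; apply: (@le_halving _ _ A0) => // k; exact: hk.
apply: le_trans (solution_step hs B0 hy LL) _.
by rewrite le_eqVlt; apply/orP; left; apply/eqP; rewrite /B; ring.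
Qed.

(** * Picard iteration in exponentially weighted norms *)

Lemma Rint_expR_le (m B x : R) : 0 < m -> 0 <= B -> 0 <= x <= L ->
  I (fun t => B * expR (m * t)) 0 x <= B / m * expR (m * x).
Proof.
move=> m0 B0 /andP[x0 xL].
move: x0; rewrite le_eqVlt => /orP[/eqP<-|x0].
  by rewrite Rint0 mulr_ge0 ?expR_ge0 // divr_ge0 // ltW.
have cexpm : continuous (fun t : R => expR (m * t)).
  move=> t; apply: (@continuous_comp _ _ _ (fun t : R => m * t) expR); last exact: continuous_expR.
  by apply: cvgM; [exact: cvg_cst|exact: cvg_id].
have cF : continuous (fun t : R => B / m * expR (m * t)).
  by move=> t; apply: cvgM; [exact: cvg_cst|exact: cexpm].
have dF (t : R) : is_derive t 1 (fun t : R => B / m * expR (m * t)) (B * expR (m * t)).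
  apply: is_derive_eq; rewrite /GRing.scale /= !mulr1; field; exact: lt0r_neq0.
rewrite /Rintegral (@continuous_FTC2 _ _ (fun t => B / m * expR (m * t))) //.
- by rewrite -EFinB /= lerBlDr lerDl mulr_ge0 ?expR_ge0 // divr_ge0 // ltW.
- by apply: continuous_subspaceT => t; apply: cvgM; [exact: cvg_cst|exact: cexpm].
- split.
  + by move=> t _; exact: ex_derive.
  + by apply: cvg_at_right_filter; exact: cF.
  + by apply: cvg_at_left_filter; exact: cF.
- by move=> t _; rewrite derive1E derive_val.
Qed.

(** Polynomials in [l] whose coefficients are continuous in [x]. The inductive form lets closure
    under integration be proved without handling coefficients; [polyfam_ext] is there because only
    values on [[0, L]] are controlled. *)
Inductive polyfam : (C -> R -> C) -> Prop :=
| polyfam_cst c : ccts c -> polyfam (fun _ x => c x)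
| polyfamZ F : polyfam F -> polyfam (fun l x => l * F l x)
| polyfamD F G : polyfam F -> polyfam G -> polyfam (fun l x => F l x + G l x)
| polyfam_ext F G : (forall l x, 0 <= x <= L -> F l x = G l x) -> polyfam F -> polyfam G.

Lemma polyfam_ccts F l : polyfam F -> ccts (F l).
Proof.
elim=> {F} [c //|F _ h|F G _ h1 _ h2|F G e _ h].
- by apply: cctsM => //; exact: ccts_cst.
- exact: cctsD.
- by apply: ccts_ext h => x; exact: e.
Qed.

Lemma polyfam_entire F x : 0 <= x <= L -> polyfam F -> entire (fun l => F l x).
Proof.
move=> hx; elim=> {F} [c _|F _ h|F G _ h1 _ h2|F G e _ h].
- exact: entire_cst.
- by apply: entireM => //; exact: entire_id.
- exact: entireD.
- by apply: entire_ext h => l; exact: e.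
Qed.

Lemma polyfam_int F w : polyfam F -> cinteg w ->
  polyfam (fun l x => cintegral 0 x (fun t => w t * F l t)).
Proof.
move=> hF iw; elim: hF => {F} [c hc|F hF h|F G hF h1 hG h2|F G e hF h].
- apply: polyfam_cst; apply: ccts_int => //.
  by apply: cinteg_ext (cintegM_cts hc iw) => t _; rewrite mulrC.
- apply: polyfam_ext (polyfamZ h) => l x /andP[x0 xL].
  rewrite -(@cintZ _ L) //; last first.
    by apply: cinteg_ext (cintegM_cts (polyfam_ccts l hF) iw) => t _; rewrite mulrC.
  by apply: cint_ext => t _; ring.
- apply: polyfam_ext (polyfamD h1 h2) => l x /andP[x0 xL].
  rewrite -(@cintD _ L) //; last 2 first.
  + by apply: cinteg_ext (cintegM_cts (polyfam_ccts l hF) iw) => t _; rewrite mulrC.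
  + by apply: cinteg_ext (cintegM_cts (polyfam_ccts l hG) iw) => t _; rewrite mulrC.
  by apply: cint_ext => t _; ring.
- apply: polyfam_ext h => l x /andP[x0 xL].
  by apply: cint_ext => t /andP[t0 tx]; rewrite e // t0 (le_trans tx).
Qed.

(** Iterates of the pair formed by the solution and its derivative. The parameter [l] stands for
    [rho ^ 2], which is the source of the evenness of [S]. *)
Fixpoint picard k : (C -> R -> C) * (C -> R -> C) :=
  if k is k'.+1 then
    (fun l x => cintegral 0 x ((picard k').2 l),
     fun l x => 1 + cintegral 0 x (fun t => (q t - l) * (picard k').1 l t))
  else (fun _ _ => 0, fun _ _ => 0).

Lemma polyfam_picard k : polyfam (picard k).1 /\ polyfam (picard k).2.
Proof.
elim: k => [|k [h1 h2]] /=; first by split; apply: polyfam_cst; exact: ccts_cst.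
split.
  have := polyfam_int h2 (cinteg_cst L 1).
  by apply: polyfam_ext => l x _; apply: cint_ext => t _; rewrite mul1r.
have p1 := polyfam_cst (ccts_cst L 1).
have p2 := polyfam_int h1 iq.
have p3 := polyfamZ (polyfam_int h1 (cinteg_cst L (-1))).
apply: polyfam_ext (polyfamD p1 (polyfamD p2 p3)) => l x /andP[x0 xL]; congr (_ + _).
have i1 := cintegqM (polyfam_ccts l h1).
have i2 := cintegZ (-1) (ccts_integ (polyfam_ccts l h1)).
rewrite -(cintZ _ i2) // -(@cintD _ L) //; last exact: cintegZ.
by apply: cint_ext => t _; ring.
Qed.

(* Both the solution and its Picard iterates are compared in the weighted norm
   sup exp(-m x)|.|, in which one Picard step halves the distance. *)
Lemma picard_step (l : C) (D m A : R) (u v : R -> C) : cabs l <= D -> 0 < m ->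
  16 * (Q + D * L) <= m -> 0 <= A -> ccts u -> ccts v ->
  (forall x, 0 <= x <= L -> cabs (u x) <= A * expR (m * x)) ->
  (forall x, 0 <= x <= L -> cabs (v x) <= m / 4 * A * expR (m * x)) ->
  (forall x, 0 <= x <= L -> cabs (cintegral 0 x v) <= A / 2 * expR (m * x)) /\
  (forall x, 0 <= x <= L -> cabs (cintegral 0 x (fun t => (q t - l) * u t)) <= m / 4 * (A / 2) * expR (m * x)).
Proof.
move=> lD m0 mQ A0 cu cv hu hv.
have mA : 0 <= m / 4 * A by rewrite !mulr_ge0 // ltW.
have icexp (c : R) : integ (fun t => c * expR (m * t)).
  apply: integZ; apply: integ_cont; apply: continuous_subspaceT => t.
  apply: (@continuous_comp _ _ _ (fun t : R => m * t) expR); last exact: continuous_expR.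
  by apply: cvgM; [exact: cvg_cst|exact: cvg_id].
split=> x /andP[x0 xL].
  apply: le_trans (@cint_le _ L v (fun t => m / 4 * A * expR (m * t)) 0 x _ _ (lexx _) xL _) _.
  - exact: ccts_integ.
  - exact: icexp.
  - by move=> t /andP[t0 tx]; apply: hv; rewrite t0 (le_trans tx).
  (* The derivative carries the weight [m / 4] so that this step contracts by
     [2 * (m / 4) / m = 1 / 2]; the 16 in the condition on [m] makes the other component contract
     equally. *)
  apply: le_trans (_ : 2 * (m / 4 * A / m * expR (m * x)) <= _).
    by rewrite ler_pM2l //; apply: Rint_expR_le => //; rewrite x0.
  rewrite le_eqVlt; apply/orP; left; apply/eqP; field; exact: lt0r_neq0.
have D0 : 0 <= D by apply: le_trans lD.
have ik : integ (fun t => n1 (q t) + D).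
  by apply: integD; [exact: integ_n1|exact: integ_cst].
apply: le_trans (@cint_le _ L _ (fun t => A * expR (m * x) * (n1 (q t) + D)) 0 x _ _ (lexx _) xL _) _.
- have h : cinteg (fun t => q t - l) by apply: cintegB => //; exact: cinteg_cst.
  by apply: cinteg_ext (cintegM_cts cu h) => t _; rewrite mulrC.
- exact: integZ.
- move=> t /andP[t0 tx]; rewrite cabsM mulrC; apply: ler_pM => //.
    apply: le_trans (hu t _) _; first by rewrite t0 (le_trans tx).
    by rewrite ler_wpM2l // ler_expR ler_wpM2l // ltW.
  by apply: le_trans (ler_cabsB _ _) _; apply: lerD => //; exact: cabs_n1.
rewrite (RintZ _ ik) // (RintD (integ_n1 iq) (integ_cst L D)) // Rint_cst // subr0.
have h1 : I (fun t => n1 (q t)) 0 x + D * x <= Q + D * L.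
  by apply: lerD; [apply: normq_mono; rewrite x0|rewrite ler_wpM2l].
have Ae : 0 <= A * expR (m * x) by rewrite mulr_ge0 // expR_ge0.
have h2 : A * expR (m * x) * (I (fun t => n1 (q t)) 0 x + D * x) <= A * expR (m * x) * (m / 16).
  by apply: ler_wpM2l => //; lra.
have -> : m / 4 * (A / 2) * expR (m * x) = 2 * (A * expR (m * x) * (m / 16)) by field.
by rewrite ler_pM2l.
Qed.

(** The bound has to be uniform in [rho], but the a priori bound [A'] depends on the solution. The
    halving argument is therefore run twice: on [y] and [dy] themselves to replace [A'] by a bound
    in [m] alone, then on the distance to the iterates. *)
Lemma picard_cvg (rho : C) (D m : R) y dy k : solution rho y dy ->
  cabs (rho ^+ 2) <= D -> 0 < m -> 16 * (Q + D * L) <= m ->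
  forall x, 0 <= x <= L -> cabs (y x - (picard k).1 (rho ^+ 2) x) <= 8 / m / 2 ^+ k * expR (m * x).
Proof.
move=> hs lD m0 mQ.
have e1 (x : R) : 0 <= x -> 1 <= expR (m * x).
  by move=> x0; rewrite -expR0 ler_expR mulr_ge0 // ltW.
have B0 : 0 <= 8 / m by rewrite divr_ge0 // ltW.
have [A' A'0 hA'] := solution_bounded hs.
pose A := A' + A' / (m / 4).
have m4 : 0 < m / 4 by rewrite divr_gt0.
have A0 : 0 <= A by rewrite addr_ge0 // divr_ge0 // ltW.
have mA : A' <= m / 4 * A.
  by rewrite /A mulrDr [m / 4 * (A' / _)]mulrC divfK ?gt_eqF // lerDr mulr_ge0 // ltW.
(* [8 / m] is the fixed point of [A -> A / 2 + 4 / m], where [4 / m] is the initial slope 1 measured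
   in the weight [m / 4]. *)
have hbase j : (forall x, 0 <= x <= L -> cabs (y x) <= (A / 2 ^+ j + 8 / m) * expR (m * x)) /\
    (forall x, 0 <= x <= L -> cabs (dy x) <= m / 4 * (A / 2 ^+ j + 8 / m) * expR (m * x)).
  elim: j => [|j [IH1 IH2]].
    split=> x hx; have [h1 h2] := hA' x hx; rewrite divr1; case/andP: hx => x0 _.
      apply: le_trans h1 _; rewrite -[leLHS]mulr1; apply: ler_pM => //; last exact: e1.
      by rewrite /A -addrA lerDl addr_ge0 // divr_ge0 // ltW.
    apply: le_trans h2 _; rewrite -[leLHS]mulr1; apply: ler_pM => //; last exact: e1.
    by apply: le_trans mA _; rewrite ler_pM2l // lerDl.
  have Aj0 : 0 <= A / 2 ^+ j + 8 / m by rewrite addr_ge0 // divr_ge0 // exprn_ge0.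
  have [s1 s2] := picard_step lD m0 mQ Aj0 (sol_y hs) (sol_dy hs) IH1 IH2.
  have Aj : A / 2 ^+ j.+1 + 8 / m = (A / 2 ^+ j + 8 / m) / 2 + 4 / m.
    by rewrite exprS; field; rewrite (lt0r_neq0 m0) expf_neq0.
  have em x : 0 <= expR (m * x) by exact: expR_ge0.
  have m40 : 0 <= 4 / m by rewrite divr_ge0 // ltW.
  split=> x hx; have x0 : 0 <= x by case/andP: hx.
    rewrite (sol_int hs) // Aj; apply: le_trans (s1 x hx) _.
    by rewrite ler_wpM2r // lerDl.
  rewrite (sol_eq hs) // Aj; apply: le_trans (ler_cabsD _ _) _; rewrite cabs1.
  have h := s2 x hx; have h1 := e1 x x0.
  have -> : m / 4 * ((A / 2 ^+ j + 8 / m) / 2 + 4 / m) * expR (m * x) =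
     expR (m * x) + m / 4 * ((A / 2 ^+ j + 8 / m) / 2) * expR (m * x).
    by field; rewrite expf_neq0 // (lt0r_neq0 m0).
  exact: lerD.
have hk j : (forall x, 0 <= x <= L -> cabs (y x - (picard j).1 (rho ^+ 2) x) <= 8 / m / 2 ^+ j * expR (m * x)) /\
    (forall x, 0 <= x <= L -> cabs (dy x - (picard j).2 (rho ^+ 2) x) <= m / 4 * (8 / m / 2 ^+ j) * expR (m * x)).
  elim: j => [|j [IH1 IH2]].
    rewrite divr1; split=> x hx /=; rewrite subr0.
      apply: (@le_halving _ _ A) => //.
      by move=> j; exact: (hbase j).1.
    have -> : m / 4 * (8 / m) * expR (m * x) = 8 / m * (m / 4 * expR (m * x)) by ring.
    have c0 : 0 <= m / 4 * expR (m * x) by rewrite mulr_ge0 ?expR_ge0 // ltW.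
    apply: (le_halving A0 c0) => j; apply: le_trans ((hbase j).2 x hx) _.
    by rewrite le_eqVlt; apply/orP; left; apply/eqP; ring.
  have Aj0 : 0 <= 8 / m / 2 ^+ j by rewrite divr_ge0 // exprn_ge0.
  have [p1 p2] := polyfam_picard j.
  have c1 : ccts (fun x => y x - (picard j).1 (rho ^+ 2) x).
    have := cctsD (sol_y hs) (cctsM (ccts_cst L (-1)) (polyfam_ccts (rho ^+ 2) p1)).
    by apply: ccts_ext => x _; rewrite mulN1r.
  have c2 : ccts (fun x => dy x - (picard j).2 (rho ^+ 2) x).
    have := cctsD (sol_dy hs) (cctsM (ccts_cst L (-1)) (polyfam_ccts (rho ^+ 2) p2)).
    by apply: ccts_ext => x _; rewrite mulN1r.
  have [s1 s2] := picard_step lD m0 mQ Aj0 c1 c2 IH1 IH2.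
  have -> : 8 / m / 2 ^+ j.+1 = 8 / m / 2 ^+ j / 2.
    by rewrite exprS; field; rewrite (lt0r_neq0 m0) expf_neq0.
  have iy := ccts_integ (sol_y hs); have idy := ccts_integ (sol_dy hs).
  have ip1 := ccts_integ (polyfam_ccts (rho ^+ 2) p1); have ip2 := ccts_integ (polyfam_ccts (rho ^+ 2) p2).
  split=> x hx; have /andP[x0 xL] := hx.
    apply: le_trans (s1 x hx); rewrite /= (sol_int hs) //.
    rewrite -[X in _ <= cabs X]/(cintegral 0 x (fun t => dy t - _ t)).
    rewrite -[- cintegral _ _ _]mulN1r -(cintZ _ ip2) // -(cintD idy) //; last exact: cintegZ.
    by rewrite (@cint_ext _ _ (fun t => dy t - (picard j).2 (rho ^+ 2) t)) // => t _; rewrite mulN1r.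
  apply: le_trans (s2 x hx); rewrite /= (sol_eq hs) // opprD addrACA subrr add0r.
  have iql : cinteg (fun t => q t - rho ^+ 2) by apply: cintegB => //; exact: cinteg_cst.
  have i1 : cinteg (fun t => (q t - rho ^+ 2) * y t).
    by apply: cinteg_ext (cintegM_cts (sol_y hs) iql) => t _; rewrite mulrC.
  have i2 : cinteg (fun t => (q t - rho ^+ 2) * (picard j).1 (rho ^+ 2) t).
    by apply: cinteg_ext (cintegM_cts (polyfam_ccts (rho ^+ 2) p1) iql) => t _; rewrite mulrC.
  rewrite -[- cintegral _ _ _]mulN1r -(cintZ _ i2) // -(cintD i1) //; last exact: cintegZ.
  by rewrite (@cint_ext _ _ (fun t => (q t - rho ^+ 2) * (y t - (picard j).1 (rho ^+ 2) t))) // => t _; ring.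
by move=> x hx; exact: (hk k).1.
Qed.

(** * Entirety, evenness and asymptotics in the spectral parameter *)

Variable S : C -> R -> C.
Hypothesis hS : forall rho, is_S_solution L q rho (S rho).

(** An admissible [m] for [picard_step]; the summand 1 keeps it positive. *)
Let weight (D : R) := 16 * (Q + D * L) + 1.

Lemma S_picard rho D k : cabs (rho ^+ 2) <= D ->
  cabs (S rho L - (picard k).1 (rho ^+ 2) L) <= 8 / weight D * expR (weight D * L) / k.+1%:R.
Proof.
move=> hD; have D0 : 0 <= D by apply: le_trans hD.
have w0 : 0 < weight D by rewrite ltr_wpDl // mulr_ge0 // addr_ge0 ?normq_ge0 // mulr_ge0 // ltW.
have [dy hs] := is_S_solutionP (hS rho).
have hw : 16 * (Q + D * L) <= weight D by rewrite /weight lerDl.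
have LL : 0 <= L <= L by rewrite lexx ltW.
apply: le_trans (picard_cvg k hs hD w0 hw LL) _.
rewrite mulrAC ler_wpM2l ?mulr_ge0 ?expR_ge0 ?invr_ge0 ?(ltW w0) //.
rewrite lef_pV2 ?posrE ?ltr0n ?exprn_gt0 // -natrX ler_nat; exact: ltn_expl.
Qed.

(** Both values are approximated by the same iterate, taken at [rho ^ 2]. *)
Lemma S_even rho : S (- rho) L = S rho L.
Proof.
apply/eqP; rewrite -subr_eq0 -cabs_eq0 eq_le cabs_ge0 andbT.
pose D := cabs (rho ^+ 2); pose K := 8 / weight D * expR (weight D * L).
apply: (@le_archi _ _ _ (K + K)) => k; rewrite add0r mulrDl.
have h1 := @S_picard rho D k (lexx _).
have h2 := @S_picard (- rho) D k; rewrite sqrrN in h2; have {}h2 := h2 (lexx _).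
have -> : S (- rho) L - S rho L = (S (- rho) L - (picard k).1 (rho ^+ 2) L) - (S rho L - (picard k).1 (rho ^+ 2) L) by ring.
by apply: le_trans (ler_cabsB _ _) _; exact: lerD.
Qed.

Lemma entire_S : entire (fun rho => S rho L).
Proof.
apply: entire_lim => r e e0.
pose D := r ^+ 2; pose K := 8 / weight D * expR (weight D * L).
pose k := Num.bound (K / e).
have LL : 0 <= L <= L by rewrite lexx ltW.
have [r0|r0] := ltP r 0.
  exists (fun=> 0); first exact: entire_cst.
  by move=> z hz; have := le_lt_trans (le_trans (cabs_ge0 z) hz) r0; rewrite ltxx.
have D0 : 0 <= D by exact: sqr_ge0.
have w0 : 0 < weight D by rewrite ltr_wpDl // mulr_ge0 // addr_ge0 ?normq_ge0 // mulr_ge0 // ltW.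
have K0 : 0 <= K by rewrite mulr_ge0 ?expR_ge0 // divr_ge0 // ltW.
have hk : K / e < k.+1%:R.
  apply: (@lt_trans _ _ k%:R); last by rewrite ltr_nat.
  by apply: archi_boundP; rewrite divr_ge0 // ltW.
exists (fun rho => (picard k).1 (rho ^+ 2) L).
  by apply: (@entire_sqr _ (fun l => (picard k).1 l L)); apply: polyfam_entire => //; exact: (polyfam_picard k).1.
move=> z hz; apply: le_trans (@S_picard z D k _) _.
  by rewrite cabsX lerXn2r ?nnegrE.
by rewrite ler_pdivrMr ?ltr0n // -/K [leRHS]mulrC -ler_pdivrMr // ltW.
Qed.

(** Stated without division so as to include small [rho], where boundedness of an entire function on
    the disc [|rho| <= 4 Q] replaces [solution_large]. *)
Lemma S_asymp : exists2 K, 0 < K & forall rho,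
  cabs rho * cabs (rho * S rho L - csin (rho * L%:C)) <= K * expR (`|cim rho| * L).
Proof.
have eF : entire (fun rho => rho * S rho L - csin (rho * L%:C)).
  apply: entireB; first by apply: entireM; [exact: entire_id|exact: entire_S].
  exact: (entire_scale L%:C (@entire_csin R)).
have [M M0 hM] := entire_bounded (4 * Q) eF.
have Q0 := normq_ge0.
exists (4 * Q + 4 * Q * M + 1); first by rewrite ltr_wpDl // addr_ge0 // ?mulr_ge0 // ltW.
move=> rho.
have e1 : 1 <= expR (`|cim rho| * L) by rewrite -expR0 ler_expR mulr_ge0 // ltW.
have QM : 0 <= 4 * Q * M by rewrite !mulr_ge0 // ltW.
have [r4|r4] := leP (cabs rho) (4 * Q).
  apply: (@le_trans _ _ (4 * Q * M * 1)).
    by rewrite mulr1; apply: ler_pM => //; exact: hM.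
  by apply: ler_pM => //; lra.
have r0 : 0 < cabs rho by apply: le_lt_trans r4; rewrite mulr_ge0.
have [dy hs] := is_S_solutionP (hS rho).
have := solution_large hs r0 (ltW r4).
rewrite mulrAC ler_pdivlMr // mulrC => h; apply: le_trans h _.
by apply: ler_wpM2r; [exact: expR_ge0|lra].
Qed.

End Solutions.

(** * Interpolation at the zeros of the cosine *)

Section Interpolation.
Variable R : realType.
Local Notation C := R[i].
Variable L : R.
Hypothesis L0 : 0 < L.
Local Notation pi := (@pi R).

Let LC : L%:C != 0 :> C.
Proof. by rewrite -cabs_gt0 cabsR gtr0_norm. Qed.

(** The nodes, the zeros of [sin (w L)] and 0 are all real, so identities with these denominators
    need only be checked off the real axis. *)
Lemma entire_eq_off_real (f g : C -> C) : ccontinuous f -> ccontinuous g ->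
  (forall w, cim w != 0 -> f w = g w) -> forall w, f w = g w.
Proof.
move=> cf cg h w; have [w0|/h//] := eqVneq (cim w) 0.
apply: ccont_eq_off; [exact: cf|exact: cg|] => e e0.
exists (w + 0 +i* (e / 2)).
  rewrite addrAC subrr add0r; apply: le_lt_trans (cabs_le_reim _) _.
  by rewrite /cre /cim /= normr0 add0r gtr0_norm; lra.
by apply: h; rewrite cimD w0 add0r /cim /= lt0r_neq0 // divr_gt0.
Qed.

Lemma odd_natr n : (n.*2.+1)%:R = 2 * n%:R + 1 :> R.
Proof. by rewrite -natr1 -mul2n natrM. Qed.

(** The positive zeros of [cos (w L)]. *)
Definition node n : R := (n.*2.+1)%:R * pi / (2 * L).
Local Notation nd n := ((node n)%:C : C).

Lemma nodeE n : (n.*2.+1)%:R * pi%:C / (2 * L%:C) = nd n.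
Proof. by rewrite /node !rmorphM fmorphV rmorphM !rmorph_nat. Qed.

Lemma node_gt0 n : 0 < node n.
Proof. by rewrite divr_gt0 ?mulr_gt0 ?pi_gt0 ?ltr0n. Qed.

Lemma node_inj : injective node.
Proof.
move=> m n /(congr1 (fun x => x * (2 * L) / pi)).
have p0 := pi_gt0 R; have L20 : 2 * L != 0 by rewrite mulf_neq0 ?lt0r_neq0.
rewrite /node !divfK // !mulfK ?lt0r_neq0 // => /eqP; rewrite eqr_nat eqSS => /eqP h.
by rewrite -(doubleK m) h doubleK.
Qed.

Lemma nd_neq0 n : nd n != 0.
Proof. by rewrite -cabs_gt0 cabsR gtr0_norm node_gt0. Qed.

Lemma nd_addr_neq0 m n : nd m + nd n != 0.
Proof.
by rewrite -rmorphD -cabs_gt0 cabsR gtr0_norm ?addr_gt0 ?node_gt0.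
Qed.

Lemma nd_subr_neq0 m n : m != n -> nd m - nd n != 0.
Proof.
move=> mn; rewrite -rmorphB -cabs_gt0 cabsR normr_gt0 subr_eq0.
by apply: contra mn => /eqP/node_inj ->.
Qed.

Lemma nodeL n : node n * L = pi / 2 + pi *+ n.
Proof.
rewrite /node -mulr_natr odd_natr; field.
exact: lt0r_neq0.
Qed.

Lemma csin_node n : csin (nd n * L%:C) = (-1) ^+ n.
Proof.
by rewrite -rmorphM nodeL rmorphD rmorphMn csinDnpi csinR sin_pihalf rmorph1 mulr1.
Qed.

Lemma ccos_shift_node n w : ccos (w * L%:C) = (-1) ^+ n.+1 * csin ((w - nd n) * L%:C).
Proof.
rewrite ccosE -csinDnpi; congr csin.
have -> : (pi / 2)%:C = pi%:C *+ n.+1 - nd n * L%:C.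
  by rewrite -rmorphM -rmorphMn -rmorphB /=; congr (_%:C); rewrite nodeL mulrS; field.
by ring.
Qed.

Lemma ccos_node n : ccos (nd n * L%:C) = 0.
Proof. by rewrite (ccos_shift_node n) subrr mul0r -(rmorph0 (real_complex R)) csinR sin0 rmorph0 mulr0. Qed.

Lemma ccos_nodeN n : ccos (- nd n * L%:C) = 0.
Proof. by rewrite mulNr ccosN ccos_node. Qed.

Lemma entire_ccosL : entire (fun w => ccos (w * L%:C)).
Proof. exact: (entire_scale L%:C (@entire_ccos R)). Qed.

(** The cofactor is the interpolation kernel [cos (w L) / (w ^ 2 - node n ^ 2)], with its
    singularities removed. *)
Lemma ccos_factor n : exists g, entire g /\
  forall w, ccos (w * L%:C) = (w - nd n) * (w + nd n) * g w.
Proof.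
have [||g eg hg] := @entire_div_seq R _ [:: nd n; - nd n] entire_ccosL.
- by rewrite /= inE andbT -subr_eq0 opprK nd_addr_neq0.
- by move=> a; rewrite !inE => /orP[/eqP->|/eqP->]; [exact: ccos_node|exact: ccos_nodeN].
exists g; split=> // w.
by rewrite hg !prodX_cons prodX_nil mulr1 opprK.
Qed.

Definition remainder (f : C -> C) w : C := w * f w - csin (w * L%:C).

(** * The interpolation series and its error *)

Section Kernel.
Variable kap : nat -> C -> C.
Hypothesis ekap : forall n, entire (kap n).
Hypothesis hkap : forall n w, ccos (w * L%:C) = (w - nd n) * (w + nd n) * kap n w.

Lemma kap_even n w : kap n (- w) = kap n w.
Proof.
apply: (@entire_eq_off_real (fun w => kap n (- w)) (kap n)).
- move=> z; apply: entire_cont.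
  by apply: entire_ext (entire_scale (-1) (ekap n)) => u; rewrite mulrN1.
- by move=> z; exact: entire_cont.
move=> z z0; apply: (@mulfI _ ((z - nd n) * (z + nd n))).
  rewrite mulf_neq0 //; apply: contra z0 => /eqP h.
    by rewrite -(subrK (nd n) z) h add0r cimR.
  by rewrite -(addrK (nd n) z) h sub0r cimN cimR oppr0.
rewrite -hkap -ccosN -mulNr (hkap n (- z)); by ring.
Qed.

(** Amounts to the derivative of the cosine at its zero. It is found by cancelling [w - nd n] and
    using the value 1 of [sin z / z] at 0. *)
Lemma kap_self n : kap n (nd n) * (2 * nd n) = (-1) ^+ n.+1 * L%:C.
Proof.
have [g eg [hg g0]] := @csin_div R.
pose A w := (w + nd n) * kap n w.
pose B w := (-1) ^+ n.+1 * (L%:C * g ((w - nd n) * L%:C)).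
have e : A (nd n) = B (nd n).
  apply: (@ccont_eq_punctured _ A B (nd n)).
  - move=> z; apply: entire_cont; apply: entireM => //.
    by apply: entireD; [exact: entire_id|exact: entire_cst].
  - move=> z; apply: entire_cont; apply: entireZ; apply: entireZ.
    exact: (@entire_shift _ (fun w => g (w * L%:C)) (- nd n) (entire_scale L%:C eg)).
  move=> w wn; apply: (@mulfI _ (w - nd n)); first by rewrite subr_eq0.
  rewrite /A /B mulrA -hkap (ccos_shift_node n) hg; by ring.
by move: e; rewrite /A /B subrr mul0r g0 mulr1 => <-; ring.
Qed.

Lemma kap_self_neq0 n : kap n (nd n) != 0.
Proof.
apply/eqP => h; have := kap_self n; rewrite h mul0r => /eqP.
by rewrite eq_sym mulf_eq0 signr_eq0 (negbTE LC).
Qed.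

Lemma kap_other m n : m != n -> kap n (nd m) = 0.
Proof.
move=> mn; have := hkap n (nd m); rewrite ccos_node => /esym/eqP.
by rewrite !mulf_eq0 (negbTE (nd_subr_neq0 mn)) (negbTE (nd_addr_neq0 m n)) => /eqP.
Qed.

Variable f : C -> C.
Hypothesis ef : entire f.
Hypothesis feven : forall w, f (- w) = f w.
Variable K : R.
Hypothesis K0 : 0 < K.
Local Notation F := (remainder f).
Hypothesis hK : forall w, cabs w * cabs (F w) <= K * expR (`|cim w| * L).

(** The coefficient [s_n(L)]: since [sin (node n * L) = (-1) ^ n], the constant -2 is absorbed into
    the remainder [F]. *)
Definition coef n : C := 2 * (-1) ^+ n * F (nd n).
Definition GN N w : C := - \sum_(n < N) coef n / L%:C * kap n w.

Let FN w : F (- w) = - F w.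
Proof. by rewrite /remainder feven !mulNr csinN opprD. Qed.

Let eF : entire F.
Proof.
apply: entireB; first by apply: entireM => //; exact: entire_id.
exact: (entire_scale L%:C (@entire_csin R)).
Qed.

Lemma entire_GN N : entire (GN N).
Proof.
apply: entireN; apply: (@entire_sum R 'I_N _ (fun n w => coef n / L%:C * kap n w)) => n.
exact: entireZ.
Qed.

Definition defect N w : C := F w - w * GN N w.
Local Notation DN := defect.

(** At a node all other kernels vanish, and [kap_self] normalizes the remaining term to [F]. *)
Lemma defect_node N n : (n < N)%N -> DN N (nd n) = 0.
Proof.
move=> nN; rewrite /defect /GN (bigD1 (Ordinal nN)) //= big1 ?addr0; last first.
  move=> m mn; rewrite kap_other ?mulr0 //.
  by apply: contra mn => /eqP e; apply/eqP/val_inj; rewrite /= e.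
have : kap n (nd n) = (-1) ^+ n.+1 * L%:C / (2 * nd n).
  by rewrite -kap_self mulfK // mulf_neq0 ?pnatr_eq0 // nd_neq0.
move=> ->; rewrite /coef exprS.
have s2 : (-1) ^+ n * (-1) ^+ n = 1 :> C by rewrite -exprMn mulrNN mulr1 expr1n.
have -> : nd n * - (2 * (-1) ^+ n * F (nd n) / L%:C * (-1 * (-1) ^+ n * L%:C / (2 * nd n)))
  = ((-1) ^+ n * (-1) ^+ n) * F (nd n).
  by field; rewrite nd_neq0 LC.
by rewrite s2 mul1r subrr.
Qed.

Lemma defect_odd N w : DN N (- w) = - DN N w.
Proof.
rewrite /defect FN; have -> : GN N (- w) = GN N w.
  by rewrite /GN; congr (- _); apply: eq_bigr => n _; rewrite kap_even.
by ring.
Qed.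

Definition nodes N : seq C := [seq nd n | n <- iota 0 N] ++ [seq - nd n | n <- iota 0 N].

Lemma mem_nodes N z : z \in nodes N -> exists2 n, (n < N)%N & z = nd n \/ z = - nd n.
Proof.
by rewrite mem_cat => /orP[] /mapP[n]; rewrite mem_iota add0n => /andP[_ nN] ->; exists n => //; [left|right].
Qed.

Lemma nd_in_nodes N n : (n < N)%N -> (nd n \in nodes N) /\ (- nd n \in nodes N).
Proof.
move=> nN; rewrite !mem_cat; split; apply/orP; [left|right]; apply/mapP; exists n => //;
  by rewrite mem_iota.
Qed.

Lemma uniq_nodes N : uniq (nodes N).
Proof.
have inj : injective (fun n => nd n) by move=> m n /complexI/node_inj.
rewrite cat_uniq !map_inj_uniq ?iota_uniq //=; last first.
  by move=> m n /oppr_inj; exact: inj.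
rewrite andbT; apply/hasPn => z /mapP[n _ ->]; apply/mapP => -[m _ /eqP].
by rewrite -subr_eq0 -opprD oppr_eq0 (negbTE (nd_addr_neq0 n m)).
Qed.

(** For [N > 0] this is the midpoint of [node N.-1] and [node N]. *)
Definition radius N : R := N%:R * pi / L.

(** On the circle [|w L|] is an integer multiple of pi, while the zeros of the cosine have moduli
    [(j + 1 / 2) pi]. The distance is at least [pi / 2], so [csin_lower] gives a constant
    independent of [N]. *)
Lemma ccos_lower : exists2 c, 0 < c & forall N w, (0 < N)%N -> cabs w = radius N ->
  c * expR (`|cim w| * L) <= cabs (ccos (w * L%:C)).
Proof.
have p0 := pi_gt0 R.
have [||c c0 hc] := @csin_lower R (pi / 2); [lra|lra|].
exists c => // N w N0 hw; rewrite ccosE.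
have -> : `|cim w| * L = `|cim (w * L%:C + (pi / 2)%:C)|.
  by rewrite cimD cimM !cimR creR mulr0 add0r addr0 normrM (gtr0_norm L0).
apply: hc => m.
have hm : exists j : nat, `|m%:~R - 1 / 2 : R| = j%:R + 1 / 2.
  case: m => [[|k]|k].
  - by exists 0%N; rewrite sub0r normrN ger0_norm; lra.
  - exists k; have -> : (k.+1%:Z)%:~R = k%:R + 1 :> R by rewrite natr1.
    have k0 : 0 <= k%:R :> R by [].
    by rewrite ger0_norm; lra.
  - exists k.+1; rewrite NegzE mulrNz -opprD normrN.
    have -> : (k.+1%:Z)%:~R = k.+1%:R :> R by [].
    have k0 : 0 <= k.+1%:R :> R by [].
    by rewrite ger0_norm; lra.
have [j hj] := hm.
have -> : w * L%:C + (pi / 2)%:C - m%:~R * pi%:C = w * L%:C - ((m%:~R - 1 / 2) * pi)%:C.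
  have -> : m%:~R * pi%:C = (m%:~R * pi)%:C by rewrite rmorphM rmorph_int.
  by rewrite -addrA -rmorphB -rmorphN; congr (_ + _%:C); field.
have e1 : cabs (w * L%:C) = N%:R * pi.
  by rewrite cabsM hw cabsR (gtr0_norm L0) /radius divfK ?lt0r_neq0.
have e2 : cabs ((m%:~R - 1 / 2) * pi)%:C = (j%:R + 1 / 2) * pi.
  by rewrite cabsR normrM hj (gtr0_norm p0).
have [jN|Nj] := ltnP j N.
  apply: le_trans (lerB_cabs _ _); rewrite e1 e2.
  have : j%:R + 1 <= N%:R :> R by rewrite natr1 ler_nat.
  nra.
rewrite cabsB; apply: le_trans (lerB_cabs _ _); rewrite e1 e2.
have : N%:R <= j%:R :> R by rewrite ler_nat.
nra.
Qed.

Lemma ccos_zero_node N w : ccos (w * L%:C) = 0 -> cabs w <= radius N -> w \in nodes N.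
Proof.
have p0 := pi_gt0 R.
rewrite ccosE => /csin_zero[m hm] hw.
have e : w * L%:C = ((m%:~R - 1 / 2) * pi)%:C.
  apply: (@addIr _ (pi / 2)%:C); rewrite hm -rmorphD.
  have -> : (m%:~R - 1 / 2) * pi + pi / 2 = m%:~R * pi by field.
  by rewrite rmorphM rmorph_int.
have we : w = ((m%:~R - 1 / 2) * pi / L)%:C by rewrite -(mulfK LC w) e -fmorphV -rmorphM.
have hn : exists n, w = nd n \/ w = - nd n.
  case: m {hm e} we => [[|k]|k] ->.
  - exists 0%N; right; rewrite -rmorphN; congr (_%:C); rewrite /node mulr0z double0; field; exact: lt0r_neq0.
  - exists k; left; congr (_%:C); rewrite /node odd_natr.
    have -> : (k.+1%:Z)%:~R = k%:R + 1 :> R by rewrite natr1.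
    field; exact: lt0r_neq0.
  - exists k.+1; right; rewrite -rmorphN; congr (_%:C); rewrite /node odd_natr NegzE mulrNz.
    have -> : (k.+1%:Z)%:~R = k.+1%:R :> R by [].
    field; exact: lt0r_neq0.
have [n hwn] := hn.
have cw : cabs w = node n.
  by case: hwn => ->; rewrite ?cabsN cabsR gtr0_norm // node_gt0.
have nN : (n < N)%N.
  rewrite ltnNge; apply/negP => Nn; move: hw; rewrite cw leNgt => /negP; apply.
  rewrite /radius /node odd_natr.
  have -> : (2 * n%:R + 1) * pi / (2 * L) = (n%:R + 1 / 2) * pi / L by field; exact: lt0r_neq0.
  have : N%:R <= n%:R :> R by rewrite ler_nat.
  by rewrite ltr_pM2r ?invr_gt0 // ltr_pM2r //; lra.
have [h1 h2] := nd_in_nodes nN.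
by case: hwn => ->.
Qed.

Let coef_le n : cabs (coef n) <= 2 * K / node n.
Proof.
rewrite /coef !cabsM cabs_nat cabsX cabsN cabs1 expr1n mulr1 ler_pdivlMr ?node_gt0 //.
have := hK (nd n); rewrite cimR normr0 mul0r expR0 mulr1 cabsR (gtr0_norm (node_gt0 n)); lra.
Qed.

(** Bounds [|w GN| / |cos (w L)|] outside the circle: a coefficient is at most [2 K / node n], a
    kernel times [w] at most [|cos (w L)| / (radius N - node n)]. *)
Definition tail N : R := \sum_(n < N) 2 * K / L / (node n * (radius N - node n)).

Lemma node_lt_radius n N : (n < N)%N -> node n < radius N.
Proof.
have p0 := pi_gt0 R; move=> nN; rewrite /radius /node odd_natr.
have -> : (2 * n%:R + 1) * pi / (2 * L) = (n%:R + 1 / 2) * pi / L by field; exact: lt0r_neq0.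
have : n%:R + 1 <= N%:R :> R by rewrite natr1 ler_nat.
by rewrite ltr_pM2r ?invr_gt0 // ltr_pM2r //; lra.
Qed.

Lemma kap_le N n w : (n < N)%N -> radius N <= cabs w ->
  cabs w * cabs (kap n w) <= cabs (ccos (w * L%:C)) / (radius N - node n).
Proof.
move=> nN hw; have n0 := node_gt0 n; have nR := node_lt_radius nN.
have h1 : cabs w - node n <= cabs (w - nd n).
  by have := lerB_cabs w (nd n); rewrite cabsR gtr0_norm.
have h2 : cabs w - node n <= cabs (w + nd n).
  by have := lerB_cabsD w (nd n); rewrite cabsR gtr0_norm.
have h3 : cabs w * (radius N - node n) <= cabs ((w - nd n) * (w + nd n)).
  have -> : (w - nd n) * (w + nd n) = w ^+ 2 - nd n ^+ 2 by ring.
  apply: le_trans (lerB_cabs _ _); rewrite !cabsX cabsR (gtr0_norm n0).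
  (* With [a = node n] and [R = radius N]: [r ^ 2 - a ^ 2 - r (R - a) = r (r - R) + a (r - a)]. *)
  set r := cabs w in h1 h2 hw *; nra.
rewrite ler_pdivlMr ?subr_gt0 // (hkap n) cabsM mulrAC.
by rewrite ler_wpM2r.
Qed.

Lemma GN_le N w : radius N <= cabs w -> cabs (w * GN N w) <= tail N * cabs (ccos (w * L%:C)).
Proof.
move=> hw; rewrite /GN mulrN cabsN mulr_sumr; apply: le_trans (ler_cabs_sum _ _ _) _.
rewrite /tail mulr_suml; apply: ler_sum => n _.
have nR := node_lt_radius (ltn_ord n).
have n0 := node_gt0 n.
have h := kap_le (ltn_ord n) hw.
have -> : w * (coef n / L%:C * kap n w) = coef n / L%:C * (w * kap n w) by ring.
rewrite cabsM [cabs (w * _)]cabsM cabsf cabsR (gtr0_norm L0).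
have -> : 2 * K / L / (node n * (radius N - node n)) * cabs (ccos (w * L%:C)) =
   (2 * K / node n / L) * (cabs (ccos (w * L%:C)) / (radius N - node n)).
  by rewrite invfM; ring.
apply: ler_pM => //; first by rewrite divr_ge0 // ltW.
  by rewrite mulr_ge0.
by rewrite ler_wpM2r ?coef_le ?invr_ge0 ?(ltW L0).
Qed.

(** Outside the circle the two terms of the defect are bounded separately. Inside, defect and cosine
    are both divided by the product over the nodes; the cosine then has no zero left, and
    [quotient_max] carries the bound inwards. *)
Lemma interp_error : exists2 A, 0 < A & forall N, (0 < N)%N -> forall w,
  cabs (DN N w) <= (A / N%:R + tail N) * expR (`|cim w| * L).
Proof.
have p0 := pi_gt0 R.
have [c c0 hc] := ccos_lower.
(* The first summand, with the constant [c] of [ccos_lower], serves the inside of the circle, the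
   second the outside; [K L / (pi N)] is [K / radius N]. *)
exists (K * L / pi / c + K * L / pi); first by rewrite addr_gt0 // !divr_gt0 // mulr_gt0.
move=> N N0 w.
have NR : 0 < N%:R :> R by rewrite ltr0n.
have R0 : 0 < radius N by rewrite divr_gt0 // mulr_gt0.
have KR : K / radius N = K * L / pi / N%:R by rewrite /radius invf_div mulrA invfM mulrA mulrAC.
have tail0 : 0 <= tail N.
  apply: sumr_ge0 => n _; rewrite divr_ge0 //; first by rewrite divr_ge0 ?mulr_ge0 // ltW.
  by rewrite mulr_ge0 ?subr_ge0 // ltW ?node_gt0 ?node_lt_radius.
have cosle z : cabs (ccos (z * L%:C)) <= expR (`|cim z| * L).
  apply: le_trans (cabs_ccos_le _) _.
  by rewrite cimM cimR creR mulr0 add0r normrM (gtr0_norm L0).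
have Fle z : radius N <= cabs z -> cabs (F z) <= K / radius N * expR (`|cim z| * L).
  move=> hz; have z0 : 0 < cabs z by apply: lt_le_trans hz.
  have := hK z; rewrite mulrC -ler_pdivlMr // => h; apply: le_trans h _.
  rewrite mulrAC ler_wpM2r ?expR_ge0 // ler_pM2l // lef_pV2 ?posrE //.
have eD : entire (DN N).
  by apply: entireB => //; apply: entireM; [exact: entire_id|exact: entire_GN].
have E0 := expR_ge0 (`|cim w| * L).
have A1 : 0 <= K * L / pi / N%:R by rewrite -KR divr_ge0 // ltW.
have [wR|Rw] := leP (cabs w) (radius N); last first.
  apply: le_trans (ler_cabsB _ _) _.
  have h1 := Fle w (ltW Rw); have h2 := GN_le (ltW Rw).
  have h3 : tail N * cabs (ccos (w * L%:C)) <= tail N * expR (`|cim w| * L) by rewrite ler_wpM2l.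
  have h4 : 0 <= K * L / pi / c / N%:R * expR (`|cim w| * L).
    by rewrite mulr_ge0 // mulrAC divr_ge0 // ltW.
  rewrite KR in h1.
  have -> : ((K * L / pi / c + K * L / pi) / N%:R + tail N) * expR (`|cim w| * L) =
    K * L / pi / c / N%:R * expR (`|cim w| * L) + K * L / pi / N%:R * expR (`|cim w| * L) + tail N * expR (`|cim w| * L) by ring.
  lra.
pose kk := K / radius N / c + tail N.
have kk0 : 0 <= kk by apply: addr_ge0 => //; apply: divr_ge0; [apply: divr_ge0|]; exact: ltW.
suff h : cabs (DN N w) <= kk * cabs (ccos (w * L%:C)).
  apply: le_trans h _; apply: (@le_trans _ _ (kk * expR (`|cim w| * L))); first by rewrite ler_wpM2l.
  rewrite ler_wpM2r // lerD2r KR [leRHS]mulrDl mulrAC lerDl //.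
have [H eH hH] := entire_div_seq eD (uniq_nodes N)
  (ltac:(by move=> a /mem_nodes[n nN [->|->]]; rewrite ?defect_odd defect_node ?oppr0)).
have [Q eQ hQ] := entire_div_seq entire_ccosL (uniq_nodes N)
  (ltac:(by move=> a /mem_nodes[n nN [->|->]]; rewrite ?ccos_nodeN ?ccos_node)).
(* A zero of [Q] in the disc would be a double zero of the cosine at a node, which [kap_self_neq0]
   excludes. *)
have Q0 z : cabs z <= radius N -> Q z != 0.
  move=> hz; apply/eqP => Qz.
  have cz : ccos (z * L%:C) = 0 by rewrite hQ Qz mulr0.
  have zn := ccos_zero_node cz hz.
  have [Q' eQ' hQ'] := entire_div eQ Qz.
  have z2 : zero_atleast (fun w => ccos (w * L%:C)) z 1.
    apply: (@zero_atleast_count _ _ (z :: nodes N) Q') => //.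
      by move=> u; rewrite hQ hQ' prodX_cons mulrCA mulrA.
    by rewrite /= eqxx add1n ltnS -has_count has_pred1.
  have [n nN hzn] := mem_nodes zn.
  have kz : kap n z != 0 by case: hzn => ->; rewrite ?kap_even kap_self_neq0.
  have hk u : ccos (u * L%:C) = prodX [:: nd n; - nd n] u * kap n u.
    by rewrite !prodX_cons prodX_nil mulr1 opprK.
  move/(zero_atleastP _ (ekap n) hk kz): z2.
  have nn : nd n != - nd n by rewrite -subr_eq0 opprK nd_addr_neq0.
  by case: hzn => ->; rewrite /= eqxx ?(negbTE nn) // eq_sym (negbTE nn).
rewrite hH hQ !cabsM mulrCA; apply: ler_wpM2l => //.
apply: (@quotient_max _ H Q 0 (radius N) kk) => //; [|move=> z|by rewrite subr0].
  by move=> z; rewrite subr0; exact: Q0.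
rewrite subr0 => hz.
have Pz : 0 < cabs (prodX (nodes N) z).
  rewrite cabs_gt0; apply/eqP => P0.
  have cz : ccos (z * L%:C) = 0 by rewrite hQ P0 mul0r.
  have := hc N z N0 hz; rewrite cz cabs0 leNgt => /negP; apply.
  by rewrite mulr_gt0 // expR_gt0.
rewrite -(ler_pM2l Pz) mulrCA -!cabsM -hH -hQ.
apply: le_trans (ler_cabsB _ _) _; rewrite /kk mulrDl.
have Rz : radius N <= cabs z by rewrite hz.
apply: lerD; last exact: GN_le.
apply: le_trans (Fle z Rz) _.
rewrite -[leRHS]mulrA; apply: ler_wpM2l; first by apply: divr_ge0; exact: ltW.
by rewrite [leRHS]mulrC ler_pdivlMr // [leLHS]mulrC; exact: (hc N).
Qed.

(** Any bound of order less than [N] would do. The square root makes the induction elementary: [2 (b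
    - a) = 2 / (a + b) >= 1 / b >= 1 / b ^ 2]. *)
Lemma sum_inv_le N : \sum_(n < N) (n.+1%:R^-1 : R) <= 2 * Num.sqrt N%:R.
Proof.
elim: N => [|N IH]; first by rewrite big_ord0 sqrtr0 mulr0.
rewrite big_ord_recr /=; apply: le_trans (lerD IH (lexx _)) _.
set a := Num.sqrt N%:R; set b := Num.sqrt N.+1%:R.
have a0 : 0 <= a by exact: sqrtr_ge0.
have b0 : 0 < b by rewrite sqrtr_gt0 ltr0n.
have a2 : a ^+ 2 = N%:R by rewrite sqr_sqrtr.
have b2 : b ^+ 2 = N.+1%:R by rewrite sqr_sqrtr.
have ab : b ^+ 2 = a ^+ 2 + 1 by rewrite a2 b2 natr1.
have b1 : 1 <= b ^+ 2 by rewrite b2 ler1n.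
rewrite -b2 -lerBrDl -mulrBr -[_^-1]mul1r ler_pdivrMr ?exprn_gt0 //.
have ba : a <= b by rewrite ler_sqrt // ler_nat.
have b_1 : 1 <= b by rewrite -(@ler_pXn2r _ 2) ?nnegrE ?ler01 ?(ltW b0) // expr1n.
have h1 : (b - a) * (b + a) = 1 by rewrite -subr_sqr ab; ring.
have h2 : 0 <= (b - a) * (2 * b ^+ 2 - (b + a)).
  by rewrite mulr_ge0 ?subr_ge0 //; nra.
lra.
Qed.

(** Partial fractions [1 / (a b) = (1 / a + 1 / b) / (a + b)] in the scaling of the nodes. *)
Lemma term_split (p a b l k : R) : 0 < p -> 0 < a -> 0 < b -> 0 < l ->
  2 * k / l / (a * p / (2 * l) * (b * p / (2 * l))) =
  2 * k * (2 * l) ^+ 2 / l / p ^+ 2 / (a + b) * (a^-1 + b^-1).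
Proof.
move=> p0 a0 b0 l0; field.
by rewrite !lt0r_neq0 // addr_gt0.
Qed.

Lemma term_sum (p l k s : R) : 0 < p -> 0 < l -> 0 < s ->
  2 * k * (2 * l) ^+ 2 / l / p ^+ 2 / (2 * s ^+ 2) * (2 * s + 2 * s) = 16 * k * l / p ^+ 2 / s.
Proof. by move=> p0 l0 s0; field; rewrite !lt0r_neq0. Qed.

(** [radius N - node n] is the node of the reversed index, and the two odd numbers involved add up
    to [2 N]. Partial fractions then give [1 / N] times two harmonic sums, equal by reversal. *)
Lemma tail_le N : (0 < N)%N -> tail N <= 16 * K * L / pi ^+ 2 / Num.sqrt N%:R.
Proof.
move=> N0; have p0 := pi_gt0 R.
have NR : 0 < N%:R :> R by rewrite ltr0n.
have sN : 0 < Num.sqrt N%:R :> R by rewrite sqrtr_gt0.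
pose A := 2 * K * (2 * L) ^+ 2 / L / pi ^+ 2 / (2 * N%:R).
have A0 : 0 <= A.
  have B0 : 0 <= 2 * K * (2 * L) ^+ 2 by rewrite !mulr_ge0 ?exprn_ge0 ?mulr_ge0 // ltW.
  by rewrite /A; do !apply: divr_ge0 => //; rewrite ?exprn_ge0 ?mulr_ge0 ?ltW.
have hterm (n : 'I_N) : 2 * K / L / (node n * (radius N - node n)) <=
    A * (n.+1%:R^-1 + (rev_ord n).+1%:R^-1).
  pose a : R := (n.*2.+1)%:R; pose b : R := ((rev_ord n).*2.+1)%:R.
  have a0 : 0 < a by rewrite ltr0n.
  have b0 : 0 < b by rewrite ltr0n.
  have ab : a + b = 2 * N%:R.
    rewrite /a /b -natrD -natrM; congr (_%:R); rewrite /=.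
    have := ltn_ord n; rewrite -!addnn; lia.
  have hr : radius N - node n = b * pi / (2 * L).
    rewrite /radius /node -/a; have -> : N%:R = (a + b) / 2 by rewrite ab; field.
    by field; exact: lt0r_neq0.
  have -> : 2 * K / L / (node n * (radius N - node n)) = A * (a^-1 + b^-1).
    by rewrite hr /node -/a /A -ab; exact: term_split.
  rewrite ler_wpM2l //; apply: lerD; rewrite lef_pV2 ?posrE ?ltr0n // ler_nat ltnS -addnn leq_addr //.
apply: le_trans (ler_sum _ (fun n _ => hterm n)) _.
rewrite -mulr_sumr big_split /=.
have -> : \sum_(n < N) ((rev_ord n).+1%:R^-1 : R) = \sum_(n < N) (n.+1%:R^-1).
  by rewrite [LHS](reindex_inj rev_ord_inj); apply: eq_bigr => n _; rewrite rev_ordK.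
have h := sum_inv_le N.
apply: (@le_trans _ _ (A * (2 * Num.sqrt N%:R + 2 * Num.sqrt N%:R))).
  by rewrite ler_wpM2l // lerD.
have sE : N%:R = Num.sqrt N%:R ^+ 2 :> R by rewrite sqr_sqrtr.
by rewrite le_eqVlt; apply/orP; left; apply/eqP; rewrite /A {1}sE; exact: term_sum.
Qed.

Lemma interp_approx (e : R) : 0 < e -> exists N, forall w,
  cabs (DN N w) <= e * expR (`|cim w| * L).
Proof.
move=> e0; have [A A0 hA] := interp_error; have p0 := pi_gt0 R.
pose B := 16 * K * L / pi ^+ 2.
have B0 : 0 <= B by rewrite divr_ge0 ?exprn_ge0 ?(ltW p0) // !mulr_ge0 // ltW.
pose m := (Num.bound ((A + B) / e)).+1.
have m0 : 0 < m%:R :> R by rewrite ltr0n.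
have hm : (A + B) / e <= m%:R.
  apply: ltW; apply: (@lt_trans _ _ (Num.bound ((A + B) / e))%:R).
    by apply: archi_boundP; rewrite divr_ge0 ?addr_ge0 // ltW.
  by rewrite ltr_nat.
(* A perfect square, so that the square root of [N] is the natural number [m]. *)
exists (m ^ 2)%N => w; apply: le_trans (hA _ _ w) _; first by rewrite expn_gt0.
rewrite ler_wpM2r ?expR_ge0 //.
have h1 : tail (m ^ 2)%N <= B / m%:R.
  apply: le_trans (tail_le _) _; first by rewrite expn_gt0.
  by rewrite natrX sqrtr_sqr ger0_norm.
have h2 : A / (m ^ 2)%:R <= A / m%:R.
  rewrite ler_pM2l // lef_pV2 ?posrE ?ltr0n ?expn_gt0 // ler_nat.
  by rewrite -{1}(expn1 m) leq_pexp2l.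
apply: le_trans (lerD h2 h1) _.
by rewrite -mulrDl ler_pdivrMr // mulrC -ler_pdivrMr.
Qed.

End Kernel.
End Interpolation.

(** * Localization and matching of the zeros *)

Section Stability.
Variable R : realType.
Local Notation C := R[i].
Variable L : R.
Hypothesis L0 : 0 < L.
Local Notation pi := (@pi R).
Local Notation ctr m := ((m%:~R * pi / L)%:C : C).

Let LC : L%:C != 0 :> C.
Proof. by rewrite -cabs_gt0 cabsR gtr0_norm. Qed.

(** [hurwitz] at the single zero 0; [r L < pi] keeps the other zeros of the sine out of the disc.
    The constant [d] found here is reused at every remote zero. *)
Lemma csin_disc (r e : R) : 0 < r -> r * L < pi -> 0 < e -> exists2 d, 0 < d &
  forall h, entire h -> (forall w, cabs w <= r -> cabs (csin (w * L%:C) - h w) <= d) ->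
  exists b, exists2 h', entire h' & [/\ cabs b <= e, cabs b < r,
    forall w, h w = (w - b) * h' w & forall w, cabs w <= r -> h' w != 0].
Proof.
move=> r0 rL e0; have [g eg [hg g0]] := @csin_div R.
pose sg w := L%:C * g (w * L%:C).
have esg : entire sg by apply: entireZ; exact: (entire_scale L%:C eg).
have hsg w : csin (w * L%:C) = prodX [:: 0] w * sg w.
  by rewrite prodX_cons prodX_nil mulr1 subr0 hg /sg mulrA.
have sg0 w : cabs w <= r -> sg w != 0.
  move=> wr; have [->|w0] := eqVneq w 0; first by rewrite /sg mul0r g0 mulr1.
  apply/eqP => sw; have : csin (w * L%:C) = 0 by rewrite hsg sw mulr0.
  move=> /csin_zero[m hm].
  have hc : cabs w * L = `|m%:~R| * pi.
    have := congr1 (@cabs R) hm; rewrite !cabsM !cabsR (gtr0_norm L0) (gtr0_norm (pi_gt0 R)) => ->.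
    by rewrite -(rmorph_int (real_complex R)) cabsR.
  have lt1 : `|m%:~R : R| < 1.
    rewrite -(ltr_pM2r (pi_gt0 R)) -hc mul1r; apply: le_lt_trans rL.
    by rewrite ler_wpM2r // ltW.
  have m0 : m = 0.
    move: lt1; rewrite -intr_norm -[1]/(1%:~R) ltr_int; lia.
  by move: hm; rewrite m0 mulr0z mul0r => /eqP; rewrite mulf_eq0 (negbTE LC) orbF (negbTE w0).
have [|d d0 hd] := @hurwitz R [:: 0] _ sg r r0 (entire_scale L%:C (@entire_csin R)) esg hsg sg0 _ e e0.
  by move=> a; rewrite inE => /eqP->; rewrite cabs0.
exists d => // h eh hh; have [t [h' eh' [st tb tr ht h'0]]] := hd h eh hh.
case: t st tb tr ht => [//|b []] //= _ tb tr ht; exists b, h' => //; split=> //.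
- by have := tb 0%N isT; rewrite /= sub0r cabsN.
- by apply: tr; rewrite mem_head.
- by move=> w; rewrite ht prodX_cons prodX_nil mulr1.
Qed.

Lemma ctr_cabs (m : int) : cabs (ctr m) = `|m|%N%:R * pi / L.
Proof.
rewrite cabsR !normrM normfV (gtr0_norm L0) (gtr0_norm (pi_gt0 R)).
by rewrite -intr_norm -abszE.
Qed.

Lemma ctr_dist (m n : int) : m != n -> pi / L <= cabs (ctr m - ctr n).
Proof.
move=> mn; rewrite -rmorphB cabsR -mulrBl -mulrBl -intrB !normrM normfV.
rewrite (gtr0_norm L0) (gtr0_norm (pi_gt0 R)) ler_pM2r ?invr_gt0 // ler_peMl ?pi_ge0 //.
rewrite -intr_norm -[1]/(1%:~R) ler_int; lia.
Qed.

(** Translation by [m pi / L] multiplies the sine by a sign only, hence [d] does not depend on [m].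
    The perturbation is [w * h w]; as [|ctr m| > r], the factor [w] has no zero in the disc and the
    zero belongs to [h]. *)
Lemma far_zero (r e : R) : 0 < r -> r * L < pi -> 0 < e -> exists2 d, 0 < d &
  forall h (m : int), entire h -> r < cabs (ctr m) ->
  (forall w, cabs (w - ctr m) <= r -> cabs (w * h w - csin (w * L%:C)) <= d) ->
  exists b, exists2 h', entire h' & [/\ cabs (b - ctr m) <= e, cabs (b - ctr m) < r,
    forall w, h w = (w - b) * h' w & forall w, cabs (w - ctr m) <= r -> h' w != 0].
Proof.
move=> r0 rL e0; have [d d0 hd] := csin_disc r0 rL e0.
exists d => // h m eh rm hh.
set a := ctr m in rm hh *.
pose sgn : C := (-1) ^+ `|m|%N.
have sgn2 : sgn * sgn = 1 by rewrite -exprMn mulrNN mulr1 expr1n.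
have csgn : cabs sgn = 1 by rewrite /sgn cabsX cabsN cabs1 expr1n.
pose g u := sgn * ((u + a) * h (u + a)).
have ehs : entire (fun u => h (u + a)) by exact: entire_shift.
have eida : entire (fun u : C => u + a) by apply: entireD; [exact: entire_id|exact: entire_cst].
have eg : entire g by apply: entireZ; exact: entireM.
have hs u : csin (u * L%:C) = sgn * csin ((u + a) * L%:C).
  have -> : (u + a) * L%:C = u * L%:C + m%:~R * pi%:C.
    rewrite mulrDl; congr (_ + _); rewrite /a -rmorphM divfK ?lt0r_neq0 //.
    by rewrite rmorphM rmorph_int.
  by rewrite csin_shift mulrA sgn2 mul1r.
have [|b [g' eg' [be br hg g'0]]] := hd g eg.
  move=> u ur; rewrite hs -mulrBr cabsM csgn mul1r cabsB.
  by apply: hh; rewrite addrK.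
have ba0 : b + a != 0.
  rewrite -cabs_gt0; have := lerB_cabsD a b; rewrite (addrC a b); lra.
have hb : h (b + a) = 0.
  have := hg b; rewrite subrr mul0r /g => /eqP.
  by rewrite !mulf_eq0 signr_eq0 (negbTE ba0) => /eqP.
have [h' eh' hh'] := entire_div eh hb.
exists (b + a), h' => //; rewrite addrK; split=> // w wr.
(* Both sides are the cofactor of [u - b] in [g]; they agree at [b] by continuity, so [h'] inherits
   the absence of zeros from [g']. *)
have e1 : forall u, sgn * ((u + a) * h' (u + a)) = g' u.
  apply: (@ccont_eq_punctured _ (fun u => sgn * ((u + a) * h' (u + a))) g' b).
  - move=> u; apply: entire_cont; apply: entireZ; apply: entireM => //.
    exact: entire_shift.
  - by move=> u; exact: entire_cont.
  move=> u ub; apply: (@mulfI _ (u - b)); first by rewrite subr_eq0.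
  by rewrite -hg /g hh'; ring.
have := g'0 (w - a) wr; rewrite -e1 subrK.
by apply: contra => /eqP->; rewrite !mulr0.
Qed.

(** [eta] has to be fixed before [g], so the regions and the list of central zeros are determined by
    [f] and [eps]. Remote zeros of [f] and [g] are not compared directly: each is within [eps / 2]
    of the same centre. *)
Lemma zeros_stable (f : C -> C) (K eps : R) : entire f -> 0 < K -> 0 < eps ->
  (forall w, cabs w * cabs (remainder L f w) <= K * expR (`|cim w| * L)) ->
  exists2 eta, 0 < eta & forall g, entire g ->
    (forall w, cabs (w * f w - w * g w) <= eta * expR (`|cim w| * L)) ->
    exists phi : C * nat -> C * nat, set_bij (zeros_mult f) (zeros_mult g) phi /\
      (forall p, zeros_mult f p -> cabs ((phi p).1 - p.1) <= eps).
Proof.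
move=> ef K0 eps0 hK.
have p0 := pi_gt0 R.
(* A quarter of the spacing of the centres: the small discs are disjoint. *)
pose r := pi / 4 / L; have r0 : 0 < r by rewrite !divr_gt0.
have rL : r * L = pi / 4 by rewrite /r divfK ?lt0r_neq0.
have [||c c0 hc] := @csin_lower R (pi / 4); [lra|lra|].
have e20 : 0 < eps / 2 by lra.
have [|d d0 hd] := @far_zero r (eps / 2) r0 _ e20; first by rewrite rL; lra.
(* In a disc of radius [r] about a real centre the exponential weight is at most [expR (r * L)]. *)
pose d' := d * expR (- (r * L)).
have d'0 : 0 < d' by rewrite mulr_gt0 ?expR_gt0.
(* Below [c / 2] no zero can lie outside the small discs; below [d'] each remote small disc contains
   exactly one, by [far_zero]. *)
pose e0 := Num.min (c / 2) d'.
have e00 : 0 < e0 by rewrite lt_min d'0 divr_gt0.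
have e0c : e0 <= c / 2 by rewrite ge_min lexx.
have e0d : e0 <= d' by rewrite ge_min lexx orbT.
(* Makes [K / |w| <= e0 / 2] for [|w| >= R1]: [f] uses half of [e0], and [g] has the other half
   through [eta]. *)
pose n0 := (Num.bound (K / (e0 / 2) * L / pi)).+1.
have hn0 : K / (e0 / 2) * L / pi <= n0%:R.
  apply: ltW; apply: (@lt_trans _ _ (Num.bound (K / (e0 / 2) * L / pi))%:R); last by rewrite ltr_nat.
  apply: archi_boundP; rewrite divr_ge0 ?(ltW p0) // mulr_ge0 ?(ltW L0) // divr_ge0 ?ltW // divr_gt0 //.
pose u := pi / L; have u0 : 0 < u by rewrite divr_gt0.
have ru : r = u / 4 by rewrite /r /u; ring.
pose R1 := n0%:R * u; have R10 : 0 < R1 by rewrite mulr_gt0 // ltr0n.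
(* Halfway between consecutive centres, so the circle [|w| = R0] stays at distance [u / 2] from all
   of them; small discs with index beyond [n0] lie outside it but within [|w| >= R1]. *)
pose R0 := R1 + u / 2; have R00 : 0 < R0 by rewrite addr_gt0 // divr_gt0.
have KR1 : K / (e0 / 2) <= R1.
  by move: hn0; rewrite ler_pdivrMr // -ler_pdivlMr // /R1 /u mulrA.
have ctrE m : cabs (ctr m) = `|m|%N%:R * u by rewrite ctr_cabs /u mulrA.
have hcirc w m : cabs w = R0 -> u / 2 <= cabs (w - ctr m).
  move=> hw; have [mn|mn] := leqP `|m|%N n0.
    apply: le_trans (lerB_cabs _ _); rewrite hw ctrE /R0 /R1.
    have : `|m|%N%:R <= n0%:R :> R by rewrite ler_nat.
    by move=> h; have := ler_wpM2r (ltW u0) h; lra.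
  rewrite cabsB; apply: le_trans (lerB_cabs _ _); rewrite hw ctrE /R0 /R1.
  have : n0%:R + 1 <= `|m|%N%:R :> R by rewrite natr1 ler_nat.
  by move=> h; have := ler_wpM2r (ltW u0) h; lra.
have nonzero h w : cabs (w * h w - csin (w * L%:C)) <= e0 * expR (`|cim w| * L) ->
    (forall m : int, r <= cabs (w - ctr m)) -> h w != 0.
  move=> h1 h2; apply/eqP => hw; move: h1; rewrite hw mulr0 sub0r cabsN leNgt => /negP; apply.
  have E0 := expR_gt0 (`|cim w| * L).
  apply: lt_le_trans (_ : c * expR (`|cim w| * L) <= _); first by rewrite ltr_pM2r //; lra.
  have e1 : `|cim w| * L = `|cim (w * L%:C)| by rewrite cimM cimR creR mulr0 add0r normrM (gtr0_norm L0).
  rewrite e1; apply: hc => m.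
  have -> : w * L%:C - m%:~R * pi%:C = (w - ctr m) * L%:C.
    by rewrite mulrBl -[ctr m * _]rmorphM divfK ?lt0r_neq0 // rmorphM rmorph_int.
  by rewrite cabsM cabsR (gtr0_norm L0) -rL ler_pM2r.
have zone h (m : int) : entire h -> (n0 < `|m|)%N ->
    (forall w, R1 <= cabs w -> cabs (w * h w - csin (w * L%:C)) <= e0 * expR (`|cim w| * L)) ->
    exists b, exists2 h', entire h' & [/\ cabs (b - ctr m) <= eps / 2, cabs (b - ctr m) < r,
    forall w, h w = (w - b) * h' w & forall w, cabs (w - ctr m) <= r -> h' w != 0].
  move=> eh mn hh.
  have hm : n0%:R * u + u <= cabs (ctr m).
    have hmn : n0%:R + 1 <= `|m|%N%:R :> R by rewrite natr1 ler_nat.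
    by rewrite ctrE; have := ler_wpM2r (ltW u0) hmn; lra.
  apply: hd => //; first by rewrite ru /R1 in R10 *; lra.
  move=> w hw; apply: le_trans (hh w _) _.
    by rewrite /R1; have := lerB_cabs (ctr m) w; rewrite cabsB ru in hw *; lra.
  apply: (@le_trans _ _ (d' * expR (`|cim w| * L))); first by rewrite ler_wpM2r ?expR_ge0.
  rewrite /d' -mulrA -expRD ger_pMr // expR_le1.
  have : `|cim w| <= r.
    apply: le_trans hw; have := cim_le_cabs (w - ctr m).
    by rewrite cimD cimN cimR subr0.
  by move=> hcim; have := ler_wpM2r (ltW L0) hcim; lra.
have far_f w : R1 <= cabs w -> cabs (w * f w - csin (w * L%:C)) <= e0 / 2 * expR (`|cim w| * L).
  move=> hw; have w0 : 0 < cabs w by apply: lt_le_trans hw.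
  have h1 := hK w; rewrite mulrC -ler_pdivlMr // in h1; apply: le_trans h1 _.
  rewrite mulrAC ler_wpM2r ?expR_ge0 // ler_pdivrMr // mulrC -ler_pdivrMr ?divr_gt0 //.
  exact: le_trans KR1 hw.
have far_f' w : R1 <= cabs w -> cabs (w * f w - csin (w * L%:C)) <= e0 * expR (`|cim w| * L).
  move=> /far_f h; apply: le_trans h _; rewrite ler_wpM2r ?expR_ge0 //; lra.
have R01 : R1 <= R0 by rewrite lerDl divr_ge0 // ltW.
have fcirc w : cabs w = R0 -> f w != 0.
  move=> hw; apply: nonzero; first by apply: far_f'; rewrite hw.
  by move=> m; apply: le_trans (hcirc w m hw); rewrite ru; lra.
have [s [f1 ef1 [hf sR f10]]] := entire_finite_zeros R00 ef
  (fcirc R0%:C (ltac:(by rewrite cabsR gtr0_norm))).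
have {}sR a : a \in s -> cabs a < R0.
  move=> as_; rewrite lt_neqAle sR // andbT; apply/eqP => /fcirc.
  by rewrite hf mulf_eq0 prodX_eq0 as_.
have [d2 d20 hd2] := hurwitz R00 ef ef1 hf f10 sR eps0.
(* The second bound undoes, on the circle [|w| = R0], the factor [w] and the largest value
   [expR (R0 * L)] of the weight. *)
pose eta := Num.min (e0 / 2) (d2 * R0 * expR (- (R0 * L))).
have eta0 : 0 < eta by rewrite lt_min divr_gt0 //= !mulr_gt0 ?expR_gt0.
exists eta => // g eg hfg.
have far_g w : R1 <= cabs w -> cabs (w * g w - csin (w * L%:C)) <= e0 * expR (`|cim w| * L).
  move=> hw; have h1 := far_f w hw; have h2 := hfg w.
  have h3 : eta * expR (`|cim w| * L) <= e0 / 2 * expR (`|cim w| * L).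
    by rewrite ler_wpM2r ?expR_ge0 // ge_min lexx.
  have := ler_cabsB (w * f w - csin (w * L%:C)) (w * f w - w * g w).
  have -> : w * f w - csin (w * L%:C) - (w * f w - w * g w) = w * g w - csin (w * L%:C) by ring.
  lra.
have close w : cabs w <= R0 -> cabs (f w - g w) <= d2.
  move=> hw; apply: (@entire_max _ (fun w => f w - g w) 0 R0 d2 R00); last by rewrite subr0.
    exact: entireB.
  move=> z; rewrite subr0 => hz; rewrite -(ler_pM2l R00) -{1}hz -cabsM mulrBr.
  apply: le_trans (hfg z) _.
  apply: (@le_trans _ _ (d2 * R0 * expR (- (R0 * L)) * expR (R0 * L))).
    apply: ler_pM; [exact: ltW|exact: expR_ge0|by rewrite ge_min lexx orbT|].
    by rewrite ler_expR ler_wpM2r ?(ltW L0) // -hz cim_le_cabs.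
  by rewrite -mulrA -expRD addNr expR0 mulr1 mulrC.
have [t [g1 eg1 [st std tR hg g10]]] := hd2 g eg close.
pose good h (m : int) (p : C * (C -> C)) := (n0 < `|m|)%N -> entire p.2 /\
  [/\ cabs (p.1 - ctr m) <= eps / 2, cabs (p.1 - ctr m) < r,
    forall w, h w = (w - p.1) * p.2 w & forall w, cabs (w - ctr m) <= r -> p.2 w != 0].
have ex h : entire h ->
    (forall w, R1 <= cabs w -> cabs (w * h w - csin (w * L%:C)) <= e0 * expR (`|cim w| * L)) ->
    exists p, forall m, good h m (p m).
  move=> eh hh; suff /choice[p hp] : forall m, exists p, good h m p by exists p.
  move=> m; have [mn|mn] := ltnP n0 `|m|%N.
    by have [b [h' eh' H]] := zone h m eh mn hh; exists (b, h').
  (* Placeholder for the central indices, where [good] is vacuous. *)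
  by exists (0, fun=> 0) => mn'; rewrite ltnNge mn in mn'.
have [pf hpf] := ex f ef far_f'.
have [pg hpg] := ex g eg far_g.
pose sel (h h1 : C -> C) (p : int -> C * (C -> C)) (i : option int) :=
  if i is Some m then (if (n0 < `|m|)%N then (p m).2 else h) else h1.
pose lst (s : seq C) (p : int -> C * (C -> C)) (i : option int) :=
  if i is Some m then (if (n0 < `|m|)%N then [:: (p m).1] else [::]) else s.
(* [None] is the large disc with its finite lists, [Some m] the small disc at a remote centre; for
   central [m] the region and its lists are empty. *)
pose D (i : option int) : set C := if i is Some m then [set w | (n0 < `|m|)%N /\ cabs (w - ctr m) <= r]
  else [set w | cabs w <= R0].
have disj0 w m : cabs w <= R0 -> (n0 < `|m|)%N -> cabs (w - ctr m) <= r -> False.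
  move=> h1 mn h2.
  have h : n0%:R + 1 <= `|m|%N%:R :> R by rewrite natr1 ler_nat.
  have := ler_wpM2r (ltW u0) h; have := lerB_cabs (ctr m) w.
  by rewrite cabsB ctrE ru /R0 /R1 in h1 h2 *; lra.
have cover h : (forall w, R1 <= cabs w -> cabs (w * h w - csin (w * L%:C)) <= e0 * expR (`|cim w| * L)) ->
    forall z, h z = 0 -> exists i, D i z.
  move=> hh z hz; have [zR|Rz] := leP (cabs z) R0; first by exists None.
  have zR1 : R1 <= cabs z by apply: le_trans (ltW Rz).
  have [m hm] : exists m : int, cabs (z - ctr m) < r.
    apply: contrapT => hno; have := nonzero h z (hh z zR1); rewrite hz eqxx => H.
    suff : false by []. apply: H => m; rewrite leNgt; apply/negP => hm.
    by apply: hno; exists m.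
  exists (Some m); split; last exact: ltW.
  rewrite ltnNge; apply/negP => mn.
  have hmn : `|m|%N%:R <= n0%:R :> R by rewrite ler_nat.
  have := ler_wpM2r (ltW u0) hmn; have := lerB_cabs z (ctr m).
  by rewrite ctrE ru /R0 /R1 in hm Rz *; lra.
apply: (@zeros_matching R (option int) D f g (sel f f1 pf) (sel g g1 pg) (lst s pf) (lst t pg)).
- move=> [m|] [n|] z //=.
  + move=> [mn hm] [nn hn]; congr Some; apply/eqP/negPn/negP => mnn.
    have := ctr_dist mnn; have := ler_cabsB (z - ctr n) (z - ctr m).
    have -> : z - ctr n - (z - ctr m) = ctr m - ctr n by ring.
    by rewrite -/u ru in hm hn *; lra.
  + by move=> [mn hm] zR; case: (disj0 _ _ zR mn hm).
  + by move=> zR [mn hm]; case: (disj0 _ _ zR mn hm).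
- by move=> [m|] //=; case: ifP => // /hpf[].
- by move=> [m|] //=; case: ifP => // /hpg[].
- move=> [m|] w //=; case: ifP => [/hpf[_ [_ _ -> _]]|_].
    by rewrite prodX_cons prodX_nil mulr1.
  by rewrite prodX_nil mul1r.
- move=> [m|] w //=; case: ifP => [/hpg[_ [_ _ -> _]]|_].
    by rewrite prodX_cons prodX_nil mulr1.
  by rewrite prodX_nil mul1r.
- move=> [m|] w /=; last exact: f10.
  by move=> [mn hm]; rewrite mn; have [_ [_ _ _]] := hpf m mn; apply.
- move=> [m|] w /=; last exact: g10.
  by move=> [mn hm]; rewrite mn; have [_ [_ _ _]] := hpg m mn; apply.
- move=> [m|] a /=; last by move=> /sR/ltW.
  case: ifP => // mn; rewrite inE => /eqP->; split=> //.
  by have [_ [_ /ltW]] := hpf m mn.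
- move=> [m|] a /=; last by move=> /tR/ltW.
  case: ifP => // mn; rewrite inE => /eqP->; split=> //.
  by have [_ [_ /ltW]] := hpg m mn.
- exact: cover.
- exact: cover.
- by move=> [m|] //=; case: ifP.
- move=> [m|] k /=; last exact: std.
  case: ifP => // mn; case: k => //= _.
  have [_ [h1 _ _ _]] := hpf m mn; have [_ [h2 _ _ _]] := hpg m mn.
  have := ler_cabsB ((pf m).1 - ctr m) ((pg m).1 - ctr m).
  have -> : (pf m).1 - ctr m - ((pg m).1 - ctr m) = (pf m).1 - (pg m).1 by ring.
  lra.
Qed.

Lemma csin_neq0_off_real (w : C) : cim w != 0 -> csin (w * L%:C) != 0.
Proof.
move=> w0; apply/eqP => /csin_eq0[h _]; move: h; rewrite cimM cimR creR mulr0 add0r => /eqP.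
by rewrite mulf_eq0 (negbTE w0) (gt_eqF L0).
Qed.

(** Both sinc terms have numerator [- sin (2 rho L) = - 2 sin (rho L) cos (rho L)], and [1 / (rho -
    a) + 1 / (rho + a) = 2 rho / (rho ^ 2 - a ^ 2)]; the prefactor [1 / (2 rho sin (rho L))] then
    leaves [- kap n rho / L]. Off the real axis every denominator is nonzero. *)
Lemma SN_formulaE (kap : nat -> C -> C) (S : C -> R -> C) (sg : C -> C) N rho :
  (forall n w, ccos (w * L%:C) = (w - (node L n)%:C) * (w + (node L n)%:C) * kap n w) ->
  csin (rho * L%:C) = rho * sg rho -> cim rho != 0 ->
  SN_formula L S N rho = sg rho + GN L kap (S^~ L) N rho.
Proof.
move=> hkap hsg rho_im.
have p0 : pi%:C != 0 :> C by rewrite -cabs_gt0 cabsR gtr0_norm ?pi_gt0.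
have rho0 : rho != 0 by apply: contra rho_im => /eqP->.
have s0 := csin_neq0_off_real rho_im.
rewrite /SN_formula /GN {1}hsg [rho * sg _]mulrC mulfK //; congr (_ + _).
rewrite mulr_sumr -sumrN; apply: eq_bigr => n _.
set nd : C := (node L n)%:C.
have hm : rho - nd != 0.
  apply: contra rho_im => /eqP h; by rewrite -(subrK nd rho) h add0r cimR.
have hp : rho + nd != 0.
  apply: contra rho_im => /eqP h; by rewrite -(addrK nd rho) h sub0r cimN cimR oppr0.
have ndE : (n.*2.+1)%:R * pi%:C = 2 * L%:C * nd.
  by rewrite /nd -nodeE; field; exact: LC.
have ndE' : (n.*2.+1)%:R = 2 * L%:C * nd / pi%:C by rewrite -ndE mulfK.
have a1 : 2 * rho * L%:C / pi%:C - (n.*2.+1)%:R = 2 * L%:C * (rho - nd) / pi%:C.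
  by rewrite ndE'; ring.
have a2 : 2 * rho * L%:C / pi%:C + (n.*2.+1)%:R = 2 * L%:C * (rho + nd) / pi%:C.
  by rewrite ndE'; ring.
have sinodd (z : C) : csin (z + 2 * L%:C * nd) = - csin z.
  by rewrite -ndE mulr_natl csinDnpi -signr_odd /= odd_double expr1 mulN1r.
have sinc (z : C) : z != 0 -> csinc (2 * L%:C * z / pi%:C) = csin (2 * L%:C * z) / (2 * L%:C * z).
  move=> z0; rewrite /csinc !mulf_eq0 invr_eq0 (negbTE LC) (negbTE z0) (negbTE p0) pnatr_eq0 /=.
  by rewrite [pi%:C * _]mulrC divfK.
have s1 : csin (2 * L%:C * (rho - nd)) = - csin (2 * (rho * L%:C)).
  have := sinodd (2 * L%:C * (rho - nd)); have -> : 2 * L%:C * (rho - nd) + 2 * L%:C * nd = 2 * (rho * L%:C) by ring.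
  by move=> ->; rewrite opprK.
have s2 : csin (2 * L%:C * (rho + nd)) = - csin (2 * (rho * L%:C)).
  by rewrite -sinodd; congr csin; ring.
have cf : s_coef L S n = coef L (S^~ L) n.
  rewrite /s_coef nodeE -/nd ndE /coef /remainder -/nd (csin_node L0).
  have e2 : (-1) ^+ n * (-1) ^+ n = 1 :> C by rewrite -exprMn mulrNN mulr1 expr1n.
  have -> : 2 * (-1) ^+ n * (nd * S nd L - (-1) ^+ n) = (-1) ^+ n * (2 * nd * S nd L) - 2 * ((-1) ^+ n * (-1) ^+ n) by ring.
  by rewrite e2; field; exact: LC.
rewrite a1 a2 !sinc // s1 s2 csin2 (hkap n) -/nd cf.
by field; rewrite hm hp s0 LC rho0.
Qed.

End Stability.

(** The bijection between zeros counted with multiplicity expresses both claims: surjectivity says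
    that [SN N] has no other zeros. Continuity determines [SN N] at the removable singularities of
    the formula. *)
Theorem mainTheorem12 (R : realType) (L : R) (q : R -> R[i])
  (S : R[i] -> R -> R[i]) (SN : nat -> R[i] -> R[i]) :
  0 < L ->
  in_L2 L q ->
  (forall rho, is_S_solution L q rho (S rho)) ->
  (forall N, ccontinuous (SN N)) ->
  (forall N rho, rho != 0 -> csin (rho * L%:C) != 0 ->
     SN N rho = SN_formula L S N rho) ->
  forall eps : R, 0 < eps ->
  exists N : nat, exists phi : R[i] * nat -> R[i] * nat,
    set_bij (zeros_mult (fun rho => S rho L)) (zeros_mult (SN N)) phi /\
    (forall p, zeros_mult (fun rho => S rho L) p -> cabs ((phi p).1 - p.1) <= eps).
Proof.
move=> L0 [mre [mim [ire iim]]] hS cSN hSN eps eps0.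
have iq : cinteg L q by split; exact: L2_integ.
have eS := entire_S L0 iq hS.
have [K K0 hK] := S_asymp L0 iq hS.
have [eta eta0 stable] := zeros_stable L0 eS K0 eps0 hK.
have [kap /all_and2[ekap hkap]] := choice (ccos_factor L0).
have [N hN] := interp_approx L0 ekap hkap eS (S_even L0 iq hS) K0 hK eta0.
have [g eg [hg _]] := @csin_div R.
pose sg w := L%:C * g (w * L%:C).
have esg : entire sg by apply: entireZ; exact: (entire_scale L%:C eg).
have hsg w : csin (w * L%:C) = w * sg w by rewrite hg /sg mulrA.
have eSN : entire (fun w => sg w + GN L kap (S^~ L) N w).
  by apply: entireD => //; exact: entire_GN.
(* The right-hand side is entire and agrees with the formula off the real axis, which identifies the
   given continuous extension everywhere. *)
have SNE : forall w, SN N w = sg w + GN L kap (S^~ L) N w.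
  apply: entire_eq_off_real => [|z|w wim]; [exact: cSN|exact: entire_cont|].
  rewrite hSN; [exact: SN_formulaE| |].
    by apply: contra wim => /eqP->.
  exact: csin_neq0_off_real.
exists N; apply: stable => [|w]; first by apply: entire_ext eSN => w; rewrite SNE.
have -> : w * S w L - w * SN N w = defect L kap (S^~ L) N w.
  by rewrite SNE /defect /remainder hsg; ring.
exact: hN.
Qed.
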